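(* Let $(X,d,\mu,\mathcal{E},\mathcal{F})$ be a Dirichlet space satisfying the standing assumptions (A1)–(A3), (HK), (BE) stated in the context, and let $0<\delta<1$. Assume $\alpha_1^{\#}<1$. For a function $f$ on $X$ write $E_t(f)=\{x\in X: f(x)>t\}$. There exist constants $C_1,C_2>0$ such that for any non-negative $f\in L^1(X,\mu)$, $$C_1\int_0^\infty\|\mathbf{1}_{E_t(f)}\|_{1,\alpha_1^{\#}}\,dt\le\|f\|_{1,\alpha_1^{\#}}\le C_2\int_0^\infty\|\mathbf{1}_{E_t(f)}\|_{1,\alpha_1^{\#}}\,dt.$$ In particular, for non-negative $f\in\mathbf{B}^{1,\alpha_1^{\#}}(X)$ one has $\mathbf{1}_{E_t(f)}\in\mathbf{B}^{1,\alpha_1^{\#}}(X)$ for almost every $t>0$. Conversely, for non-negative $f\in L^1(X,\mu)$, if $\mathbf{1}_{E_t(f)}\in\mathbf{B}^{1,\alpha_1^{\#}}(X)$ for almost every $t>0$ and $\int_0^\infty\|\mathbf{1}_{E_t(f)}\|_{1,\alpha_1^{\#}}\,dt<\infty$, then $f\in\mathbf{B}^{1,\alpha_1^{\#}}(X)$.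
   Context: Setting. $(X,d,\mu)$ is a locally compact metric measure space, $\mu$ a Radon measure supported on $X$, and $(\mathcal{E},\mathcal{F})$ is a Dirichlet form on $L^2(X,\mu)$ with heat semigroup $\{P_t\}_{t>0}$ and generator $L$. Write $B(x,r)=\{y: d(x,y)<r\}$. For $\lambda>0$, $1\le p<\infty$, $KS^{\lambda,p}(X)$ is the set of $f\in L^p(X,\mu)$ with $\limsup_{r\to0^+}\int_X\int_{B(x,r)}\frac{|f(x)-f(y)|^p}{r^{\lambda p}\mu(B(x,r))}d\mu(y)d\mu(x)<\infty$. Standing assumptions. (A1) Every ball $B(x,r)$ has compact closure. (A2) There are $c_1,c_2,d_H>0$ with $c_1r^{d_H}\le\mu(B(x,r))\le c_2r^{d_H}$ for all $x\in X$, $r\ge0$. (A3) $(\mathcal{E},\mathcal{F})$ is regular and strongly local. (HK) $\{P_t\}$ has a continuous heat kernel $p_t(x,y)$ and there are $c_3,c_4,c_5,c_6\in(0,\infty)$, $d_W\in[2,\infty)$ with $c_5t^{-d_H/d_W}\exp(-c_6(d(x,y)^{d_W}/t)^{1/(d_W-1)})\le p_t(x,y)\le c_3t^{-d_H/d_W}\exp(-c_4(d(x,y)^{d_W}/t)^{1/(d_W-1)})$ for $\mu\times\mu$-a.e. $(x,y)$ and every $t>0$. (BE) There is $C>0$ such that $|P_tg(x)-P_tg(y)|\le C\frac{d(x,y)^\kappa}{t^{\kappa/d_W}}\|g\|_{L^\infty(X,\mu)}$ for all $t>0$, $g\in L^\infty(X,\mu)$, $x,y\in X$, where $0<\kappa<d_W$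 is defined by $d_W-\kappa=\sup\{\lambda>0: KS^{\lambda,1}(X)\text{ contains non-constant functions}\}$. Subordinated semigroup. For fixed $0<\delta<1$ let $\eta^{(\delta)}_t\ge0$ be the continuous function with $\int_0^\infty\eta^{(\delta)}_t(s)e^{-s\lambda}ds=e^{-t\lambda^\delta}$ for $\lambda>0$. The semigroup with generator given by the fractional Laplacian $(-L)^\delta$ is $P^{(\delta)}_tf=\int_0^\infty\eta^{(\delta)}_t(s)P_sf\,ds$, with heat kernel $p^{(\delta)}_t(x,y)=\int_0^\infty\eta^{(\delta)}_t(s)p_s(x,y)ds$. Besov classes. For $p\ge1$, $\alpha\ge0$: $\|f\|_{p,\alpha}=\sup_{t>0}t^{-\alpha}\left(\int_X\int_X|f(x)-f(y)|^pp^{(\delta)}_t(x,y)d\mu(x)d\mu(y)\right)^{1/p}\in[0,\infty]$ and $\mathbf{B}^{p,\alpha}(X)=\{f\in L^p(X,\mu):\|f\|_{p,\alpha}<\infty\}$. The $L^1$ critical exponent is $\alpha_1^{\#}=\sup\{\alpha>0:\mathbf{B}^{1,\alpha}(X)\text{ contains non-constant functions}\}$; the condition $\alpha_1^{\#}<1$ is equivalent to $\delta>1-\frac{\kappa}{d_W}$. *)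

(* Defs.v *)
From HB Require Import structures.
From mathcomp Require Import all_boot all_order all_algebra.
From mathcomp Require Import all_classical all_reals all_analysis.

Set Implicit Arguments.
Unset Strict Implicit.
Unset Printing Implicit Defensive.

Import Order.TTheory GRing.Theory Num.Theory.
Import numFieldNormedType.Exports.

Local Open Scope classical_set_scope.
Local Open Scope ring_scope.

(* Metric spaces equipped with their Borel sigma-algebra.  The distance is
   [mdist], and [ball x r] is the open ball [set y | mdist x y < r]. *)
HB.mixin Record isBorelMetric (d : measure_display) (R : realType) T
    & Measurable d T & Metric R T := {
  borel_measurableE : (measurable : set (set T)) = <<s (open : set (set T)) >>
}.

#[short(type="borelMetricType")]
HB.structure Definition BorelMetric (d : measure_display) (R : realType) :=
  { T of Measurable d T & Metric R T & isBorelMetric d R T }.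

(* Elements of L^p(X, mu) are represented by Borel functions X -> R, members of
   [Lfun mu p]; [F], the domain of a form, is a set of such functions that is
   closed under a.e. equality.  Sigma-finiteness of mu, needed to form
   mu \x mu, is automatic as soon as balls have finite measure. *)
Section dirichlet_space.
Context (R : realType) (d : measure_display) (X : borelMetricType d R).
Variable mu : {sigma_finite_measure set X -> \bar R}.
Implicit Types (f g h : X -> R) (t r lambda alpha : R).

Definition radon_measure : Prop :=
  [/\ forall K : set X, compact K -> (mu K < +oo)%E,
      forall A : set X, measurable A ->
        mu A = ereal_inf [set mu U | U in [set U | open U /\ A `<=` U]]
    & forall U : set X, open U ->
        mu U = ereal_sup [set mu K | K in [set K | compact K /\ K `<=` U]]].

Definition full_support : Prop :=
  forall U : set X, open U -> U !=set0 -> (0 < mu U)%E.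

Definition L2norm f : \bar R := 'N[mu]_2%:E[EFin \o f]%E.

Definition L2inner f g : R := \int[mu]_x (f x * g x).

Section form.
Variables (E : (X -> R) -> (X -> R) -> R) (F : set (X -> R)).

(* The squared norm of the Hilbert space F. *)
Definition form1 f : R := E f f + L2inner f f.

Record dirichlet_form : Prop := {
  form_L2 : forall f, F f -> f \in Lfun mu 2%:E ;
  form_ae : forall f g, F f -> g \in Lfun mu 2%:E -> f = g %[ae mu] ->
    F g /\ forall h, F h -> E g h = E f h ;
  form_0 : F (fun=> 0) ;
  form_lin : forall (a : R) f g, F f -> F g -> F (fun x => a * f x + g x) ;
  form_dense : forall f, f \in Lfun mu 2%:E -> forall e : R, 0 < e ->
    exists g, F g /\ (L2norm (f \- g)%R < e%:E)%E ;
  form_bilinear : forall (a : R) f g h, F f -> F g -> F h ->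
    E (fun x => (a * f x + g x)%R) h = a * E f h + E g h ;
  form_sym : forall f g, F f -> F g -> E f g = E g f ;
  form_ge0 : forall f, F f -> 0 <= E f f ;
  form_closed : forall u : nat -> X -> R, (forall n, F (u n)) ->
    (forall e : R, 0 < e -> exists N : nat, forall m n : nat,
       (N <= m)%N -> (N <= n)%N -> form1 (u m \- u n) < e) ->
    exists f, F f /\ (form1 (u n \- f) @[n --> \oo] --> (0 : R)) ;
  form_markov : forall f, F f ->
    let g := fun x => Num.min (Num.max (f x) 0) 1 in F g /\ E g g <= E f f
}.

Definition Cc f : Prop :=
  continuous f /\ compact (closure [set x | f x != 0]).

Definition regular_form : Prop :=
  (forall f, F f -> forall e : R, 0 < e ->
     exists g, [/\ F g, Cc g & form1 (f \- g) < e]) /\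
  (forall f, Cc f -> forall e : R, 0 < e ->
     exists g, [/\ F g, Cc g & forall x, `|f x - g x| < e]).

(* The support of the measure |f| mu; for a continuous f and a measure of full
   support it is the closure of {f <> 0}. *)
Definition ae_support f : set X :=
  ~` \bigcup_(U in [set U : set X |
        open U /\ {ae mu, forall x, U x -> f x = 0}]) U.

Definition strongly_local : Prop :=
  forall f g, F f -> F g -> compact (ae_support f) -> compact (ae_support g) ->
    (exists (V : set X) (c : R), [/\ open V, ae_support g `<=` V
       & {ae mu, forall x, V x -> f x = c}]) ->
    E f g = 0.

(* Graph of the non-positive self-adjoint operator L with E(f, g) = - <L f, g>
   for all g in F. *)
Definition form_operator f h : Prop :=
  [/\ F f, h \in Lfun mu 2%:E & forall g, F g -> E f g = - L2inner h g].

Variable P : R -> (X -> R) -> X -> R.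

(* Graph of the infinitesimal generator of (P_t) on L^2. *)
Definition semigroup_generator f h : Prop :=
  [/\ f \in Lfun mu 2%:E, h \in Lfun mu 2%:E
    & L2norm (fun x => (P t f x - f x) / t - h x) @[t --> 0^'+] --> 0%E].

(* (P_t)_{t > 0} is the heat semigroup of (E, F), i.e., the symmetric strongly
   continuous contraction semigroup on L^2 whose generator is the operator
   associated with the form. *)
Record heat_semigroup : Prop := {
  heat_L2 : forall t f, 0 < t -> f \in Lfun mu 2%:E -> P t f \in Lfun mu 2%:E ;
  heat_ae : forall t f g, 0 < t -> f \in Lfun mu 2%:E -> g \in Lfun mu 2%:E ->
    f = g %[ae mu] -> P t f = P t g %[ae mu] ;
  heat_lin : forall t (a : R) f g, 0 < t ->
    f \in Lfun mu 2%:E -> g \in Lfun mu 2%:E ->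
    P t (fun x => a * f x + g x) = (fun x => a * P t f x + P t g x) %[ae mu] ;
  heat_contraction : forall t f, 0 < t -> f \in Lfun mu 2%:E ->
    (L2norm (P t f) <= L2norm f)%E ;
  heat_sym : forall t f g, 0 < t ->
    f \in Lfun mu 2%:E -> g \in Lfun mu 2%:E ->
    L2inner (P t f) g = L2inner f (P t g) ;
  heat_semi : forall s t f, 0 < s -> 0 < t -> f \in Lfun mu 2%:E ->
    P (s + t) f = P s (P t f) %[ae mu] ;
  heat_continuous : forall f, f \in Lfun mu 2%:E ->
    L2norm (P t f \- f) @[t --> 0^'+] --> 0%E ;
  heat_generator : forall f h, semigroup_generator f h <-> form_operator f h
}.

End form.

Definition ahlfors_regular (dH : R) : Prop :=
  0 < dH /\ exists c1 c2 : R, [/\ 0 < c1, 0 < c2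
    & forall (x : X) r, 0 <= r ->
        ((c1 * r `^ dH)%:E <= mu (ball x r) <= (c2 * r `^ dH)%:E)%E].

(* p t is the integral kernel of P_t for t > 0, and p is continuous on
   (0, +oo) x X x X. *)
Definition continuous_heat_kernel (P : R -> (X -> R) -> X -> R)
    (p : R -> X -> X -> R) : Prop :=
  {within [set z : R * (X * X) | 0 < z.1],
     continuous (fun z => p z.1 z.2.1 z.2.2)} /\
  forall t f, 0 < t -> f \in Lfun mu 2%:E ->
    {ae mu, forall x,
       mu.-integrable setT (fun y => (p t x y * f y)%:E) /\
       P t f x = \int[mu]_y (p t x y * f y)}.

Definition sub_gaussian (dH dW c c' t : R) (x y : X) : R :=
  c * t `^ (- (dH / dW)) *
  expR (- (c' * (mdist x y `^ dW / t) `^ (dW - 1)^-1)).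

Definition heat_kernel_bounds (p : R -> X -> X -> R) (dH dW : R) : Prop :=
  2 <= dW /\ exists c3 c4 c5 c6 : R, [/\ 0 < c3, 0 < c4, 0 < c5, 0 < c6
    & forall t, 0 < t -> {ae (mu \x mu)%E, forall z : X * X,
        sub_gaussian dH dW c5 c6 t z.1 z.2 <= p t z.1 z.2
          <= sub_gaussian dH dW c3 c4 t z.1 z.2}].

Definition nonconstant f : Prop := ~ exists c : R, {ae mu, forall x, f x = c}.

(* [fine] is harmless: balls have finite measure in an Ahlfors regular space. *)
Definition KS_energy lambda (p : R) f r : \bar R :=
  (\int[mu]_x \int[mu]_(y in ball x r)
     (`|f x - f y| `^ p / (r `^ (lambda * p) * fine (mu (ball x r))))%:E)%E.

Definition KS lambda (p : R) : set (X -> R) :=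
  [set f | f \in Lfun mu p%:E
         /\ (limf_esup (KS_energy lambda p f) 0^'+ < +oo)%E].

Definition KS_critical_exponent (p : R) : \bar R :=
  ereal_sup [set lambda%:E | lambda in
    [set lambda : R | 0 < lambda /\ exists2 f, KS lambda p f & nonconstant f]].

(* P_t g is given here, on L^oo, by the kernel p; it is thus defined at every
   point. *)
Definition weak_bakry_emery (p : R -> X -> X -> R) (dW kappa : R) : Prop :=
  exists2 C : R, 0 < C &
    forall t g (x y : X), 0 < t -> g \in Lfun mu +oo%E ->
      (`|\int[mu]_z (p t x z * g z) - \int[mu]_z (p t y z * g z)|%:E
       <= (C * (mdist x y `^ kappa / t `^ (kappa / dW)))%:E
          * 'N[mu]_+oo[EFin \o g])%E.

(* The subordinated kernel, with eta as in [subordinator_density] below. *)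
Definition subordinated_kernel (eta : R -> R -> R) (p : R -> X -> X -> R)
    t (x y : X) : \bar R :=
  (\int[lebesgue_measure]_(s in `]0%R, +oo[) (eta t s * p s x y)%:E)%E.

(* In the definitions below q is meant to be the subordinated kernel.  The
   critical exponent is a supremum in \bar R; [fine] of it is 0 when the set is
   empty. *)
Section besov.
Variable q : R -> X -> X -> \bar R.

Definition besov_norm (p : R) alpha f : \bar R :=
  ereal_sup [set ((t `^ (- alpha))%:E *
    (\int[mu]_y \int[mu]_x ((`|f x - f y| `^ p)%:E * q t x y)) `^ p^-1)%E
    | t in [set t : R | 0 < t]].

Definition besov (p : R) alpha : set (X -> R) :=
  [set f | f \in Lfun mu p%:E /\ (besov_norm p alpha f < +oo)%E].

Definition besov_critical_exponent (p : R) : \bar R :=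
  ereal_sup [set alpha%:E | alpha in
    [set alpha : R | 0 < alpha /\ exists2 f, besov p alpha f & nonconstant f]].

End besov.

Definition superlevel f t : set X := [set x | t < f x].

End dirichlet_space.

(* eta t (t > 0) is the continuous density on (0, +oo) of the delta-stable
   subordinator at time t. *)
Definition subordinator_density (R : realType) (delta : R)
    (eta : R -> R -> R) : Prop :=
  forall t : R, 0 < t ->
    [/\ {within `]0, +oo[, continuous (eta t)},
        forall s : R, 0 < s -> 0 <= eta t s
      & forall lambda : R, 0 < lambda ->
          (\int[lebesgue_measure]_(s in `]0%R, +oo[)
             (eta t s * expR (- (s * lambda)))%:E
           = (expR (- (t * lambda `^ delta)))%:E)%E].

(* Main.v *)
From HB Require Import structures.
Require Import Defs.
From mathcomp Require Import all_boot all_order all_algebra finmap.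
From mathcomp Require Import all_classical all_reals all_analysis.
From mathcomp Require Import measurable_realfun ess_sup_inf ring lra.

(** Write P_s 1_A (x) for the integral of p s x over A, and let the heat energy
W_s(f) be the double integral of p s x y * |f x - f y|.  Its average in s
against eta t is the subordinated energy E_t(f), and the norm of order alpha is
the supremum over t of t^(-alpha) E_t(f).  Put b = 1 - kappa / dW.

The upper bound holds with constant 1.  Since |a - b| is the integral over s > 0
of |1_(s < a) - 1_(s < b)|, the Tonelli theorem gives the coarea formula
[sub_energy_coarea]: E_t(f) is the integral over s > 0 of E_t(1_(f > s)).  A
supremum of integrals is at most the integral of the suprema.

The lower bound needs the converse exchange, which the Fatou lemma allows for
lower limits: the integral over s of the lower limit as t -> 0 of
t^(-alpha) E_t(1_(f > s)) is at most the norm of f.  It remains to dominate, for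
indicators, the supremum over all t by this lower limit
[indicator_besov_norm_le_liminf].  This weak monotonicity is the core of the
proof; its source is the near-monotonicity of the heat loss phi(s), the integral
over A of P_s 1_(A^c), which is half of W_s(1_A) [heat_loss_near_monotone].  By
the weak Bakry-Emery estimate u = P_s 1_A is kappa-Holder continuous with
constant of order s^(-kappa/dW); hence in the time from s to s + h the heat
content of A decreases by at most
   s^(-kappa/dW) * (integral over A x A^c of d(x, y)^kappa p h x y),
which is of order (h/s)^(kappa/dW) phi(c h) by the sub-Gaussian bounds.  Taking
s = h, 2h, ..., n h and summing k^(-kappa/dW) gives phi(n h) <= L n^b phi(c h):
up to a constant, s^(-b) phi(s) does not increase with s.

Subordination transports this to E_t because the stable law at time t charges a
fixed window around t^(1/delta) [subordinator_window], so that a small E_t(1_A)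
forces phi to be small somewhere in that window and thus at all later times, and
because this law has moments of every order below delta [subordinator_moment],
in particular of order b.

Two facts have to be extracted from the hypotheses.  The step above
uses that the semigroup is conservative, P_t 1 = 1 [heat_mass_eq1].  By the weak
Bakry-Emery estimate P_t 1 is nearly constant at distances below t^(1/dW), so
P_(t+s) 1 (x) - P_s 1 (x) * P_t 1 (x) tends to 0 as t tends to infinity; as P_t 1
is bounded away from 0 and infinity, the ratio P_s 1 (x) must be 1.  Secondly,
the exponent b / delta must be the L^1 critical exponent
[besov_critical_exponentE]: comparing W_s(f) with the energy of f at distances
below s^(1/dW) matches the Besov classes of order alpha < 1 with the
Korevaar-Schoen classes of order alpha * delta * dW, whose critical exponent is
dW - kappa = b * dW. *)

Set Implicit Arguments.
Unset Strict Implicit.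
Unset Printing Implicit Defensive.

Import Order.TTheory GRing.Theory Num.Theory.
Import numFieldNormedType.Exports.

Local Open Scope classical_set_scope.
Local Open Scope ring_scope.

(** * Second countable spaces and measurable products *)

(** Countably many balls exhaust the space, and each is covered by finitely many
balls of radius 1/n, for every n; the interiors of all these form a base. *)
Lemma second_countable_compact_balls (R : realType) (T : pseudoPMetricType R) :
  (forall (x : T) (r : R), compact (closure (ball x r))) ->
  (forall x : T, exists r : R, ball (point : T) r x) -> @second_countable T.
Proof.
move=> cpt bnd.
have npos n : (0 : R) < n.+1%:R^-1 by [].
pose f n (z : T): set T := (ball z (n.+1%:R^-1 : R))°.
have h (m n : nat) :
    finite_subset_cover [set: T] (f n) (closure (ball (point : T) (m%:R : R))).
  have := cpt point m%:R; rewrite compact_cover; apply.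
  - by move=> z _; rewrite /f; exact: open_interior.
  - by move=> z _; exists z => //; rewrite /f /interior; exact: nbhsx_ballx.
pose h' m n := cid (iffLR (exists2P _ _) (h m n)).
pose h'' m n := projT1 (h' m n).
pose B := \bigcup_(mn : nat * nat) ((f mn.2) @` [set` h'' mn.1 mn.2]).
exists B; [|split].
- apply: bigcup_countable => // -[m n] _; apply: finite_set_countable.
  exact/finite_image/finite_fset.
- by move => ? [? _ [? _ <-]]; exact: open_interior.
- move=> x V /nbhs_ballP [] _/posnumP[eps] ballsubV.
  have [//|N] := @ltr_add_invr R 0%R (eps%:num/2) _; rewrite add0r => deleps.
  have [M xM] : exists m : nat, ball (point : T) (m%:R : R) x.
    suff [r xr] : exists r : R, ball (point : T) r x.
      exists (Num.bound r); apply: le_ball xr.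
      by rewrite ltW// (le_lt_trans (ler_norm _))// unstable.ltr_norm_bound.
    exact: bnd.
  have [w wh fx] : exists2 w : T, w \in h'' M N & f N w x.
    by have [_ /(_ x (subset_closure xM))[w wD fw]] := projT2 (h' M N); exists w.
  exists (f N w); first split => //; first by exists (M, N) => //=; exists w.
  apply: (subset_trans _ ballsubV) => z bz.
  rewrite [_%:num]splitr; apply: (@ball_triangle _ _ w).
    by apply: (le_ball (ltW deleps)); apply/ball_sym; apply: interior_subset.
  by apply: (le_ball (ltW deleps)); apply: interior_subset.
Qed.

Lemma open_setX (S T : topologicalType) (U : set S) (V : set T) :
  open U -> open V -> open (U `*` V).
Proof.
move=> oU oV; rewrite openE => -[x y] [/= Ux Vy].
by exists (U, V) => //; split; apply: open_nbhs_nbhs.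
Qed.

Lemma second_countable_prod (S T : topologicalType) :
  @second_countable S -> @second_countable T -> @second_countable (S * T)%type.
Proof.
move=> [B1 cB1 [oB1 bB1]] [B2 cB2 [oB2 bB2]].
exists ((fun UV => UV.1 `*` UV.2) @` (B1 `*` B2)).
  apply: (sub_countable (card_image_le _ _)).
  exact: countableX.
split.
  by move=> _ [[U V] [/= BU BV] <-]; apply: open_setX; [exact: oB1|exact: oB2].
move=> [x y] A [[U V] [/= xU yV] UVA].
have [U' [B1U' xU'] U'U] := bB1 x U xU.
have [V' [B2V' yV'] V'V] := bB2 y V yV.
exists (U' `*` V'); first by split => //; exists (U', V').
by move=> [a b] [/= /U'U Ua /V'V Vb]; exact: UVA.
Qed.

Lemma countable_bigcup_measurable d (T : measurableType d) I (D : set I)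
    (F : I -> set T) :
  countable D -> (forall i, D i -> measurable (F i)) ->
  measurable (\bigcup_(i in D) F i).
Proof.
move=> /countable_injP[f finj] mF.
have -> : \bigcup_(i in D) F i =
    \bigcup_n \bigcup_(i in [set i | D i /\ f i = n]) F i.
  apply/seteqP; split => [x [i Di Fx]|x [n _ [i [Di _] Fx]]].
    by exists (f i) => //; exists i.
  by exists i.
apply: bigcupT_measurable => n.
have [[i [Di fin]]|nD] := pselect (exists i, D i /\ f i = n).
  have -> : [set i | D i /\ f i = n] = [set i].
    apply/seteqP; split => [j [Dj fjn]|_ -> //].
    by apply: finj; rewrite ?inE// fin.
  by rewrite bigcup_set1; exact: mF.
rewrite (_ : [set i | D i /\ f i = n] = set0) ?bigcup_set0//.
by apply/seteqP; split => // i Di; apply: nD; exists i.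
Qed.

(** The product sigma-algebra is generated by rectangles, so an open set of a
product is measurable only because a countable base writes it as a countable
union of rectangles. *)
Lemma measurable_bigcup_rectangles d1 d2 (T1 : measurableType d1)
    (T2 : measurableType d2) (B1 : set (set T1)) (B2 : set (set T2))
    (A : set (T1 * T2)) :
  countable B1 -> countable B2 -> B1 `<=` measurable -> B2 `<=` measurable ->
  (forall z, A z -> exists U V,
     [/\ B1 U, B2 V, U z.1, V z.2 & U `*` V `<=` A]) -> measurable A.
Proof.
move=> cB1 cB2 mB1 mB2 AB.
have -> : A = \bigcup_(UV in [set UV | (B1 `*` B2) UV /\ UV.1 `*` UV.2 `<=` A])
    (UV.1 `*` UV.2).
  apply/seteqP; split => [z /AB[U [V [? ? ? ? ?]]]|z [[U V] [_ UVA] ?]].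
    by exists (U, V).
  exact: UVA.
apply: countable_bigcup_measurable.
  apply: (@sub_countable _ _ _ (B1 `*` B2)); last exact: countableX.
  by apply: subset_card_le => UV [].
by move=> [U V] [[/= /mB1 ? /mB2 ?] _]; exact: measurableX.
Qed.

(** * Measurability of the distance and of the heat kernel *)

Section borel_products.
Context (R : realType).

Lemma realType_second_countable : @second_countable R.
Proof.
apply: second_countable_compact_balls => [x r|x]; last first.
  exists (`|x - point| + 1); rewrite -ball_normE /=.
  by rewrite distrC ltrDl.
apply: (subclosed_compact _ (@segment_compact R (x - r) (x + r))).
  exact: closed_closure.
rewrite [X in _ `<=` X](closure_id `[x - r, x + r]).1; last exact: interval_closed.
apply: closure_subset => y; rewrite -ball_normE /= in_itv/=.
by rewrite ltr_norml => /andP[? ?]; apply/andP; split; lra.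
Qed.

Context (d : measure_display) (X : borelMetricType d R).
Hypothesis A1 : forall (x : X) (r : R), compact (closure (ball x r)).

Lemma open_borel_measurable (U : set X) : open U -> measurable U.
Proof. by move=> oU; rewrite borel_measurableE; exact: sub_sigma_algebra. Qed.

Lemma borelMetric_second_countable : @second_countable X.
Proof.
apply: second_countable_compact_balls => // x.
by exists (mdist point x + 1); rewrite ballEmdist/= ltrDl.
Qed.

Lemma open_measurable_prod (U : set (X * X)) : open U -> measurable U.
Proof.
move=> oU; have [B cB [oB bB]] := borelMetric_second_countable.
apply: (measurable_bigcup_rectangles cB cB).
- by move=> V /oB; exact: open_borel_measurable.
- by move=> V /oB; exact: open_borel_measurable.
- move=> [x y] Uxy.
  have /= : nbhs (x, y) U by exact: open_nbhs_nbhs.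
  move=> [[V W] [/= /bB[V' [BV' V'x] V'V] /bB[W' [BW' W'y] W'W]] VWU].
  exists V', W'; split => // -[a b] [/= /V'V ? /W'W ?].
  exact: VWU.
Qed.

Lemma open_measurable_prod3 (U : set (R * (X * X))) : open U -> measurable U.
Proof.
move=> oU; have [B cB [oB bB]] := realType_second_countable.
have bX := borelMetric_second_countable.
have [B2 cB2 [oB2 bB2]] := second_countable_prod bX bX.
apply: (measurable_bigcup_rectangles cB cB2).
- by move=> V /oB; exact: open_measurable.
- by move=> V /oB2; exact: open_measurable_prod.
- move=> [x y] Uxy.
  have /= : nbhs (x, y) U by exact: open_nbhs_nbhs.
  move=> [[V W] [/= /bB[V' [BV' V'x] V'V] /bB2[W' [BW' W'y] W'W]] VWU].
  exists V', W'; split => // -[a b] [/= /V'V ? /W'W ?].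
  exact: VWU.
Qed.

Lemma metric_ball_open (x : X) (r : R) : open (ball x r).
Proof.
rewrite openE => y; rewrite ballEmdist/= => xy.
have r0 : 0 < r - mdist x y by rewrite subr_gt0.
apply/nbhs_ballP; exists (r - mdist x y) => // z; rewrite !ballEmdist/= => yz.
by have := metric_triangle x y z; lra.
Qed.

Lemma open_mdist_lt (r : R) : open [set z : X * X | mdist z.1 z.2 < r].
Proof.
rewrite openE => -[x y] /= xyr.
pose e := (r - mdist x y) / 2; have e0 : 0 < e by rewrite divr_gt0// subr_gt0.
exists (ball x e, ball y e) => /=; first by split; exact: nbhsx_ballx.
move=> [a b] [/=]; rewrite !ballEmdist/= => xa yb.
have := metric_triangle a x b; have := metric_triangle x y b.
rewrite (metric_sym a x) => ? ?.
rewrite (@le_lt_trans _ _ (mdist x a + (mdist x y + mdist y b)))//; first lra.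
by move: xa yb; rewrite /e; lra.
Qed.

Lemma measurable_mdist :
  measurable_fun [set: X * X] (fun z => mdist z.1 z.2).
Proof.
apply: (measurability _ (RGenInftyO.measurableE R)) => //.
move=> _ [_ [a ->] <-]; apply: measurableI => //.
apply: open_measurable_prod.
rewrite (_ : _ @^-1` _ = [set z : X * X | mdist z.1 z.2 < a]).
  exact: open_mdist_lt.
by apply/seteqP; split => z /=; rewrite in_itv.
Qed.

Lemma open_pos_time : open [set z : R * (X * X) | 0 < z.1].
Proof.
rewrite openE => -[t z] /= t0; exists ([set s | 0 < s], setT) => /=.
  split; last exact: filterT.
  by apply: open_nbhs_nbhs; split; [exact: open_gt|].
by move=> [s w] [].
Qed.

(** Joint measurability in time and space is what the exchange of the integrals
over s, x and y rests on. *)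
Lemma measurable_continuous_kernel (p : R -> X -> X -> R) :
  {within [set z : R * (X * X) | 0 < z.1],
     continuous (fun z => p z.1 z.2.1 z.2.2)} ->
  measurable_fun [set z : R * (X * X) | 0 < z.1]
    (fun z => p z.1 z.2.1 z.2.2).
Proof.
have oD := open_pos_time.
rewrite continuous_open_subspace// => /(continuous_inP _ oD) cp.
apply: (measurability _ (RGenOpens.measurableE R)).
move=> _ [_ [a [b ->] <-]]; apply: open_measurable_prod3; apply: cp.
exact: interval_open.
Qed.

End borel_products.

(** * Real inequalities *)

Section real_bounds.
Context (R : realType).
Implicit Types (a b x y r t : R).

Lemma powR_le1X a x (n : nat) : 0 <= a -> a <= n%:R -> 0 <= x ->
  x `^ a <= 1 + x ^+ n.
Proof.
move=> a0 an x0; have [x1|x1] := leP 1 x.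
  rewrite (le_trans (ler_powR x1 an))// powR_mulrn//; lra.
have : x `^ a <= 1 `^ a by rewrite ge0_ler_powR ?nnegrE// ltW.
by rewrite powR1 => /le_trans; apply; rewrite lerDl exprn_ge0.
Qed.

Lemma le_powR a x y : 0 <= a -> 0 <= x -> x <= y -> x `^ a <= y `^ a.
Proof.
by move=> a0 x0 xy; apply: ge0_ler_powR; rewrite ?nnegrE// (le_trans x0).
Qed.

Lemma gt0_powRD x a b : 0 < x -> x `^ (a + b) = x `^ a * x `^ b.
Proof. by move=> x0; rewrite powRD// (gt_eqF x0) implybT. Qed.

Lemma gt0_powRB x a b : 0 < x -> x `^ (a - b) = x `^ a / x `^ b.
Proof. by move=> x0; rewrite gt0_powRD// powRN. Qed.

(** Only one term of the exponential series matters: y^a <= 1 + y^n for an integer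
n >= a, and (b y)^n / n! <= exp (b y). *)
Lemma powR_expR_bounded a b : 0 <= a -> 0 < b ->
  exists2 C : R, 0 < C & forall y, 0 <= y -> y `^ a * expR (- (b * y)) <= C.
Proof.
move=> a0 b0; pose n := Num.bound a.
have an : a <= n.+1%:R.
  rewrite ltW// (le_lt_trans (ler_norm _))// (lt_le_trans (unstable.ltr_norm_bound _))//.
  by rewrite ler_nat.
have fb : 0 < n.+1`!%:R / b ^+ n.+1 by rewrite divr_gt0 ?exprn_gt0// ltr0n fact_gt0.
exists (1 + n.+1`!%:R / b ^+ n.+1) => [|y y0]; first lra.
have by0 : 0 <= b * y by rewrite mulr_ge0// ltW.
rewrite expRN ler_pdivrMr ?expR_gt0//.
apply: (le_trans (powR_le1X a0 an y0)).
rewrite mulrDl mul1r lerD//; first by rewrite -[leLHS]addr0 (le_trans _ (expR_ge1Dx _)) ?lerD.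
rewrite -ler_pdivrMl// invf_div.
apply: (le_trans _ (expR_ge1Dxn n by0)).
by rewrite exprMn mulrAC ler_wpDl// mulrC.
Qed.

Lemma dyadic_scale x : 0 <= x ->
  exists k : nat, x < 2 ^+ k /\ ((k = 0%N) \/ (2 ^+ k <= 2 * x)).
Proof.
move=> x0.
have [n xn] : exists n : nat, x < 2 ^+ n.
  exists (Num.bound x); rewrite (le_lt_trans (ler_norm _))//.
  rewrite (lt_le_trans (unstable.ltr_norm_bound _))//.
  by rewrite -natrX ler_nat ltnW// ltn_expl.
have ex : exists n : nat, x < 2 ^+ n by exists n.
case: (ex_minnP ex) => k xk kmin; exists k; split => //.
case: k xk kmin => [|k] xk kmin; [by left|right].
rewrite exprS ler_pM2l// leNgt; apply/negP => /kmin.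
by rewrite ltnn.
Qed.

(** Up to a factor 2, the derivative b x^(b-1) is at most the increment of x^b, so
that the sum of k^(b-1) for k <= n telescopes to a multiple of n^b. *)
Lemma powR_increment b (n : nat) : 0 < b -> b < 1 ->
  n.+1%:R `^ (b - 1) <= 2 / b * (n.+2%:R `^ b - n.+1%:R `^ b).
Proof.
move=> b0 b1.
have n1 : 0 < n.+1%:R :> R by [].
have n2 : 0 < n.+2%:R :> R by [].
(* Young inequality with weights b and 1 - b *)
have young : n.+1%:R `^ b * n.+2%:R `^ (1 - b) <=
    b * n.+1%:R + (1 - b) * n.+2%:R :> R.
  have := @conjugate_powR R (n.+1%:R `^ b) (n.+2%:R `^ (1 - b)) b^-1 (1 - b)^-1
    (powR_ge0 _ _) (powR_ge0 _ _).
  rewrite !invr_gt0 subr_gt0 b0 b1 !invrK => /(_ isT isT).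
  rewrite subrKC => /(_ erefl).
  rewrite -!powRrM !mulfV ?powRr1//; last 2 first.
    by rewrite subr_eq0 gt_eqF.
    by rewrite gt_eqF.
  by rewrite ![b * _]mulrC ![(1 - b) * _]mulrC.
have inc : b * n.+2%:R `^ (b - 1) <= n.+2%:R `^ b - n.+1%:R `^ b :> R.
  have P0 : 0 < n.+2%:R `^ (1 - b) :> R by exact: powR_gt0.
  rewrite -(ler_pM2r P0) mulrBl -mulrA -!gt0_powRD//.
  rewrite subrKA subrKC subrr powRr0 mulr1 powRr1//.
  move: young; rewrite -[n.+2%:R]natr1; lra.
(* n.+2 <= 2 n.+1 allows replacing the derivative at n.+2 by that at n.+1 *)
have half : n.+1%:R `^ (b - 1) <= 2 * n.+2%:R `^ (b - 1) :> R.
  rewrite -opprB !powRN.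
  rewrite ler_pdivlMr ?powR_gt0// ler_pdivrMl ?powR_gt0//.
  have : n.+2%:R `^ (1 - b) <= (2 * n.+1%:R) `^ (1 - b) :> R.
    have h : n.+2%:R <= 2 * n.+1%:R :> R.
      by rewrite -natrM ler_nat mulSn mul1n addSn addnS !ltnS leq_addr.
    by apply: ge0_ler_powR h; rewrite ?nnegrE ?subr_ge0 ?mulr_ge0// ltW.
  move=> /le_trans; apply.
  rewrite powRM// mulrC ler_pM2l ?powR_gt0// ler1_powR//; lra.
apply: (le_trans half); rewrite -mulrA ler_pM2l// mulrC ler_pdivlMr// mulrC.
exact: inc.
Qed.

End real_bounds.

(** * Sub-Gaussian profiles *)

Section sub_gaussian_profile.
Context (R : realType).
Implicit Types (a b c m r t u : R).
Variable dW : R.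
Hypothesis dW2 : 2 <= dW.

(** The exponent in sub-Gaussian bounds.  It equals 1 at distance t^(1/dW). *)
Definition stretch t r : R := (r `^ dW / t) `^ (dW - 1)^-1.

Let dW0 : 0 < dW. Proof. by move: dW2; lra. Qed.
Let dW1 : 0 < dW - 1. Proof. by move: dW2; lra. Qed.
Let dWN0 : dW != 0. Proof. by rewrite gt_eqF. Qed.
Let dW1N0 : dW - 1 != 0. Proof. by rewrite gt_eqF. Qed.
Let idW : 0 < (dW - 1)^-1. Proof. by rewrite invr_gt0. Qed.

Lemma stretch_ge0 t r : 0 <= stretch t r.
Proof. exact: powR_ge0. Qed.

Lemma le_stretch t r u : 0 < t -> 0 <= r -> r <= u -> stretch t r <= stretch t u.
Proof.
move=> t0 r0 ru; apply: le_powR; [exact: ltW|by rewrite divr_ge0 ?powR_ge0 ?ltW|].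
by rewrite ler_pM2r ?invr_gt0//; apply: le_powR => //; exact: ltW.
Qed.

Lemma stretchM t r a : 0 < t -> 0 <= r -> 0 <= a ->
  stretch t (a * r) = a `^ (dW / (dW - 1)) * stretch t r.
Proof.
move=> t0 r0 a0; rewrite /stretch (powRM _ a0 r0) -mulrA powRM ?divr_ge0 ?powR_ge0 ?ltW//.
by rewrite -powRrM.
Qed.

Lemma stretch_moment t r a : 0 < t -> 0 <= r ->
  r `^ a / t `^ (a / dW) = stretch t r `^ (a / dW * (dW - 1)).
Proof.
move=> t0 r0; rewrite /stretch -powRrM mulrCA mulVf// mulr1.
rewrite powRM ?powR_ge0 ?invr_ge0 ?ltW// -powRrM mulrCA mulfV// mulr1.
by rewrite -[t^-1]powR_inv1 ?ltW// -powRrM mulN1r powRN.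
Qed.

Lemma stretch_time t u c r : 0 < c -> 0 < t -> 0 <= r -> c * t <= u ->
  c `^ (dW - 1)^-1 * stretch u r <= stretch t r.
Proof.
move=> c0 t0 r0 ctu; have u0 : 0 < u by apply: lt_le_trans ctu; exact: mulr_gt0.
have ru0 : 0 <= r `^ dW / u by rewrite divr_ge0 ?powR_ge0 ?ltW.
rewrite /stretch -(powRM _ (ltW c0) ru0).
apply: le_powR; [exact: ltW|by rewrite mulr_ge0 ?divr_ge0 ?powR_ge0 ?ltW|].
rewrite mulrCA ler_wpM2l ?powR_ge0//.
by rewrite ler_pdivrMr// mulrC ler_pdivlMr// mulrC.
Qed.

Lemma stretch_diag t : 0 < t -> stretch t (t `^ dW^-1) = 1.
Proof.
move=> t0; rewrite /stretch -powRrM mulVf// powRr1 ?ltW// divff ?gt_eqF//.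
by rewrite powR1.
Qed.

(** The upper profile at time t is dominated by the lower profile at a later time
u comparable to t: the stretch decreases with time, so a large enough dilation c
compensates for c6 > c4 and even leaves an exponential factor to absorb any
power of the distance. *)
Lemma sub_gaussian_dilation (dH : R) c3 c4 c5 c6 :
  0 <= dH -> 0 < c3 -> 0 < c4 -> 0 < c5 -> 0 < c6 ->
  exists2 c, 0 < c & forall a, 0 <= a -> exists2 K, 0 < K &
    forall t u r, 0 < t -> 0 <= r -> c * t <= u -> u <= 2 * c * t ->
    r `^ a * (c3 * t `^ (- (dH / dW)) * expR (- (c4 * stretch t r))) <=
    K * t `^ (a / dW) * (c5 * u `^ (- (dH / dW)) * expR (- (c6 * stretch u r))).
Proof.
move=> dH0 c30 c40 c50 c60.
(* with this c, c6 * stretch u r <= (c4 / 2) * stretch t r as soon as c t <= u *)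
pose c := (2 * c6 / c4) `^ (dW - 1).
have c0 : 0 < c by rewrite powR_gt0// divr_gt0// mulr_gt0.
exists c => // a a0.
have e0 : 0 <= a / dW * (dW - 1).
  by apply: mulr_ge0; [apply: divr_ge0 => //|]; rewrite ltW.
have c42 : 0 < c4 / 2 by rewrite divr_gt0.
have [C C0 CP] := @powR_expR_bounded R _ (c4 / 2) e0 c42.
exists (C * c3 / c5 * (2 * c) `^ (dH / dW)).
  by rewrite !mulr_gt0 ?invr_gt0 ?powR_gt0 ?mulr_gt0.
move=> t u r t0 r0 ctu utc.
have u0 : 0 < u by apply: lt_le_trans ctu; exact: mulr_gt0.
have -> : r `^ a = t `^ (a / dW) * stretch t r `^ (a / dW * (dW - 1)).
  by rewrite -stretch_moment// mulrCA divff ?mulr1// gt_eqF ?powR_gt0.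
set S := stretch t r; set T := t `^ _; set e := a / dW * _.
have S0 : 0 <= S by exact: stretch_ge0.
have h1 : expR (- (c4 * S)) <= expR (- (c4 / 2 * S)) * expR (- (c6 * stretch u r)).
  rewrite -expRD ler_expR.
  have := stretch_time c0 t0 r0 ctu; rewrite /c -powRrM mulfV// powRr1; last first.
    by rewrite divr_ge0 ?mulr_ge0 ?ltW.
  rewrite -/S mulrAC ler_pdivrMr// => h; lra.
have h2 : t `^ (- (dH / dW)) <= (2 * c) `^ (dH / dW) * u `^ (- (dH / dW)).
  rewrite !powRN ler_pdivlMr ?powR_gt0// mulrC ler_pdivrMr ?powR_gt0//.
  have cc : 0 <= 2 * c by rewrite mulr_ge0// ltW.
  rewrite -(powRM _ cc (ltW t0)).
  by apply: le_powR; rewrite ?divr_ge0 // ltW.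
have h3 := CP _ S0; rewrite -/e in h3.
have T0 : 0 <= T by exact: powR_ge0.
rewrite [leLHS](_ : _ = T * (c3 * (t `^ (- (dH / dW))) *
   (S `^ e * expR (- (c4 * S))))); last by ring.
rewrite [leRHS](_ : _ = T * (c3 * ((2 * c) `^ (dH / dW) * u `^ (- (dH / dW))) *
   (C * expR (- (c6 * stretch u r))))); last first.
  by field; rewrite gt_eqF.
rewrite ler_wpM2l// ler_pM ?mulr_ge0 ?powR_ge0 ?expR_ge0 ?(ltW c30)//.
  by rewrite ler_wpM2l// ltW.
apply: (le_trans (ler_wpM2l (powR_ge0 _ _) h1)).
by rewrite mulrA ler_wpM2r ?expR_ge0.
Qed.

(** On the annulus of radii about 2^k t^(1/dW) a sub-Gaussian profile is at most
2^(-k m), for any m: the exponential beats all powers of r / t^(1/dW). *)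
Lemma sub_gaussian_dyadic c4 m : 0 < c4 -> 0 <= m ->
  exists2 K, 0 < K & forall t r, 0 < t -> 0 <= r ->
    exists k : nat, r < 2 ^+ k * t `^ dW^-1 /\
      expR (- (c4 * stretch t r)) <= K * (2 ^+ k) `^ (- m).
Proof.
move=> c40 m0.
have e0 : 0 <= m / dW * (dW - 1).
  by apply: mulr_ge0; [apply: divr_ge0 => //|]; rewrite ltW.
have [C C0 CP] := powR_expR_bounded e0 c40.
exists (1 + 2 `^ m * C) => [|t r t0 r0].
  by rewrite ltr_pwDl// mulr_ge0 ?powR_ge0 ?ltW.
have rho0 : 0 < t `^ dW^-1 by exact: powR_gt0.
have [k [rk k2]] := dyadic_scale (divr_ge0 r0 (ltW rho0)).
exists k; split; first by rewrite -ltr_pdivrMr.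
have twok : 0 < 2 ^+ k :> R by rewrite exprn_gt0.
case: k2 => [->|k2].
  rewrite expr0 powR1 mulr1 (@le_trans _ _ 1)//.
    by rewrite -expR0 ler_expR oppr_le0 mulr_ge0 ?stretch_ge0 ?ltW.
  by rewrite lerDl mulr_ge0 ?powR_ge0 ?ltW.
rewrite powRN ler_pdivlMr ?powR_gt0// (@le_trans _ _ (2 `^ m * C))//; last by lra.
have : (2 ^+ k) `^ m <= (2 * (r / t `^ dW^-1)) `^ m.
  by apply: le_powR => //; rewrite ltW.
have r1 : 0 <= r / t `^ dW^-1 by rewrite divr_ge0// ltW.
rewrite (powRM _ (ler0n _ 2) r1) [(r / _) `^ _]powRM ?invr_ge0 ?(ltW rho0)//.
have -> : (t `^ dW^-1)^-1 `^ m = (t `^ (m / dW))^-1.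
  rewrite -[(t `^ dW^-1)^-1]powR_inv1 ?powR_ge0// -!powRrM -powRN.
  by congr (_ `^ _); field.
rewrite stretch_moment// => h.
apply: (le_trans (ler_wpM2l (expR_ge0 _) h)).
by rewrite mulrCA ler_wpM2l ?powR_ge0// mulrC CP// stretch_ge0.
Qed.

End sub_gaussian_profile.

(** * Heat kernel bounds at every point *)

Section heat_kernel_pointwise.
Context (R : realType) (d : measure_display) (X : borelMetricType d R).
Variable mu : {sigma_finite_measure set X -> \bar R}.

Lemma full_support_ball : full_support mu ->
  forall (x : X) (r : R), 0 < r -> (0 < mu (ball x r))%E.
Proof.
move=> supp x r r0; apply: supp; first exact: metric_ball_open.
by exists x; exact: ballxx.
Qed.

Lemma ball_measurable (x : X) (r : R) : measurable (ball x r).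
Proof.
have [r0|r0] := ltP 0 r; first exact/open_borel_measurable/metric_ball_open.
rewrite (_ : ball x r = set0)//; apply/seteqP; split => // y.
rewrite ballEmdist/= => /(le_lt_trans (mdist_ge0 _ _)).
by rewrite ltNge r0.
Qed.

(** Products of balls have positive measure, so a property that holds almost
everywhere holds at points arbitrarily close to any given one. *)
Lemma ae_prod_dense (Q : X * X -> Prop) : full_support mu ->
  {ae (mu \x mu)%E, forall z, Q z} ->
  forall (x y : X) (e : R), 0 < e ->
    exists x' y', [/\ mdist x x' < e, mdist y y' < e & Q (x', y')].
Proof.
move=> supp [N [mN N0 QN]] x y e e0; apply: contrapT => nex.
have sub : ball x e `*` ball y e `<=` N.
  move=> [a b] [/=]; rewrite !ballEmdist/= => xa yb; apply: QN => /= Qab.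
  by apply: nex; exists a, b.
have := @product_measure1E _ _ X X R mu mu _ _ (ball_measurable x e) (ball_measurable y e).
have : ((mu \x mu) (ball x e `*` ball y e) <= (mu \x mu) N)%E.
  by apply: le_measure; rewrite ?inE//; apply: measurableX; exact: ball_measurable.
rewrite N0 => + E; rewrite E leNgt.
by rewrite mule_gt0// full_support_ball.
Qed.

Variable p : R -> X -> X -> R.
Hypothesis cp : {within [set z : R * (X * X) | 0 < z.1],
     continuous (fun z => p z.1 z.2.1 z.2.2)}.

Lemma kernel_continuous_at t (x y : X) (e : R) : 0 < t -> 0 < e ->
  exists2 r : R, 0 < r & forall x' y', mdist x x' < r -> mdist y y' < r ->
    `|p t x y - p t x' y'| < e.
Proof.
move=> t0 e0.
have oD : open [set z : R * (X * X) | 0 < z.1] by exact: open_pos_time.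
have cpt : {for (t, (x, y)), continuous (fun z : R * (X * X) => p z.1 z.2.1 z.2.2)}.
  move: cp; rewrite continuous_open_subspace// => h; apply: h.
  by rewrite inE.
have := cpt (ball (p t x y) e) (nbhsx_ballx _ _ e0).
move=> [[U V] [/= Ut [[V1 V2] [/= V1x V2y] V12]] UV].
have [r1 r10 b1] := iffLR (nbhs_ballP _ _) V1x.
have [r2 r20 b2] := iffLR (nbhs_ballP _ _) V2y.
exists (Num.min r1 r2); first by rewrite lt_min r10 r20.
move=> x' y'; rewrite !lt_min => /andP[xr1 _] /andP[_ yr2].
suff : ball (p t x y) e (p t x' y') by rewrite -ball_normE.
apply: (UV (t, (x', y'))); split => /=; first exact: nbhs_singleton.
by apply: V12; split => /=; [apply: b1|apply: b2]; rewrite ballEmdist.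
Qed.

Variables (dH dW : R).

(** The almost everywhere bounds extend to all points by continuity of the kernel.
The approximating points have a slightly different distance, and the extension
is paid for by the constants c4, c5 and c6. *)
Lemma heat_kernel_bounds_everywhere : full_support mu ->
  heat_kernel_bounds mu p dH dW ->
  2 <= dW /\ exists c3 c4 c5 c6 : R, [/\ 0 < c3, 0 < c4, 0 < c5, 0 < c6
    & forall t x y, 0 < t ->
       c5 * t `^ (- (dH / dW)) * expR (- (c6 * stretch dW t (mdist x y))) <=
       p t x y <=
       c3 * t `^ (- (dH / dW)) * expR (- (c4 * stretch dW t (mdist x y)))].
Proof.
move=> supp [dW2 [c3 [c4 [c5 [c6 [c30 c40 c50 c60 H]]]]]]; split => //.
have dW0 : 0 < dW by lra.
(* doubling the distance multiplies the stretch by b *)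
pose b := 2 `^ (dW / (dW - 1)).
have b0 : 0 < b by exact: powR_gt0.
have T0 t : 0 <= t `^ (- (dH / dW)) by exact: powR_ge0.
exists c3, (c4 / b), (c5 * expR (- (c6 * b))), (c6 * b); split => //.
- by rewrite divr_gt0.
- by rewrite mulr_gt0 ?expR_gt0.
- by rewrite mulr_gt0.
move=> t x y t0; have rho0 : 0 < t `^ dW^-1 by exact: powR_gt0.
have near (e e' : R) : 0 < e -> 0 < e' ->
    exists x' y', [/\ mdist x y <= mdist x' y' + e, mdist x' y' <= mdist x y + e,
      `|p t x y - p t x' y'| < e' &
     sub_gaussian dH dW c5 c6 t x' y' <= p t x' y' <= sub_gaussian dH dW c3 c4 t x' y'].
  move=> e0 e'0; have [r r0 pr] := kernel_continuous_at x y t0 e'0.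
  have m0 : 0 < Num.min r (e / 2) by rewrite lt_min r0 divr_gt0.
  have [x' [y' [xx' yy' Q]]] := ae_prod_dense supp (H t t0) x y m0.
  move: xx' yy'; rewrite !lt_min => /andP[xr xe] /andP[yr ye].
  exists x', y'; split => //; last exact: pr.
  - have := metric_triangle x x' y; have := metric_triangle x' y' y.
    by rewrite (metric_sym y' y); lra.
  - have := metric_triangle x' x y'; have := metric_triangle x y y'.
    by rewrite (metric_sym x' x); lra.
have d0 := mdist_ge0 x y.
apply/andP; split; apply/ler_addgt0Pr => e e0.
(* The distance of the approximating points is at most twice the larger of
   mdist x y and t^(1/dW); at the latter the stretch is 1. *)
- pose m := Num.max (mdist x y) (t `^ dW^-1).
  have m0 : 0 < m by rewrite lt_max rho0 orbT.
  have [x' [y' [_ dd pp /andP[lb _]]]] := near m e m0 e0.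
  have : p t x' y' <= p t x y + e by move: pp; rewrite ltr_norml => /andP[]; lra.
  apply: le_trans; apply: le_trans lb; rewrite /sub_gaussian -/(stretch dW t _).
  have d'm : mdist x' y' <= 2 * m.
    have : mdist x y <= m by rewrite le_max lexx.
    lra.
  have hs : stretch dW t (mdist x' y') <= b * (1 + stretch dW t (mdist x y)).
    apply: (le_trans (le_stretch dW2 t0 (mdist_ge0 _ _) d'm)).
    rewrite stretchM ?(ltW m0)// -/b ler_wpM2l ?(ltW b0)// /m.
    case: (leP (mdist x y) (t `^ dW^-1)) => _.
      by rewrite (stretch_diag dW2 t0) lerDl stretch_ge0.
    by rewrite lerDr.
  rewrite [leLHS](_ : _ = c5 * t `^ (- (dH / dW)) *
     expR (- (c6 * (b * (1 + stretch dW t (mdist x y)))))); last first.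
    have -> : - (c6 * (b * (1 + stretch dW t (mdist x y)))) =
      - (c6 * b) + - (c6 * b * stretch dW t (mdist x y)) by ring.
    by rewrite expRD; ring.
  rewrite ler_wpM2l ?mulr_ge0 ?(ltW c50)//.
  by rewrite ler_expR lerN2; apply: ler_wpM2l => //; exact: ltW.
- have [d00|dn0] := eqVneq (mdist x y) 0.
    have [x' [y' [_ _ pp /andP[_ ub]]]] := near _ _ rho0 e0.
    have : p t x y <= p t x' y' + e by move: pp; rewrite ltr_norml => /andP[]; lra.
    move=> /le_trans; apply; rewrite lerD2r; apply: (le_trans ub).
    rewrite d00 /sub_gaussian -/(stretch dW t _); apply: ler_wpM2l.
      by rewrite mulr_ge0 ?(ltW c30).
    rewrite ler_expR lerN2.
    have -> : stretch dW t 0 = 0.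
      have dWn : dW != 0 by rewrite gt_eqF.
      rewrite /stretch powR0// mul0r powR0// invr_eq0 gt_eqF//; lra.
    by rewrite mulr0; apply: mulr_ge0; [exact: ltW|exact: powR_ge0].
  have dd0 : 0 < mdist x y / 2 by rewrite divr_gt0// lt_neqAle eq_sym dn0.
  have [x' [y' [dd _ pp /andP[_ ub]]]] := near _ _ dd0 e0.
  have : p t x y <= p t x' y' + e by move: pp; rewrite ltr_norml => /andP[]; lra.
  move=> /le_trans; apply; rewrite lerD2r; apply: (le_trans ub).
  rewrite /sub_gaussian -/(stretch dW t _); apply: ler_wpM2l.
    by rewrite mulr_ge0 ?(ltW c30).
  rewrite ler_expR lerN2 mulrAC ler_pdivrMr// -mulrA ler_wpM2l ?(ltW c40)//.
  have h : mdist x y <= 2 * mdist x' y' by lra.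
  apply: (le_trans (le_stretch dW2 t0 d0 h)).
  by rewrite (stretchM _ t0 (mdist_ge0 _ _) (ler0n _ 2)) mulrC.
Qed.

End heat_kernel_pointwise.

(** * The heat semigroup on indicators *)

Section integral_tools.
Context (R : realType) (d : measure_display) (X : measurableType d).
Variable mu : {measure set X -> \bar R}.

Lemma indic_Lfun2 (A : set X) : measurable A -> (mu A < +oo)%E ->
  (\1_A : X -> R) \in Lfun mu 2%:E.
Proof.
move=> mA fA; rewrite inE; apply/andP; split; rewrite inE/=.
  exact: measurable_indic.
rewrite /finite_norm unlock/= poweR_lty//.
rewrite (eq_integral (fun x => (\1_A x)%:E)) => [|x _]; last first.
  rewrite /= indicE; case: (x \in A) => /=.
    by rewrite normr1 powR1.
  by rewrite normr0 powR0.
by rewrite integral_indic// setIT.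
Qed.

Lemma integral_indic_mul (A : set X) (f : X -> R) :
  (\int[mu]_x (f x * \1_A x)%:E = \int[mu]_(x in A) (f x)%:E)%E.
Proof.
rewrite [RHS]integral_mkcond; apply: eq_integral => x _.
by rewrite patchE indicE; case: (x \in A); rewrite ?mulr1 ?mulr0.
Qed.

Lemma ge0_le_integral_cst (A : set X) (f : X -> \bar R) (c : R) :
  measurable A -> measurable_fun A f -> (forall x, A x -> 0 <= f x)%E ->
  0 <= c -> (forall x, A x -> f x <= c%:E)%E ->
  (\int[mu]_(x in A) f x <= c%:E * mu A)%E.
Proof.
move=> mA mf f0 c0 fc; rewrite -(@integral_cst _ _ _ mu A mA c%:E).
by apply: ge0_le_integral => // x Ax; rewrite fc.
Qed.

Lemma ge0_le_cst_integral (A : set X) (f : X -> \bar R) (c : R) :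
  measurable A -> measurable_fun A f -> 
  0 <= c -> (forall x, A x -> c%:E <= f x)%E ->
  (c%:E * mu A <= \int[mu]_(x in A) f x)%E.
Proof.
move=> mA mf c0 fc; rewrite -(@integral_cst _ _ _ mu A mA c%:E).
by apply: ge0_le_integral => // x Ax.
Qed.

End integral_tools.

Section heat_semigroup_kernel.
Context (R : realType) (d : measure_display) (X : borelMetricType d R).
Variable mu : {sigma_finite_measure set X -> \bar R}.
Variables (E : (X -> R) -> (X -> R) -> R) (F : set (X -> R)).
Variables (P : R -> (X -> R) -> X -> R) (p : R -> X -> X -> R).
Hypothesis A1 : forall (x : X) (r : R), compact (closure (ball x r)).
Hypothesis supp : full_support mu.
Hypothesis P_heat : heat_semigroup mu E F P.
Hypothesis HK : continuous_heat_kernel mu P p.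
Hypothesis p0 : forall t x y, 0 < t -> 0 <= p t x y.
Hypothesis ball_fin : forall (x : X) (r : R), (mu (ball x r) < +oo)%E.

Lemma measurable_heat2 t : 0 < t ->
  measurable_fun [set: X * X] (fun z => p t z.1 z.2).
Proof.
move=> t0; have mp := measurable_continuous_kernel A1 HK.1.
pose D := [set z : R * (X * X) | 0 < z.1].
have mD : measurable D by apply: (open_measurable_prod3 A1); exact: open_pos_time.
apply: (@measurable_comp _ _ _ _ _ _ D (fun z : R * (X * X) => p z.1 z.2.1 z.2.2)
   setT (fun z : X * X => (t, z))) => //.
- by move=> _ [z _ <-].
- exact: pair1_measurable.
Qed.

Lemma measurable_heat1 t x : 0 < t -> measurable_fun [set: X] (p t x).
Proof.
move=> t0; apply: (@measurableT_comp _ _ _ _ _ _ (fun z : X * X => p t z.1 z.2)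
  _ (pair x)) => //; exact: measurable_heat2.
Qed.

Definition heat_mass t (A : set X) (x : X) : \bar R :=
  (\int[mu]_(y in A) (p t x y)%:E)%E.

Lemma heat_mass_ge0 t A x : 0 < t -> (0 <= heat_mass t A x)%E.
Proof. by move=> t0; apply: integral_ge0 => y _; rewrite lee_fin p0. Qed.

Lemma measurable_heat_mass t A : 0 < t -> measurable A ->
  measurable_fun [set: X] (heat_mass t A).
Proof.
move=> t0 mA.
rewrite (_ : heat_mass t A = fubini_F mu
   (fun z : X * X => (p t z.1 z.2 * \1_A z.2)%:E)); last first.
  by apply/funext => x; rewrite /fubini_F/= integral_indic_mul.
apply: measurable_fun_fubini_tonelli_F.
  apply/measurable_EFinP; apply: measurable_funM; first exact: measurable_heat2.
  by apply: measurableT_comp => //; exact: measurable_indic.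
by move=> z; rewrite lee_fin mulr_ge0// p0.
Qed.

Lemma heat_massE t A : 0 < t -> measurable A -> (mu A < +oo)%E ->
  {ae mu, forall x, (P t \1_A x)%:E = heat_mass t A x}.
Proof.
move=> t0 mA fA; have := HK.2 t \1_A t0 (indic_Lfun2 mA fA).
apply: filterS => x [ip ->]; rewrite /Rintegral fineK.
  exact: integral_indic_mul.
exact: integrable_fin_num.
Qed.

(** The semigroup is symmetric on L^2; the indicators of A and B are in L^2. *)
Lemma heat_mass_sym t A B : 0 < t -> measurable A -> (mu A < +oo)%E ->
  measurable B -> (mu B < +oo)%E ->
  (\int[mu]_(x in B) heat_mass t A x = \int[mu]_(x in A) heat_mass t B x)%E.
Proof.
move=> t0 mA fA mB fB.
have key C D : measurable C -> (mu C < +oo)%E -> measurable D -> (mu D < +oo)%E ->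
    (\int[mu]_(x in D) heat_mass t C x = (L2inner mu (P t \1_C) \1_D)%:E)%E.
  move=> mC fC mD fD.
  have LC := heat_L2 P_heat t0 (indic_Lfun2 mC fC).
  rewrite /L2inner /Rintegral fineK; last first.
    apply: integrable_fin_num => //.
    exact/Lfun1_integrable/(Lfun2_mul_Lfun1 LC (indic_Lfun2 mD fD)).
  rewrite integral_indic_mul; apply: ae_eq_integral => //.
  - exact: measurable_funTS (measurable_heat_mass t0 mC).
  - apply/measurable_EFinP/measurable_funTS.
    by have /sub_Lfun_mfun := LC; rewrite inE.
  - by apply: filterS (heat_massE t0 mC fC) => x -> _.
rewrite (key A B)// (key B A)//; congr EFin.
rewrite (heat_sym P_heat t0 (indic_Lfun2 mA fA) (indic_Lfun2 mB fB)).
by rewrite /L2inner; under eq_Rintegral => x _ do rewrite mulrC.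
Qed.

(** If p t u v > p t v u, continuity preserves a strict inequality on small balls
U and V around u and v, which contradicts the symmetry of the heat exchanged by U
and V. *)
Lemma heat_kernel_sym t x y : 0 < t -> p t x y = p t y x.
Proof.
move=> t0; suff le u v : p t u v <= p t v u by apply/eqP; rewrite eq_le !le.
rewrite leNgt; apply/negP => lt.
pose e := (p t u v - p t v u) / 3; have e0 : 0 < e by rewrite divr_gt0 ?subr_gt0.
have [r1 r10 h1] := kernel_continuous_at HK.1 u v t0 e0.
have [r2 r20 h2] := kernel_continuous_at HK.1 v u t0 e0.
pose r := Num.min r1 r2; have r0 : 0 < r by rewrite lt_min r10.
have mB z : measurable (ball z r : set X) by exact: ball_measurable.
have bpos z : (0 < mu (ball z r))%E by exact: full_support_ball.
pose U := ball u r; pose V := ball v r.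
have mU : measurable U by exact: mB.
have mV : measurable V by exact: mB.
have fU : mu U \is a fin_num by rewrite ge0_fin_numE ?ball_fin.
have fV : mu V \is a fin_num by rewrite ge0_fin_numE ?ball_fin.
have := heat_mass_sym t0 (mB v) (ball_fin v r) (mB u) (ball_fin u r).
apply/eqP; rewrite gt_eqF//.
have c20 : 0 <= p t v u + e by rewrite addr_ge0 ?p0// ltW.
have c10 : 0 <= p t u v - e.
  have := p0 v u t0; have := p0 u v t0; rewrite /e; lra.
have lower x' y' : U x' -> V y' -> p t u v - e <= p t x' y'.
  rewrite /U /V !ballEmdist/= /r !lt_min => /andP[ux _] /andP[vy _].
  by have := h1 _ _ ux vy; rewrite ltr_norml => /andP[]; lra.
have upper x' y' : V x' -> U y' -> p t x' y' <= p t v u + e.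
  rewrite /U /V !ballEmdist/= /r !lt_min => /andP[_ ux] /andP[_ vy].
  by have := h2 _ _ ux vy; rewrite ltr_norml => /andP[]; lra.
have mass_lower x' : U x' -> ((p t u v - e)%:E * mu V <= heat_mass t V x')%E.
  move=> Ux; apply: ge0_le_cst_integral => //.
    by apply/measurable_EFinP/measurable_funTS; exact: measurable_heat1.
  by move=> y' Vy; rewrite lee_fin lower.
have mass_upper x' : V x' -> (heat_mass t U x' <= (p t v u + e)%:E * mu U)%E.
  move=> Vx; apply: ge0_le_integral_cst => //.
  - by apply/measurable_EFinP/measurable_funTS; exact: measurable_heat1.
  - by move=> y' Vy; rewrite lee_fin p0.
  - by move=> y' Vy; rewrite lee_fin upper.
apply: (@le_lt_trans _ _ (((p t v u + e) * fine (mu U))%:E * mu V)%E).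
  apply: ge0_le_integral_cst => //.
  - by apply: measurable_funTS; exact: measurable_heat_mass.
  - by move=> z _; exact: heat_mass_ge0.
  - by rewrite mulr_ge0 ?fine_ge0.
  - by move=> z Vz; rewrite EFinM fineK// mass_upper.
apply: (@lt_le_trans _ _ (((p t u v - e) * fine (mu V))%:E * mu U)%E); last first.
  apply: ge0_le_cst_integral => //.
  - by apply: measurable_funTS; exact: measurable_heat_mass.
  - by rewrite mulr_ge0 ?fine_ge0.
  - by move=> z Uz; rewrite EFinM fineK// mass_lower.
rewrite -[X in (_ * X < _)%E]fineK// -[X in (_ < _ * X)%E]fineK//.
rewrite -!EFinM lte_fin -!mulrA [fine (mu V) * _]mulrC.
rewrite ltr_pM2r; last first.
  by rewrite mulr_gt0// fine_gt0// bpos ltey_eq ?fU ?fV.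
by rewrite /e; lra.
Qed.

(** The Chapman-Kolmogorov equation integrated over A, which is the semigroup law
at the indicator of A. *)
Lemma heat_mass_semigroup s t A : 0 < s -> 0 < t -> measurable A ->
  (mu A < +oo)%E ->
  {ae mu, forall x,
    heat_mass (s + t) A x = (\int[mu]_z ((p s x z)%:E * heat_mass t A z))%E}.
Proof.
move=> s0 t0 mA fA; have st0 : 0 < s + t by exact: addr_gt0.
have L1 := indic_Lfun2 mA fA.
have Lt := heat_L2 P_heat t0 L1.
have e1 := heat_semi P_heat s0 t0 L1.
have e2 := heat_massE st0 mA fA.
have e3 := heat_massE t0 mA fA.
have e4 := HK.2 s _ s0 Lt.
apply: filterS3 e1 e2 e4 => x e1 <- [ip Psx].
rewrite e1// Psx /Rintegral fineK; last exact: integrable_fin_num.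
apply: ae_eq_integral => //.
- by have /integrableP[] := ip.
- apply: emeasurable_funM; last exact: measurable_heat_mass.
  by apply/measurable_EFinP; exact: measurable_heat1.
- by apply: filterS e3 => z + _; rewrite EFinM => ->.
Qed.

(** The constant 1 is not in L^2 when mu is infinite; it is the increasing limit of
the indicators of balls. *)
Lemma heat_mass_semigroupT s t : 0 < s -> 0 < t ->
  {ae mu, forall x, heat_mass (s + t) setT x =
    (\int[mu]_z ((p s x z)%:E * heat_mass t setT z))%E}.
Proof.
move=> s0 t0; have st0 : 0 < s + t by exact: addr_gt0.
pose A n : set X := ball point n%:R.
have mA n : measurable (A n) by exact: ball_measurable.
have ndA : nondecreasing_seq A.
  by move=> m n mn; apply/subsetPset; apply: le_ball; rewrite ler_nat.
have AT : \bigcup_n A n = setT.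
  apply/seteqP; split => // x _; exists (Num.bound (mdist point x)) => //.
  rewrite /A ballEmdist/= (le_lt_trans (ler_norm _))//.
  exact: unstable.ltr_norm_bound.
have cvgA u x : 0 < u -> heat_mass u (A n) x @[n --> \oo] --> heat_mass u setT x.
  move=> u0; rewrite /heat_mass -AT.
  apply: ge0_nondecreasing_set_cvg_integral => //.
  - by move=> n; apply/measurable_EFinP/measurable_funTS; exact: measurable_heat1.
  - by move=> n y _; rewrite lee_fin p0.
have all_n : {ae mu, forall x, forall n,
    heat_mass (s + t) (A n) x =
    (\int[mu]_z ((p s x z)%:E * heat_mass t (A n) z))%E}.
  by apply/ae_foralln => n; apply: heat_mass_semigroup => //; exact: ball_fin.
apply: filterS all_n => x H.
have c1 := cvgA _ x st0.
have c2 : (\int[mu]_z ((p s x z)%:E * heat_mass t (A n) z))%E @[n --> \oo] -->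
    (\int[mu]_z ((p s x z)%:E * heat_mass t setT z))%E.
  rewrite (_ : (\int[mu]_z _)%E = (\int[mu]_z
      limn (fun n => (p s x z)%:E * heat_mass t (A n) z))%E); last first.
    apply: eq_integral => z _; apply/esym/cvg_lim => //.
    by apply: cvgeZl => //; exact: cvgA.
  apply: cvg_monotone_convergence => //.
  - move=> n; apply: emeasurable_funM; last exact: measurable_heat_mass.
    by apply/measurable_EFinP; exact: measurable_heat1.
  - by move=> n z _; rewrite mule_ge0 ?heat_mass_ge0// lee_fin p0.
  - move=> z _ m n mn; rewrite lee_wpmul2l ?lee_fin ?p0//.
    apply: ge0_subset_integral => //.
    + by apply/measurable_EFinP/measurable_funTS; exact: measurable_heat1.
    + by move=> y _; rewrite lee_fin p0.
    + by apply/subsetPset; exact: ndA.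
apply: (cvg_unique _ c1) => //.
by rewrite (_ : (fun n => _) = (fun n => (\int[mu]_z ((p s x z)%:E *
  heat_mass t (A n) z))%E)); last by apply/funext => n; exact: H.
Qed.

End heat_semigroup_kernel.

(** * Sequences and dyadic integration *)

Section real_sequences.
Context (R : realType).

(** If m <> 1, the sequence eventually moves by at least |m - 1| a / 2 in the same
direction at each step, and leaves the interval [a, b]. *)
Lemma asymptotic_ratio_eq1 (v : nat -> R) (a b m : R) : 0 < a ->
  (forall n, a <= v n <= b) ->
  (forall e, 0 < e -> exists N, forall n, (N <= n)%N ->
     `|v n.+1 - m * v n| <= e) -> m = 1.
Proof.
move=> a0 vab vm.
(* applied to v when m > 1, and to - v when m < 1 *)
have noincr (w : nat -> R) (e : R) (N : nat) c1 c2 : 0 < e ->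
    (forall n, c1 <= w n <= c2) ->
    (forall n, (N <= n)%N -> w n + e <= w n.+1) -> False.
  move=> e0 wc winc.
  have wk k : w N + k%:R * e <= w (N + k)%N.
    elim: k => [|k IH]; first by rewrite mul0r addr0 addn0.
    rewrite addnS (le_trans _ (winc _ (leq_addr _ _)))// -natr1 mulrDl mul1r addrA.
    by rewrite lerD2r.
  have := wk (Num.bound ((c2 - c1) / e)).
  have : (c2 - c1) / e < (Num.bound ((c2 - c1) / e))%:R.
    by rewrite (le_lt_trans (ler_norm _))// unstable.ltr_norm_bound.
  rewrite ltr_pdivrMr// => h1 h2.
  have /andP[+ _] := wc N.
  have /andP[_] := wc (N + Num.bound ((c2 - c1) / e))%N; lra.
apply/eqP; rewrite eq_le; apply/andP; split; rewrite leNgt; apply/negP => m1.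
- pose e := (m - 1) * a / 2.
  have e0 : 0 < e by rewrite divr_gt0// mulr_gt0// subr_gt0.
  have [N vN] := vm e e0.
  apply: (noincr v e N a b e0 vab) => n /vN; rewrite ler_norml => /andP[+ _].
  have /andP[an _] := vab n.
  have : (m - 1) * a <= (m - 1) * v n by rewrite ler_wpM2l// subr_ge0 ltW.
  by rewrite /e; lra.
- pose e := (1 - m) * a / 2.
  have e0 : 0 < e by rewrite divr_gt0// mulr_gt0// subr_gt0.
  have [N vN] := vm e e0.
  apply: (noincr (fun n => - v n) e N (- b) (- a) e0) => n.
    by rewrite !lerN2 andbC.
  move=> /vN; rewrite ler_norml => /andP[_].
  have /andP[an _] := vab n.
  have : (1 - m) * a <= (1 - m) * v n by rewrite ler_wpM2l// subr_ge0 ltW.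
  by rewrite /e; lra.
Qed.

Lemma nneseries_geometric (C z : R) : 0 <= C -> 0 <= z -> z < 1 ->
  (\sum_(0 <= k <oo) (C * z ^+ k)%:E = (C / (1 - z))%:E)%E.
Proof.
move=> C0 z0 z1; apply/cvg_lim => //.
rewrite (_ : (fun n => _) = EFin \o (series (geometric C z))); last first.
  by apply/funext => n /=; rewrite /series/= -sumEFin; apply: eq_bigr.
apply/cvg_EFin; first exact: nearW.
rewrite (_ : _ \o _ = series (geometric C z)); last by [].
by apply: cvg_geometric_series; rewrite ger0_norm.
Qed.

Lemma nneseries_half (C : R) : 0 <= C ->
  (\sum_(0 <= k <oo) (C * (2 ^+ k)^-1)%:E = (2 * C)%:E)%E.
Proof.
move=> C0; under eq_eseriesr => k _ do rewrite -exprVn.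
by rewrite nneseries_geometric//; [congr EFin; field|lra].
Qed.

End real_sequences.

Section dyadic_integral.
Context (R : realType).

Lemma nneseries_ge_term (u : nat -> \bar R) (j : nat) : (forall n, 0 <= u n)%E ->
  (u j <= \sum_(0 <= k <oo) u k)%E.
Proof.
move=> u0; apply: (le_trans _ (@nneseries_lim_ge _ u predT 0%N j.+1 _)) => //.
by rewrite big_nat_recr//= leeDr// sume_ge0.
Qed.

(** Integration over the annuli of radii about 2^j t^(1/dW).  It is used twice:
with D the distance to a point and g = 1, to bound the mass of the heat kernel,
and with D the distance on X x X and g = |f x - f y|, to bound heat energies by
energies at small distances. *)
Lemma sub_gaussian_integral_le (dH dW c3 c4 a : R) :
  2 <= dW -> 0 < c3 -> 0 < c4 -> 0 <= a ->
  exists2 K : R, 0 < K &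
  forall (dZ : measure_display) (Z : measurableType dZ)
    (nu : {measure set Z -> \bar R}) (D : Z -> R) (g : Z -> \bar R)
    (k : Z -> R) (M t : R),
    measurable_fun setT D -> (forall z, 0 <= D z) ->
    measurable_fun setT g -> (forall z, 0 <= g z)%E ->
    measurable_fun setT k -> (forall z, 0 <= k z) ->
    (forall z, k z <= c3 * t `^ (- (dH / dW)) *
                      expR (- (c4 * stretch dW t (D z)))) ->
    0 < t -> 0 <= M ->
    (forall r : R, 0 < r ->
      (\int[nu]_(z in [set z | (D z < r)%R]) g z <= (M * r `^ a)%R%:E)%E) ->
    (\int[nu]_z ((k z)%:E * g z) <= (K * M * t `^ ((a - dH) / dW))%:E)%E.
Proof.
move=> dW2 c30 c40 a0.
(* Decay of order a + 1 against growth of order a leaves the factor 2^(-j). *)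
have a1 : 0 <= a + 1 by rewrite addr_ge0.
have [K K0 KP] := sub_gaussian_dyadic dW2 c40 a1.
exists (2 * (c3 * K)); first by rewrite !mulr_gt0.
move=> dZ Z nu D g k M t mD D0 mg g0 mk k0 kub t0 M0 gM.
pose rho := t `^ dW^-1; have rho0 : 0 < rho by exact: powR_gt0.
have dWn : dW != 0 by rewrite gt_eqF//; lra.
pose A j := [set z | D z < 2 ^+ j * rho].
have mA j : measurable (A j).
  rewrite (_ : A j = D @^-1` `]-oo, 2 ^+ j * rho[).
    by rewrite -[X in measurable X]setTI; exact: mD.
  by apply/seteqP; split => z /=; rewrite in_itv.
pose co (j : nat) := c3 * t `^ (- (dH / dW)) * (K * (2 ^+ j) `^ (- (a + 1))).
have co0 j : 0 <= co j by rewrite !mulr_ge0 ?powR_ge0 ?ltW.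
pose G j z := ((co j)%:E * (g \_ (A j)) z)%E.
have gA0 j z : (0 <= (g \_ (A j)) z)%E by rewrite patchE; case: ifP.
have G0 j z : (0 <= G j z)%E by rewrite mule_ge0// lee_fin.
have mgA j : measurable_fun setT (g \_ (A j)).
  by apply/(measurable_restrictT _ (mA j)); exact: measurable_funTS.
have mG j : measurable_fun setT (G j) by exact: measurable_funeM.
apply: (@le_trans _ _ (\int[nu]_z (\sum_(0 <= j <oo) G j z))%E).
  apply: ge0_le_integral => //.
  - by move=> z _; rewrite mule_ge0// lee_fin.
  - by apply: emeasurable_funM => //; exact/measurable_EFinP.
  - by apply: ge0_emeasurable_sum.
  - move=> z _; have [j [Dz ej]] := KP t (D z) t0 (D0 z).
    apply: (le_trans _ (nneseries_ge_term j (fun n => G0 n z))).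
    rewrite /G patchE mem_set//; apply: lee_wpmul2r => //.
    rewrite lee_fin (le_trans (kub z))// /co ler_wpM2l// mulr_ge0 ?powR_ge0//.
    exact: ltW.
rewrite integral_nneseries//.
rewrite [leRHS](_ : _ = \sum_(0 <= j <oo) (c3 * K * M * t `^ ((a - dH) / dW) *
   (2 ^+ j)^-1)%:E)%E; last first.
  rewrite nneseries_half; last first.
    by rewrite !mulr_ge0 ?powR_ge0// ltW.
  by rewrite !mulrA.
apply: lee_nneseries => [j _ _|j _]; first by apply: integral_ge0.
rewrite ge0_integralZl//; last by rewrite lee_fin.
rewrite -integral_mkcond.
have r0 : 0 < 2 ^+ j * rho by rewrite mulr_gt0// exprn_gt0.
apply: (le_trans (lee_wpmul2l _ (gM _ r0))); first by rewrite lee_fin.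
rewrite -EFinM lee_fin /co le_eqVlt; apply/orP; left; apply/eqP.
have twoj : 0 < 2 ^+ j :> R by rewrite exprn_gt0.
rewrite powRM ?ltW// !powRN (gt0_powRD _ _ twoj) powRr1 ?ltW//.
rewrite /rho -powRrM mulrBl (gt0_powRB _ _ t0) [dW^-1 * a]mulrC.
field; rewrite !gt_eqF ?powR_gt0//.
Qed.

End dyadic_integral.

(** * Heat kernel estimates and stochastic completeness *)

Section heat_kernel_estimates.
Context (R : realType) (d : measure_display) (X : borelMetricType d R).
Variable mu : {sigma_finite_measure set X -> \bar R}.
Variables (E : (X -> R) -> (X -> R) -> R) (F : set (X -> R)).
Variables (P : R -> (X -> R) -> X -> R) (p : R -> X -> X -> R).
Variables (dH dW kappa c1 c2 c3 c4 c5 c6 C : R).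
Hypothesis A1 : forall (x : X) (r : R), compact (closure (ball x r)).
Hypothesis P_heat : heat_semigroup mu E F P.
Hypothesis HK : continuous_heat_kernel mu P p.
Hypotheses (dH0 : 0 < dH) (dW2 : 2 <= dW) (kappa0 : 0 < kappa).
Hypotheses (c10 : 0 < c1) (c20 : 0 < c2).
Hypotheses (c30 : 0 < c3) (c40 : 0 < c4) (c50 : 0 < c5) (c60 : 0 < c6).
Hypothesis ahl : forall (x : X) r, 0 <= r ->
  ((c1 * r `^ dH)%:E <= mu (ball x r) <= (c2 * r `^ dH)%:E)%E.
Hypothesis HB : forall t x y, 0 < t ->
  c5 * t `^ (- (dH / dW)) * expR (- (c6 * stretch dW t (mdist x y))) <=
  p t x y <=
  c3 * t `^ (- (dH / dW)) * expR (- (c4 * stretch dW t (mdist x y))).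
Hypothesis C0 : 0 < C.
Hypothesis BE : forall t g (x y : X), 0 < t -> g \in Lfun mu +oo%E ->
      (`|\int[mu]_z (p t x z * g z) - \int[mu]_z (p t y z * g z)|%:E
       <= (C * (mdist x y `^ kappa / t `^ (kappa / dW)))%:E
          * 'N[mu]_+oo[EFin \o g])%E.

Let dW0 : 0 < dW. Proof. by move: dW2; lra. Qed.
Let dWn : dW != 0. Proof. by rewrite gt_eqF. Qed.

Lemma heat_kernel_ge0 t x y : 0 < t -> 0 <= p t x y.
Proof.
move=> t0; have /andP[+ _] := HB x y t0; apply: le_trans.
by rewrite !mulr_ge0 ?powR_ge0 ?expR_ge0// ltW.
Qed.

Lemma ball_lty (x : X) (r : R) : (mu (ball x r) < +oo)%E.
Proof.
have [r0|r0] := leP 0 r.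
  by have /andP[_ /le_lt_trans] := ahl x r0; apply; rewrite ltry.
rewrite (_ : ball x r = set0) ?measure0 ?ltry//; apply/seteqP; split => // y.
rewrite ballEmdist/= => /(le_lt_trans (mdist_ge0 _ _)) /(lt_trans r0).
by rewrite ltxx.
Qed.

(** The dilation c is uniform in a, so that the bounds without and with the weight
d^kappa can be used at the same times. *)
Lemma heat_kernel_dilation : exists2 c, 0 < c & forall a, 0 <= a ->
  exists2 K, 0 < K & forall t u x y, 0 < t -> c * t <= u -> u <= 2 * c * t ->
    mdist x y `^ a * p t x y <= K * t `^ (a / dW) * p u x y.
Proof.
have [c c0 H] := sub_gaussian_dilation dW2 (ltW dH0) c30 c40 c50 c60.
exists c => // a a0; have [K K0 KP] := H a a0; exists K => // t u x y t0 ct cu.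
have u0 : 0 < u by apply: lt_le_trans ct; exact: mulr_gt0.
have /andP[_ ub] := HB x y t0; have /andP[lb _] := HB x y u0.
apply: (le_trans (ler_wpM2l (powR_ge0 _ _) ub)).
apply: (le_trans (KP t u _ t0 (mdist_ge0 _ _) ct cu)).
by rewrite ler_wpM2l// mulr_ge0 ?powR_ge0// ltW.
Qed.

Lemma heat_kernel_lower (x y : X) t : 0 < t -> mdist x y <= t `^ dW^-1 ->
  c5 * expR (- c6) * t `^ (- (dH / dW)) <= p t x y.
Proof.
move=> t0 xyt; have /andP[+ _] := HB x y t0; apply: le_trans.
rewrite mulrAC ler_wpM2l ?mulr_ge0 ?powR_ge0 ?(ltW c50)//.
rewrite ler_expR lerN2 -[leRHS]mulr1 ler_wpM2l ?(ltW c60)//.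
by rewrite -(stretch_diag dW2 t0) le_stretch ?mdist_ge0.
Qed.

Let mp1 t x : 0 < t -> measurable_fun setT (p t x).
Proof. by move=> t0; exact: (measurable_heat1 A1 HK). Qed.

Lemma heat_mass_bounded : exists m M, [/\ 0 < m, 0 < M & forall t x, 0 < t ->
  (m%:E <= heat_mass mu p t setT x <= M%:E)%E].
Proof.
have [K K0 KP] := sub_gaussian_integral_le dH dW2 c30 c40 (ltW dH0).
exists (c5 * expR (- c6) * c1), (K * c2).
split; [by rewrite !mulr_gt0 ?expR_gt0|exact: mulr_gt0|move=> t x t0].
have rho0 : 0 < t `^ dW^-1 by exact: powR_gt0.
have mB r : measurable (ball x r : set X) by exact: ball_measurable.
apply/andP; split.
  apply: (@le_trans _ _ (\int[mu]_(y in ball x (t `^ dW^-1)) (p t x y)%:E)%E).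
    apply: (@le_trans _ _ ((c5 * expR (- c6) * t `^ (- (dH / dW)))%:E * mu (ball x (t `^ dW^-1)))%E).
      have /andP[+ _] := ahl x (ltW rho0).
      have h : 0 <= c5 * expR (- c6) * t `^ (- (dH / dW)).
        by rewrite !mulr_ge0 ?powR_ge0 ?expR_ge0// ltW.
      have h' : (0 <= (c5 * expR (- c6) * t `^ (- (dH / dW)))%:E)%E by rewrite lee_fin.
      move=> /(lee_wpmul2l h'); apply: le_trans.
      rewrite -EFinM lee_fin -powRrM powRN [dW^-1 * dH]mulrC le_eqVlt.
      apply/orP; left; apply/eqP; field.
      by rewrite gt_eqF// powR_gt0.
    apply: ge0_le_cst_integral => //.
    - by apply/measurable_EFinP/measurable_funTS; exact: mp1.
    - by rewrite !mulr_ge0 ?powR_ge0 ?expR_ge0// ltW.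
    - move=> y; rewrite ballEmdist/= => xy.
      by rewrite lee_fin heat_kernel_lower// ltW.
  apply: ge0_subset_integral => //.
  - by apply/measurable_EFinP; exact: mp1.
  - by move=> y _; rewrite lee_fin heat_kernel_ge0.
have := KP d X mu (mdist x) (fun=> 1%E) (p t x) c2 t.
rewrite subrr mul0r powRr0 mulr1; under eq_integral do rewrite mule1.
apply => //; [|by exact: mdist_ge0|exact: mp1| | |exact: ltW|].
- apply: (@measurableT_comp _ _ _ _ _ _ (fun z : X * X => mdist z.1 z.2) _
    (pair x)); first exact: measurable_mdist.
  exact: pair1_measurable.
- by move=> y; exact: heat_kernel_ge0.
- by move=> y; have /andP[] := HB x y t0.
- move=> r r0; rewrite -ballEmdist integral_cst// mul1e.
  by have /andP[] := ahl x (ltW r0).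
Qed.

Lemma heat_mass_fin t (A : set X) x : 0 < t -> measurable A ->
  heat_mass mu p t A x \is a fin_num.
Proof.
move=> t0 mA; have [m [M [_ _ H]]] := heat_mass_bounded.
rewrite ge0_fin_numE; last by apply: (heat_mass_ge0 _ heat_kernel_ge0).
have /andP[_ h] := H t x t0; apply: le_lt_trans (le_lt_trans h (ltry _)).
apply: ge0_subset_integral => //; first by apply/measurable_EFinP; exact: mp1.
by move=> y _; rewrite lee_fin heat_kernel_ge0.
Qed.

Lemma indic_Lfuny (A : set X) : measurable A ->
  (\1_A : X -> R) \in Lfun mu +oo%E /\ ('N[mu]_+oo[EFin \o \1_A : X -> \bar R] <= 1)%E.
Proof.
move=> mA; have le1 : ('N[mu]_+oo[EFin \o \1_A : X -> \bar R] <= 1)%E.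
  rewrite unlock; case: ifP => // _; apply/ess_supP; apply: aeW => x /=.
  by rewrite indicE lee_fin ger0_norm ?ler0n// lern1 leq_b1.
split => //; rewrite inE; apply/andP; split; rewrite inE/=.
  exact: measurable_indic.
by rewrite /finite_norm (le_lt_trans le1)// ltry.
Qed.

Lemma heat_mass_holder t (A : set X) x y : 0 < t -> measurable A ->
  (heat_mass mu p t A x <= heat_mass mu p t A y +
     (C * (mdist x y `^ kappa / t `^ (kappa / dW)))%:E)%E.
Proof.
move=> t0 mA; have [Ay N1] := indic_Lfuny mA.
have := BE x y t0 Ay; rewrite /Rintegral !integral_indic_mul.
rewrite -/(heat_mass mu p t A x) -/(heat_mass mu p t A y).
have fx := heat_mass_fin x t0 mA; have fy := heat_mass_fin y t0 mA.
move=> h; rewrite -[leLHS]fineK// -[X in (_ <= X + _)%E]fineK// -EFinD lee_fin.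
have D0 : 0 <= C * (mdist x y `^ kappa / t `^ (kappa / dW)).
  by rewrite mulr_ge0 ?(ltW C0)// divr_ge0 ?powR_ge0.
have : (`|fine (heat_mass mu p t A x) - fine (heat_mass mu p t A y)|%:E <=
    (C * (mdist x y `^ kappa / t `^ (kappa / dW)))%:E * 1)%E.
  by apply: (le_trans h); rewrite lee_wpmul2l// lee_fin.
by rewrite mule1 lee_fin ler_norml => /andP[_]; rewrite lerBlDl.
Qed.

(** The Bakry-Emery estimate makes x |-> P_t 1 (x) almost constant at scales
below t^(1/dW), hence P_s P_t 1 is close to P_s 1 * P_t 1 when s is small
compared with t. *)
Lemma heat_mass_almost_multiplicative : exists2 D, 0 < D &
  forall s t x, 0 < s -> 0 < t ->
  let e := (D * (s `^ (kappa / dW) / t `^ (kappa / dW)))%:E in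
  (\int[mu]_z ((p s x z)%:E * heat_mass mu p t setT z) <=
     heat_mass mu p t setT x * heat_mass mu p s setT x + e)%E /\
  (heat_mass mu p t setT x * heat_mass mu p s setT x <=
     \int[mu]_z ((p s x z)%:E * heat_mass mu p t setT z) + e)%E.
Proof.
have [m [M [m0 M0 mass]]] := heat_mass_bounded.
have [c cpos /(_ kappa (ltW kappa0))[K K0 KP]] := heat_kernel_dilation.
exists (C * (K * M)) => [|s t x s0 t0 e]; first by rewrite !mulr_gt0.
have cs0 : 0 < c * s by exact: mulr_gt0.
have p0 := heat_kernel_ge0.
have mD : measurable_fun setT (fun z => mdist x z `^ kappa).
  apply: (@measurableT_comp _ _ _ _ _ _ (@powR R ^~ kappa)).
    exact: measurable_powR.
  apply: (@measurableT_comp _ _ _ _ _ _ (fun z : X * X => mdist z.1 z.2) _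
    (pair x)); first exact: measurable_mdist.
  exact: pair1_measurable.
have mps : measurable_fun setT (fun z => (p s x z)%:E).
  by apply/measurable_EFinP; exact: mp1.
have mH : measurable_fun setT (heat_mass mu p t setT).
  exact: (measurable_heat_mass A1 HK p0).
have H0 z : (0 <= heat_mass mu p t setT z)%E by exact: (heat_mass_ge0 _ p0).
pose a := C / t `^ (kappa / dW).
have a0 : 0 <= a by rewrite divr_ge0 ?powR_ge0 ?ltW.
have moment : (\int[mu]_z (mdist x z `^ kappa * p s x z)%:E <= (K * M * s `^ (kappa / dW))%:E)%E.
  apply: (@le_trans _ _ (\int[mu]_z ((K * s `^ (kappa / dW))%:E * (p (c * s)%R x z)%:E))%E).
    apply: ge0_le_integral => //.
    - by move=> z _; rewrite lee_fin mulr_ge0 ?powR_ge0 ?p0.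
    - by apply/measurable_EFinP; apply: measurable_funM => //; exact: mp1.
    - by apply: measurable_funeM; apply/measurable_EFinP; exact: mp1.
    - move=> z _; rewrite -EFinM lee_fin; apply: KP => //.
      by rewrite -mulrA [2 * _]mulr_natl mulr2n lerDl ltW.
  rewrite ge0_integralZl//; last 3 first.
    - by apply/measurable_EFinP; exact: mp1.
    - by move=> z _; rewrite lee_fin p0.
    - by rewrite lee_fin mulr_ge0 ?powR_ge0 ?ltW.
  have /andP[_ h] := mass (c * s) x cs0.
  rewrite [leRHS](_ : _ = (K * s `^ (kappa / dW))%:E * M%:E)%E; last first.
    by rewrite -EFinM mulrAC.
  by rewrite lee_wpmul2l// lee_fin mulr_ge0 ?powR_ge0 ?ltW.
have mG : measurable_fun setT (fun z => (mdist x z `^ kappa * p s x z)%:E).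
  by apply/measurable_EFinP; apply: measurable_funM => //; exact: mp1.
have G0 z : (0 <= (mdist x z `^ kappa * p s x z)%:E)%E.
  by rewrite lee_fin mulr_ge0 ?powR_ge0 ?p0.
have aG : (\int[mu]_z (a%:E * (mdist x z `^ kappa * p s x z)%:E) <= e)%E.
  rewrite ge0_integralZl// ?lee_fin//.
  rewrite [leRHS](_ : _ = a%:E * (K * M * s `^ (kappa / dW))%:E)%E.
    by rewrite lee_wpmul2l// lee_fin.
  by rewrite -EFinM /e /a; congr EFin; ring.
have fHt := heat_mass_fin x t0 measurableT.
have mpH : measurable_fun setT (fun z => ((p s x z)%:E * heat_mass mu p t setT z)%E).
  exact: emeasurable_funM.
have pH0 z : (0 <= (p s x z)%:E * heat_mass mu p t setT z)%E.
  by rewrite mule_ge0// lee_fin p0.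
have maG : measurable_fun setT (fun z => (a%:E * (mdist x z `^ kappa * p s x z)%:E)%E).
  exact: measurable_funeM.
have aG0 z : (0 <= a%:E * (mdist x z `^ kappa * p s x z)%:E)%E by rewrite mule_ge0.
have split_mass : (heat_mass mu p t setT x * heat_mass mu p s setT x =
    \int[mu]_z (heat_mass mu p t setT x * (p s x z)%:E))%E.
  by rewrite ge0_integralZl// => z _; rewrite lee_fin p0.
have mHx : measurable_fun setT (fun z => (heat_mass mu p t setT x * (p s x z)%:E)%E).
  exact: emeasurable_funM.
have Hx0 z : (0 <= heat_mass mu p t setT x * (p s x z)%:E)%E.
  by rewrite mule_ge0// lee_fin p0.
split.
- apply: (@le_trans _ _ (\int[mu]_z (heat_mass mu p t setT x * (p s x z)%:E +
      a%:E * (mdist x z `^ kappa * p s x z)%:E))%E).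
    apply: ge0_le_integral => //; first exact: emeasurable_funD.
    move=> z _; have := heat_mass_holder z x t0 measurableT; rewrite metric_sym => h.
    apply: (le_trans (lee_wpmul2l _ h)); first by rewrite lee_fin p0.
    rewrite muleDr//; last by rewrite ge0_adde_def ?inE// lee_fin mulr_ge0 ?divr_ge0 ?powR_ge0// ltW.
    rewrite muleC leeD2l// -!EFinM lee_fin /a le_eqVlt; apply/orP; left; apply/eqP.
    by ring.
  by rewrite ge0_integralD// -split_mass leeD2l.
- rewrite split_mass.
  apply: (@le_trans _ _ (\int[mu]_z ((p s x z)%:E * heat_mass mu p t setT z +
      a%:E * (mdist x z `^ kappa * p s x z)%:E))%E); last first.
    by rewrite ge0_integralD// leeD2l.
  apply: ge0_le_integral => //; first exact: emeasurable_funD.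
  move=> z _; have := heat_mass_holder x z t0 measurableT => h.
  have ps0 : (0 <= (p s x z)%:E)%E by rewrite lee_fin p0.
  rewrite muleC; apply: (le_trans (lee_wpmul2l ps0 h)).
  rewrite muleDr//; last by rewrite ge0_adde_def ?inE// lee_fin mulr_ge0 ?divr_ge0 ?powR_ge0// ltW.
  rewrite leeD2l// -!EFinM lee_fin /a le_eqVlt; apply/orP; left; apply/eqP.
  by ring.
Qed.

(** For v n = P_((n+1) s) 1 (x) the semigroup law and near-multiplicativity give v (n+1) - P_s 1 (x) * v n -> 0. *)
Lemma heat_mass_eq1 s : 0 < s ->
  {ae mu, forall x, heat_mass mu p s setT x = 1%E}.
Proof.
move=> s0; have p0 := heat_kernel_ge0.
have n0 n : 0 < n.+1%:R * s by rewrite mulr_gt0.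
have : {ae mu, forall x n, heat_mass mu p (s + n.+1%:R * s) setT x =
    (\int[mu]_z ((p s x z)%:E * heat_mass mu p (n.+1%:R * s)%R setT z))%E}.
  apply/ae_foralln => n.
  exact: (heat_mass_semigroupT A1 P_heat HK p0 ball_lty).
have [m [M [m0 M0 mass]]] := heat_mass_bounded.
have [D D0 DP] := heat_mass_almost_multiplicative.
apply: filterS => x ck.
pose v n := fine (heat_mass mu p (n.+1%:R * s) setT x).
have vE n : (v n)%:E = heat_mass mu p (n.+1%:R * s) setT x.
  by rewrite fineK// heat_mass_fin.
suff v01 : v 0%N = 1 by rewrite -[s]mul1r -(vE 0%N) v01.
have th0 : 0 < kappa / dW by rewrite divr_gt0.
apply: (@asymptotic_ratio_eq1 R v m M) => // [n|e e0].
  by rewrite -!lee_fin vE; exact: mass.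
have eD : 0 <= D / e by rewrite divr_ge0 ?ltW.
exists (Num.bound ((D / e) `^ (kappa / dW)^-1)) => n nN.
have err : D * (s `^ (kappa / dW) / (n.+1%:R * s) `^ (kappa / dW)) <= e.
  rewrite powRM ?ler0n ?(ltW s0)//.
  have -> : D * (s `^ (kappa / dW) / (n.+1%:R `^ (kappa / dW) * s `^ (kappa / dW)))
      = D / n.+1%:R `^ (kappa / dW).
    by field; rewrite !gt_eqF ?powR_gt0.
  rewrite ler_pdivrMr ?powR_gt0// -ler_pdivrMl// mulrC.
  have -> : D / e = ((D / e) `^ (kappa / dW)^-1) `^ (kappa / dW).
    by rewrite -powRrM mulVf ?gt_eqF// powRr1.
  apply: le_powR; rewrite ?powR_ge0 ?(ltW th0)//.
  rewrite (le_trans (ler_norm _))// (le_trans (ltW (unstable.ltr_norm_bound _)))//.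
  by rewrite ler_nat leqW.
have [u1 u2] := DP s _ x s0 (n0 n).
move: u1 u2; rewrite -ck.
rewrite (_ : s + n.+1%:R * s = n.+2%:R * s); last by rewrite -[in RHS]natr1; ring.
have hs : heat_mass mu p s setT x = (v 0%N)%:E by rewrite vE mul1r.
rewrite hs -!vE -!EFinM -!EFinD !lee_fin => u1 u2.
rewrite ler_norml; apply/andP; split; move: u1 u2; rewrite -/(v 0%N); lra.
Qed.

End heat_kernel_estimates.

(** * The Tonelli theorem on measurable sets *)

Section tonelli_on_sets.
Context (R : realType) d1 d2 (S : measurableType d1) (T : measurableType d2).
Variables (m1 : {sigma_finite_measure set S -> \bar R}).
Variables (m2 : {sigma_finite_measure set T -> \bar R}).
Variables (A : set S) (B : set T) (f : S * T -> \bar R).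
Hypotheses (mA : measurable A) (mB : measurable B).
Hypothesis mf : measurable_fun (A `*` B) f.
Hypothesis f0 : forall z, (A `*` B) z -> (0 <= f z)%E.

Let g := f \_ (A `*` B).
Let mg : measurable_fun setT g.
Proof. by apply/(measurable_restrictT _ (measurableX mA mB)). Qed.
Let g0 z : (0 <= g z)%E.
Proof. by rewrite /g patchE; case: ifPn => // /set_mem; exact: f0. Qed.

Let inner x : A x -> (\int[m2]_(y in B) f (x, y) = \int[m2]_y g (x, y))%E.
Proof.
move=> Ax; rewrite integral_mkcond; apply: eq_integral => y _.
rewrite /g !patchE in_setX/= (mem_set Ax)/=.
by case: (y \in B).
Qed.

Let out x : ~ A x -> (\int[m2]_y g (x, y) = 0)%E.
Proof.
move=> Ax; apply: integral0_eq => y _; rewrite /g patchE in_setX/=.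
by rewrite (memNset Ax).
Qed.

Let innerE : ((fun x => \int[m2]_(y in B) f (x, y)) \_ A =
  fun x => \int[m2]_y g (x, y))%E.
Proof.
apply/funext => x; rewrite patchE; case: ifPn => [/set_mem/inner//|].
by move=> /negP Ax; rewrite out// => /mem_set.
Qed.

Let inner2 y : B y -> (\int[m1]_(x in A) f (x, y) = \int[m1]_x g (x, y))%E.
Proof.
move=> By; rewrite integral_mkcond; apply: eq_integral => x _.
rewrite /g !patchE in_setX/= (mem_set By)/= andbT.
by case: (x \in A).
Qed.

Let inner2E : ((fun y => \int[m1]_(x in A) f (x, y)) \_ B =
  fun y => \int[m1]_x g (x, y))%E.
Proof.
apply/funext => y; rewrite patchE; case: ifPn => [/set_mem/inner2//|].
move=> /negP By; apply/esym/integral0_eq => x _; rewrite /g patchE in_setX/=.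
by rewrite (_ : y \in B = false) ?andbF//; apply/negP.
Qed.

Lemma measurable_tonelli_inner :
  measurable_fun A (fun x => \int[m2]_(y in B) f (x, y))%E.
Proof.
apply/(measurable_restrictT _ mA); rewrite innerE.
exact: measurable_fun_fubini_tonelli_F.
Qed.

Lemma tonelli_sets :
  (\int[m1]_(x in A) \int[m2]_(y in B) f (x, y) =
   \int[m2]_(y in B) \int[m1]_(x in A) f (x, y))%E.
Proof.
rewrite integral_mkcond innerE [RHS]integral_mkcond inner2E.
exact: fubini_tonelli.
Qed.

Lemma tonelli_prod :
  (\int[m1]_(x in A) \int[m2]_(y in B) f (x, y) =
   \int[(m1 \x m2)%E]_(z in A `*` B) f z)%E.
Proof.
rewrite integral_mkcond innerE [RHS]integral_mkcond.
by rewrite fubini_tonelli1.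
Qed.

End tonelli_on_sets.

(** * Near-monotonicity of the heat loss *)

Section heat_perimeter.
Context (R : realType) (d : measure_display) (X : borelMetricType d R).
Variable mu : {sigma_finite_measure set X -> \bar R}.
Variables (p : R -> X -> X -> R) (dW kappa C c K0 K1 : R).
Hypotheses (dW0 : 0 < dW) (kappa_range : 0 < kappa < dW).
Hypothesis mp : forall t, 0 < t -> measurable_fun [set: X * X] (fun z => p t z.1 z.2).
Hypothesis mdm : measurable_fun [set: X * X] (fun z => mdist z.1 z.2).
Hypothesis p0 : forall t x y, 0 < t -> 0 <= p t x y.
Hypothesis psym : forall t x y, 0 < t -> p t x y = p t y x.
Hypothesis mass1 : forall t, 0 < t ->
  {ae mu, forall x, heat_mass mu p t setT x = 1%E}.
Hypothesis CK : forall s t (A : set X), 0 < s -> 0 < t -> measurable A ->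
  (mu A < +oo)%E -> {ae mu, forall x,
    heat_mass mu p (s + t) A x =
    (\int[mu]_z ((p s x z)%:E * heat_mass mu p t A z))%E}.
Hypothesis C0 : 0 < C.
Hypothesis holder : forall t (A : set X) x y, 0 < t -> measurable A ->
  (heat_mass mu p t A x <= heat_mass mu p t A y +
     (C * (mdist x y `^ kappa / t `^ (kappa / dW)))%:E)%E.
Hypotheses (c0 : 0 < c) (K00 : 0 < K0) (K10 : 0 < K1).
Hypothesis dil0 : forall t u x y, 0 < t -> c * t <= u -> u <= 2 * c * t ->
  p t x y <= K0 * p u x y.
Hypothesis dil1 : forall t u x y, 0 < t -> c * t <= u -> u <= 2 * c * t ->
  mdist x y `^ kappa * p t x y <= K1 * t `^ (kappa / dW) * p u x y.

Let th := kappa / dW.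
Let b := 1 - th.
Let th0 : 0 < th.
Proof. by rewrite divr_gt0//; move: kappa_range; lra. Qed.
Let th1 : th < 1.
Proof. by rewrite /th ltr_pdivrMr// mul1r; move: kappa_range; lra. Qed.
Let b0 : 0 < b. Proof. by rewrite /b subr_gt0. Qed.
Let b1 : b < 1. Proof. by rewrite /b; move: th0; lra. Qed.

Let mp1 t x : 0 < t -> measurable_fun setT (fun y => (p t x y)%:E).
Proof.
move=> t0; apply/measurable_EFinP.
apply: (@measurableT_comp _ _ _ _ _ _ (fun z : X * X => p t z.1 z.2) _ (pair x)).
  exact: mp.
exact: pair1_measurable.
Qed.

Let mp2 t : 0 < t -> measurable_fun setT (fun z : X * X => (p t z.1 z.2)%:E).
Proof. by move=> t0; apply/measurable_EFinP; exact: mp. Qed.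

Let mass0 t A x : 0 < t -> (0 <= heat_mass mu p t A x)%E.
Proof. by move=> t0; apply: integral_ge0 => y _; rewrite lee_fin p0. Qed.

Let mmass t A : 0 < t -> measurable A -> measurable_fun setT (heat_mass mu p t A).
Proof.
move=> t0 mA; apply: (@measurable_tonelli_inner _ _ _ _ _ mu setT A
   (fun z => (p t z.1 z.2)%:E)) => //.
  by apply: measurable_funTS; exact: mp2.
by move=> z _; rewrite lee_fin p0.
Qed.

(** The loss phi is studied through the content: the two add up to mu A, and the
semigroup law applies to the content. *)
Section one_set.
Variable A : set X.
Hypotheses (mA : measurable A) (fA : (mu A < +oo)%E).

Let mAc : measurable (~` A). Proof. exact: measurableC. Qed.

Definition heat_content t : \bar R := (\int[mu]_(x in A) heat_mass mu p t A x)%E.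
Definition heat_loss t : \bar R :=
  (\int[mu]_(x in A) heat_mass mu p t (~` A) x)%E.

Lemma heat_content_ge0 t : 0 < t -> (0 <= heat_content t)%E.
Proof. by move=> t0; apply: integral_ge0 => x _; exact: mass0. Qed.

Lemma heat_loss_ge0 t : 0 < t -> (0 <= heat_loss t)%E.
Proof. by move=> t0; apply: integral_ge0 => x _; exact: mass0. Qed.

Let mass_split t x : 0 < t ->
  (heat_mass mu p t setT x = heat_mass mu p t A x + heat_mass mu p t (~` A) x)%E.
Proof.
move=> t0; rewrite /heat_mass -(setUv A) ge0_integral_setU//.
- by rewrite setUv; exact: mp1.
- by move=> y _; rewrite lee_fin p0.
- by apply/disj_setPS; rewrite setICr.
Qed.

Lemma heat_content_loss t : 0 < t -> (mu A = heat_content t + heat_loss t)%E.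
Proof.
move=> t0; rewrite /heat_content /heat_loss -ge0_integralD//; last 4 first.
- by move=> x _; exact: mass0.
- by apply: measurable_funTS; exact: mmass.
- by move=> x _; exact: mass0.
- by apply: measurable_funTS; exact: mmass.
transitivity (\int[mu]_(x in A) (cst 1%E x))%E; first by rewrite integral_cst// mul1e.
apply: ge0_ae_eq_integral => //.
- apply: emeasurable_funD; apply: measurable_funTS; exact: mmass.
- by move=> x _; rewrite adde_ge0// mass0.
by apply: filterS (mass1 t0) => x mx _; rewrite /= -mx mass_split.
Qed.

Lemma heat_content_fin t : 0 < t -> heat_content t \is a fin_num.
Proof.
move=> t0; rewrite ge0_fin_numE ?heat_content_ge0//.
apply: le_lt_trans fA; rewrite (heat_content_loss t0) leeDl//.
exact: heat_loss_ge0.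
Qed.

Lemma heat_loss_dilation t u : 0 < t -> c * t <= u -> u <= 2 * c * t ->
  (heat_loss t <= K0%:E * heat_loss u)%E.
Proof.
move=> t0 ct cu; have u0 : 0 < u by apply: lt_le_trans ct; exact: mulr_gt0.
rewrite /heat_loss -ge0_integralZl//; last 3 first.
- by apply: measurable_funTS; exact: mmass.
- by move=> x _; exact: mass0.
- by rewrite lee_fin ltW.
apply: ge0_le_integral => //.
- by move=> x _; exact: mass0.
- by apply: measurable_funTS; exact: mmass.
- by apply: measurable_funeM; apply: measurable_funTS; exact: mmass.
move=> x _; rewrite /heat_mass -ge0_integralZl//; last 3 first.
- by apply: measurable_funTS; exact: mp1.
- by move=> y _; rewrite lee_fin p0.
- by rewrite lee_fin ltW.
apply: ge0_le_integral => //.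
- by move=> y _; rewrite lee_fin p0.
- by apply: measurable_funTS; exact: mp1.
- by apply: measurable_funeM; apply: measurable_funTS; exact: mp1.
by move=> y _; rewrite -EFinM lee_fin dil0.
Qed.

(** Symmetry of the kernel moves one of the two time steps to the other side. *)
Let swap_content s h : 0 < s -> 0 < h ->
  (heat_content (s + h) =
   \int[mu]_z (heat_mass mu p s A z * heat_mass mu p h A z))%E.
Proof.
move=> s0 h0; rewrite /heat_content.
have mf : measurable_fun setT (fun z : X * X => (p s z.1 z.2)%:E * heat_mass mu p h A z.2)%E.
  apply: emeasurable_funM; first exact: mp2.
  by apply: measurableT_comp => //; exact: mmass.
have f0 z : (0 <= (p s z.1 z.2)%:E * heat_mass mu p h A z.2)%E.
  by rewrite mule_ge0 ?mass0// lee_fin p0.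
transitivity (\int[mu]_(x in A) \int[mu]_z ((p s x z)%:E * heat_mass mu p h A z))%E.
  apply: ge0_ae_eq_integral => //.
  - by apply: measurable_funTS; apply: mmass => //; exact: addr_gt0.
  - apply: (@measurable_tonelli_inner _ _ _ _ _ mu A setT
     (fun z => (p s z.1 z.2)%:E * heat_mass mu p h A z.2)%E) => //.
    exact: measurable_funTS.
  - by move=> x _; apply: mass0; exact: addr_gt0.
  - by move=> x _; apply: integral_ge0 => z _; exact: (f0 (x, z)).
  - by apply: filterS (CK s0 h0 mA fA) => x + _.
rewrite (@tonelli_sets _ _ _ _ _ mu mu A setT
   (fun z => (p s z.1 z.2)%:E * heat_mass mu p h A z.2)%E)//; last exact: measurable_funTS.
apply: eq_integral => z _ /=.
rewrite ge0_integralZr ?mass0//.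
- by congr (_ * _)%E; apply: eq_integral => x _; rewrite psym.
- apply/measurable_EFinP/measurable_funTS.
  apply: (@measurableT_comp _ _ _ _ _ _ (fun z : X * X => p s z.1 z.2) _ (pair^~ z)).
    exact: mp.
  exact: pair2_measurable.
- by move=> x _; rewrite lee_fin p0.
Qed.

(** With u = P_s 1_A, the content at time s is the integral over A of u * P_h 1 and
the content at time s + h is the integral over X of u * P_h 1_A.  By symmetry of
the kernel their difference is the integral over A x A^c of
(u x - u y) * p h x y, and the Holder continuity of u applies to it. *)
Lemma heat_content_step s h : 0 < s -> 0 < h ->
  (heat_content s <= heat_content (s + h) +
    (C * K1 * (h `^ th / s `^ th))%:E * heat_loss (c * h)%R)%E.
Proof.
move=> s0 h0.
have ch0 : 0 < c * h by exact: mulr_gt0.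
set u := heat_mass mu p s A.
have u0 x : (0 <= u x)%E by exact: mass0.
have mu1 : measurable_fun setT u by exact: mmass.
have mmh B : measurable B -> measurable_fun setT (heat_mass mu p h B) by exact: mmass.
have muh B : measurable B -> measurable_fun setT (fun x => u x * heat_mass mu p h B x)%E.
  by move=> mB; apply: emeasurable_funM => //; exact: mmh.
have uh0 B x : (0 <= u x * heat_mass mu p h B x)%E by rewrite mule_ge0 ?mass0.
have e1 : (heat_content s = \int[mu]_(x in A) (u x * heat_mass mu p h A x) +
    \int[mu]_(x in A) (u x * heat_mass mu p h (~` A) x))%E.
  rewrite -ge0_integralD//; [|by apply: measurable_funTS; exact: muh..].
  apply: ge0_ae_eq_integral => //.
  - exact: measurable_funTS.
  - by apply: emeasurable_funD; apply: measurable_funTS; exact: muh.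
  - by move=> x _; rewrite adde_ge0.
  apply: filterS (mass1 h0) => x mx _.
  by rewrite -ge0_muleDr ?mass0// -mass_split// mx mule1.
pose a := C / s `^ th; have a0 : 0 <= a by rewrite divr_ge0 ?powR_ge0 ?ltW.
pose dp (z : X * X) := (mdist z.1 z.2 `^ kappa * p h z.1 z.2)%:E.
have mdp : measurable_fun setT dp.
  apply/measurable_EFinP; apply: measurable_funM; last exact: mp.
  apply: (@measurableT_comp _ _ _ _ _ _ (@powR R ^~ kappa) _
    (fun z : X * X => mdist z.1 z.2)); [exact: measurable_powR|exact: mdm].
have dp0 z : (0 <= dp z)%E by rewrite lee_fin mulr_ge0 ?powR_ge0 ?p0.
have madp : measurable_fun setT (fun z => a%:E * dp z)%E by exact: measurable_funeM.
have adp0 z : (0 <= a%:E * dp z)%E by rewrite mule_ge0.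
have mup : measurable_fun setT (fun z : X * X => u z.2 * (p h z.1 z.2)%:E)%E.
  by apply: emeasurable_funM; [exact: measurableT_comp|exact: mp2].
have up0 z : (0 <= u z.2 * (p h z.1 z.2)%:E)%E by rewrite mule_ge0// lee_fin p0.
have slice (f : X * X -> \bar R) x : measurable_fun setT f ->
    measurable_fun (~` A) (fun y => f (x, y)).
  move=> mf; apply: measurable_funTS.
  by apply: (@measurableT_comp _ _ _ _ _ _ f _ (pair x)) => //; exact: pair1_measurable.
have inner (f : X * X -> \bar R) : measurable_fun setT f -> (forall z, 0 <= f z)%E ->
    measurable_fun A (fun x => \int[mu]_(y in ~` A) f (x, y))%E.
  move=> mf f0; apply: measurable_tonelli_inner => //; exact: measurable_funTS.
(* across the boundary of A, u x is replaced by u y *)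
have e2 : (\int[mu]_(x in A) (u x * heat_mass mu p h (~` A) x) <=
    \int[mu]_(x in A) (\int[mu]_(y in ~` A) (u y * (p h x y)%:E) +
       \int[mu]_(y in ~` A) (a%:E * dp (x, y))))%E.
  apply: ge0_le_integral => //.
  - by apply: measurable_funTS; exact: muh.
  - apply: emeasurable_funD.
      exact: (inner (fun z => u z.2 * (p h z.1 z.2)%:E)%E).
    exact: (inner (fun z => a%:E * dp z)%E).
  move=> x _; rewrite /heat_mass -ge0_integralZl//; last 2 first.
  - by apply: measurable_funTS; exact: mp1.
  - by move=> y _; rewrite lee_fin p0.
  rewrite -ge0_integralD//; last 3 first.
  - by move=> y _; exact: (up0 (x, y)).
  - exact: (slice (fun z => u z.2 * (p h z.1 z.2)%:E)%E).
  - exact: (slice (fun z => a%:E * dp z)%E).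
  apply: ge0_le_integral => //.
  - by move=> y _; rewrite mule_ge0// lee_fin p0.
  - by apply: measurable_funeM; apply: measurable_funTS; exact: mp1.
  - apply: emeasurable_funD.
      exact: (slice (fun z => u z.2 * (p h z.1 z.2)%:E)%E).
    exact: (slice (fun z => a%:E * dp z)%E).
  move=> y _; have ph0 : (0 <= (p h x y)%:E)%E by rewrite lee_fin p0.
  apply: (le_trans (lee_wpmul2r ph0 (holder x y s0 mA))).
  rewrite ge0_muleDl//; last by rewrite lee_fin mulr_ge0 ?divr_ge0 ?powR_ge0 ?ltW.
  rewrite leeD2l// /dp -!EFinM lee_fin le_eqVlt; apply/orP; left; apply/eqP => /=.
  by rewrite /a /th; ring.
(* the main term is the heat that A^c sends to A *)
have e3 : (\int[mu]_(x in A) (\int[mu]_(y in ~` A) (u y * (p h x y)%:E)) =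
    \int[mu]_(y in ~` A) (u y * heat_mass mu p h A y))%E.
  rewrite (@tonelli_sets _ _ _ _ _ mu mu A (~` A)
   (fun z => u z.2 * (p h z.1 z.2)%:E)%E)//; last exact: measurable_funTS.
  apply: eq_integral => y _ /=; rewrite ge0_integralZl//.
  - by congr (_ * _)%E; apply: eq_integral => x _; rewrite psym.
  - apply/measurable_EFinP/measurable_funTS.
    apply: (@measurableT_comp _ _ _ _ _ _ (fun z : X * X => p h z.1 z.2) _ (pair^~ y)).
      exact: mp.
    exact: pair2_measurable.
  - by move=> x _; rewrite lee_fin p0.
(* the weight d^kappa is absorbed by a dilation of the time h *)
have e4 : (\int[mu]_(x in A) (\int[mu]_(y in ~` A) (a%:E * dp (x, y))) <=
    (C * K1 * (h `^ th / s `^ th))%:E * heat_loss (c * h)%R)%E.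
  have k0 : 0 <= C * K1 * (h `^ th / s `^ th).
    apply: mulr_ge0; first by rewrite mulr_ge0 ?ltW.
    by rewrite divr_ge0 ?powR_ge0.
  have mlc : measurable_fun A (heat_mass mu p (c * h) (~` A)).
    by apply: measurable_funTS; exact: mmass.
  rewrite /heat_loss -ge0_integralZl//; last by move=> x _; exact: mass0.
  apply: ge0_le_integral => //.
  - by move=> x _; apply: integral_ge0 => y _.
  - exact: (inner (fun z => a%:E * dp z)%E).
  - exact: measurable_funeM.
  move=> x _; rewrite /heat_mass -ge0_integralZl//; last 2 first.
  - by apply: measurable_funTS; exact: mp1.
  - by move=> y _; rewrite lee_fin p0.
  apply: ge0_le_integral => //.
  - exact: (slice (fun z => a%:E * dp z)%E).
  - by apply: measurable_funeM; apply: measurable_funTS; exact: mp1.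
  move=> y _; rewrite /dp -!EFinM lee_fin /=.
  have hh : c * h <= 2 * c * h by rewrite -mulrA [2 * _]mulr_natl mulr2n lerDl ltW.
  apply: (le_trans (ler_wpM2l a0 (dil1 x y h0 (lexx _) hh))).
  by rewrite le_eqVlt; apply/orP; left; apply/eqP; rewrite /a -/th; ring.
rewrite e1 swap_content// -(setUv A) ge0_integral_setU//; last 2 first.
- by rewrite setUv; exact: muh.
- by apply/disj_setPS; rewrite setICr.
rewrite -[leRHS]addeA -/u; apply: leeD => //; apply: (le_trans e2).
rewrite ge0_integralD//; last 4 first.
- by move=> x _; apply: integral_ge0 => y _; exact: (up0 (x, y)).
- exact: (inner (fun z => u z.2 * (p h z.1 z.2)%:E)%E).
- by move=> x _; apply: integral_ge0 => y _.
- exact: (inner (fun z => a%:E * dp z)%E).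
by rewrite e3 leeD2l.
Qed.

(** Iterating the previous estimate along the times h, 2h, ..., n h costs the sum
of k^(-kappa/dW), that is, n^(1 - kappa/dW). *)
Lemma heat_content_iter h n : 0 < h ->
  (mu A <= heat_content (n.+1%:R * h) +
    (K0 + C * K1 * (2 / b) * n.+1%:R `^ b)%:E * heat_loss (c * h)%R)%E.
Proof.
move=> h0; have ch0 : 0 < c * h by exact: mulr_gt0.
have L0 : (0 <= heat_loss (c * h))%E by exact: heat_loss_ge0.
have hh : c * h <= 2 * c * h by rewrite -mulrA [2 * _]mulr_natl mulr2n lerDl ltW.
have CK0 : 0 <= C * K1 by rewrite mulr_ge0 ?ltW.
have b2 : 0 <= 2 / b by rewrite divr_ge0// ltW.
elim: n => [|n IH].
  rewrite mul1r (heat_content_loss h0) leeD2l//.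
  apply: (le_trans (heat_loss_dilation h0 (lexx _) hh)).
  by rewrite lee_wpmul2r// lee_fin lerDl mulr_ge0 ?powR_ge0 ?(mulr_ge0 CK0 b2).
have n0 : 0 < n.+1%:R * h by rewrite mulr_gt0.
apply: (le_trans IH).
apply: (le_trans (leeD (heat_content_step n0 h0) (lexx _))).
rewrite -addeA (_ : n.+1%:R * h + h = n.+2%:R * h); last first.
  by rewrite -[in RHS]natr1; ring.
rewrite leeD2l// -ge0_muleDl//; last 2 first.
- by rewrite lee_fin; apply: mulr_ge0; [exact: CK0|rewrite divr_ge0 ?powR_ge0].
- by rewrite lee_fin addr_ge0 ?(ltW K00)// mulr_ge0 ?powR_ge0 ?(mulr_ge0 CK0 b2).
rewrite lee_wpmul2r// -EFinD lee_fin.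
have -> : h `^ th / (n.+1%:R * h) `^ th = n.+1%:R `^ (b - 1).
  rewrite powRM ?ler0n ?(ltW h0)// (_ : b - 1 = - th); last by rewrite /b; ring.
  by rewrite powRN; field; rewrite !gt_eqF ?powR_gt0.
have := ler_wpM2l CK0 (powR_increment n b0 b1); rewrite mulrA mulrBr => inc.
by move: inc; rewrite lerBrDr => inc; rewrite addrCA; apply: lerD.
Qed.

End one_set.

(** Up to a constant t^(-b) times the loss does not increase with t, at least
between well separated times: the loss at t is first compared with the loss at a
multiple n h' of h' = h / c that is comparable to c t. *)
Lemma heat_loss_near_monotone : exists e L, [/\ 0 < e, 0 < L &
  forall A t h, measurable A -> (mu A < +oo)%E -> 0 < t -> 0 < h -> h <= e * t ->
    (heat_loss A t <= (L * (t / h) `^ b)%:E * heat_loss A h)%E].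
Proof.
have b2 : 0 < 2 / b by rewrite divr_gt0.
pose L1 := K0 + C * K1 * (2 / b).
have L10 : 0 < L1 by rewrite addr_gt0//; apply: mulr_gt0 => //; exact: mulr_gt0.
exists (c ^+ 2), (K0 * L1 * (2 * c ^+ 2) `^ b); split.
- by rewrite exprn_gt0.
- by rewrite mulr_gt0 ?(mulr_gt0 K00 L10)// powR_gt0// mulr_gt0// exprn_gt0.
move=> A t h mA fA t0 h0 ht.
pose h' := h / c; have h'0 : 0 < h' by rewrite divr_gt0.
have ch' : c * h' = h by rewrite /h' mulrCA mulfV ?mulr1// gt_eqF.
pose x := c * t / h'.
have x1 : 1 <= x.
  by rewrite /x ler_pdivlMr// mul1r /h' ler_pdivrMr// mulrAC -expr2.
(* x >= 1 guarantees an integer between x and 2 x; this is why e = c^2 *)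
have [n [nx xn]] : exists n : nat, x <= n.+1%:R /\ n.+1%:R <= 2 * x.
  have x0 : 0 <= x by rewrite (le_trans _ x1).
  exists (Num.truncn x); have /andP[? ?] := truncn_itv x0.
  split; first exact: ltW.
  by rewrite -natr1 mulr_natl mulr2n lerD.
have nh0 : 0 < n.+1%:R * h' by rewrite mulr_gt0.
have nh1 : c * t <= n.+1%:R * h' by rewrite -ler_pdivrMr.
have nh2 : n.+1%:R * h' <= 2 * c * t by move: xn; rewrite /x mulrA ler_pdivlMr// mulrA.
have L0 : (0 <= heat_loss A h)%E by exact: heat_loss_ge0.
have loss : (heat_loss A (n.+1%:R * h') <= (L1 * n.+1%:R `^ b)%:E * heat_loss A h)%E.
  have := heat_content_iter mA fA n h'0.
  rewrite (heat_content_loss mA nh0) ch' leeD2lE; last exact: heat_content_fin.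
  move=> /le_trans; apply; rewrite lee_wpmul2r// lee_fin.
  have N1 : 1 <= n.+1%:R `^ b.
    have : 1 `^ b <= n.+1%:R `^ b :> R by apply: le_powR; [exact: ltW|by []|rewrite ler1n].
    by rewrite powR1.
  rewrite [leRHS](mulrDl K0) lerD2r ler_peMr//; exact: ltW.
apply: (le_trans (heat_loss_dilation mA t0 nh1 nh2)).
have K0E : (0 <= K0%:E)%E by rewrite lee_fin ltW.
apply: (le_trans (lee_wpmul2l K0E loss)).
rewrite muleA -EFinM lee_wpmul2r// lee_fin mulrA -[leRHS]mulrA ler_wpM2l//.
  by rewrite mulr_ge0 ?ltW.
have th_ge0 : 0 <= t / h by rewrite divr_ge0 ?ltW.
have cc : 0 <= 2 * c ^+ 2 by rewrite mulr_ge0// exprn_ge0// ltW.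
rewrite -powRM//; apply: le_powR; rewrite ?(ltW b0)// (le_trans xn)//.
rewrite le_eqVlt; apply/orP; left; apply/eqP; rewrite /x /h'; field.
by rewrite !gt_eqF.
Qed.

End heat_perimeter.

(** * Moments and windows of the stable subordinator *)

Section stable_subordinator.
Context (R : realType).
Variables (delta : R) (eta : R -> R -> R).
Hypothesis delta_range : 0 < delta < 1.
Hypothesis eta_density : subordinator_density delta eta.

Let delta0 : 0 < delta. Proof. by have /andP[] := delta_range. Qed.
Let delta1 : delta < 1. Proof. by have /andP[] := delta_range. Qed.
Let leb := @lebesgue_measure R.
Let Dpos : set R := `]0, +oo[.
Let mD : measurable Dpos. Proof. exact: measurable_itv. Qed.

Let eta0 t s : 0 < t -> Dpos s -> 0 <= eta t s.
Proof. by move=> t0; rewrite /Dpos/= in_itv/= andbT; have [_ + _] := eta_density t0; apply. Qed.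

Lemma measurable_subordinator t : 0 < t -> measurable_fun Dpos (eta t).
Proof.
move=> t0; have [ceta _ _] := eta_density t0.
have oD : open Dpos by exact: interval_open.
by apply: open_continuous_measurable_fun => //; rewrite -continuous_open_subspace.
Qed.

Implicit Types (g s t u M x : R).

Let expw u s : R := expR (- (s * u)).

Let mexpw u : measurable_fun setT (expw u).
Proof.
apply: (measurableT_comp (@measurable_expR R)).
by apply: measurableT_comp => //; exact: measurable_funM.
Qed.

Let laplace t u : 0 < t -> 0 < u ->
  (\int[leb]_(s in Dpos) (eta t s * expw u s)%:E = (expR (- (t * u `^ delta)))%:E)%E.
Proof. by move=> t0 u0; have [_ _ ->] := eta_density t0. Qed.

Let meta t (f : R -> R) : 0 < t -> measurable_fun setT f ->
  measurable_fun Dpos (fun s => (eta t s * f s)%:E).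
Proof.
move=> t0 mf; apply/measurable_EFinP; apply: measurable_funM.
  exact: measurable_subordinator.
exact: measurable_funTS.
Qed.

Let scaled t u : 0 < t -> 0 <= u -> t * (u / t `^ delta^-1) `^ delta = u `^ delta.
Proof.
move=> t0 u0; rewrite powRM ?invr_ge0 ?powR_ge0//.
have -> : (t `^ delta^-1)^-1 `^ delta = t^-1.
  by rewrite -powRN -powRrM mulNr mulVf ?gt_eqF// powR_inv1 ?ltW.
by rewrite mulrCA mulfV ?mulr1// gt_eqF.
Qed.

Let mexp_diff u : measurable_fun setT (fun s => expw u s - expw (2 * u) s).
Proof. by apply: measurable_funB; exact: mexpw. Qed.

Let exp_diff_ge0 u s : 0 < u -> 0 < s -> 0 <= expw u s - expw (2 * u) s.
Proof.
move=> u0 s0; rewrite subr_ge0 ler_expR lerN2 ler_wpM2l ?(ltW s0)//.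
by rewrite mulr_natl mulr2n lerDl ltW.
Qed.

Let laplace_diff t u : 0 < t -> 0 < u ->
  (\int[leb]_(s in Dpos) (eta t s * (expw u s - expw (2 * u) s))%:E <=
   (t * (2 * u) `^ delta)%:E)%E.
Proof.
move=> t0 u0; have u20 : 0 < 2 * u by rewrite mulr_gt0.
have h : (\int[leb]_(s in Dpos) (eta t s * (expw u s - expw (2 * u) s))%:E +
    \int[leb]_(s in Dpos) (eta t s * expw (2 * u) s)%:E =
    \int[leb]_(s in Dpos) (eta t s * expw u s)%:E)%E.
  rewrite -ge0_integralD//; last 4 first.
  - move=> s Ds; rewrite lee_fin mulr_ge0 ?eta0// exp_diff_ge0//.
    by move: Ds; rewrite /Dpos/= in_itv/= andbT.
  - exact: meta.
  - by move=> s Ds; rewrite lee_fin mulr_ge0 ?eta0// expR_ge0.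
  - exact: meta.
  by apply: eq_integral => s _; rewrite -EFinD -mulrDr subrK.
move: h; rewrite !laplace//.
set I := (\int[leb]_(s in Dpos) _)%E => h.
have I0 : (0 <= I)%E.
  apply: integral_ge0 => s Ds; rewrite lee_fin mulr_ge0 ?eta0// exp_diff_ge0//.
  by move: Ds; rewrite /Dpos/= in_itv/= andbT.
have fI : I \is a fin_num.
  rewrite ge0_fin_numE//; have : (I + (expR (- (t * (2 * u) `^ delta)))%:E < +oo)%E.
    by rewrite h ltry.
  by apply: le_lt_trans; rewrite leeDl// lee_fin expR_ge0.
move: h; rewrite -(fineK fI) -EFinD => -[] h; rewrite lee_fin.
have := expR_ge1Dx (- (t * (2 * u) `^ delta)).
have : expR (- (t * u `^ delta)) <= 1.
  by rewrite -[leRHS]expR0 ler_expR oppr_le0 mulr_ge0 ?powR_ge0 ?ltW.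
lra.
Qed.

(** The stable law has moments of order g < delta.  Only its Laplace transform is
known, so the half-line is cut dyadically above T = t^(1/delta): for s of order
T 2^k, k >= 0, the difference exp (- u s) - exp (- 2 u s) with u = 2^(-k) / T is bounded
below, and its integral, at most t (2 u)^delta, is of order 2^(- k delta). *)
Lemma subordinator_moment g : 0 <= g -> g < delta ->
  exists2 K : R, 0 < K & forall t M (f : R -> \bar R), 0 < t -> 0 <= M ->
    measurable_fun Dpos f -> (forall s, Dpos s -> 0 <= f s)%E ->
    (forall s, Dpos s -> f s <= (M * s `^ g)%:E)%E ->
    (\int[leb]_(s in Dpos) ((eta t s)%:E * f s) <= (K * M * t `^ (g / delta))%:E)%E.
Proof.
move=> g0 gd.
(* a lower bound of exp (- y) - exp (- 2 y) for 1/2 <= y <= 1 *)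
pose c : R := expR (- 1) * (1 - expR (- (1/2))).
have c0 : 0 < c.
  rewrite mulr_gt0 ?expR_gt0// subr_gt0 -[ltRHS]expR0 ltr_expR; lra.
pose z : R := 2 `^ (g - delta).
have z0 : 0 < z by exact: powR_gt0.
have z1 : z < 1.
  rewrite /z -[g - delta]opprB powRN invf_lt1 ?powR_gt0//.
  rewrite -[ltLHS](_ : 1 `^ (delta - g) = 1); last by rewrite powR1.
  by apply: gt0_ltr_powR; rewrite ?nnegrE ?subr_gt0// ltr1n.
exists (1 + 2 / c / (1 - z)).
  by rewrite addr_gt0// !divr_gt0// subr_gt0.
move=> t M f t0 M0 mf f0 fM.
pose T := t `^ delta^-1; have T0 : 0 < T by exact: powR_gt0.
have Tg : T `^ g = t `^ (g / delta) by rewrite /T -powRrM mulrC.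
have Dp s : Dpos s -> 0 < s by rewrite /Dpos/= in_itv/= andbT.
pose u (k : nat) : R := (2 ^+ k)^-1 / T.
have twok k : 0 < 2 ^+ k :> R by exact: exprn_gt0.
have u0 k : 0 < u k by rewrite divr_gt0// invr_gt0.
pose a (k : nat) : R := M * T `^ g * ((2 ^+ k) `^ g / c).
have a0 k : 0 <= a k by rewrite mulr_ge0 ?divr_ge0 ?mulr_ge0 ?powR_ge0// ltW.
pose G k s : \bar R :=
  ((a k)%:E * (eta t s * (expw (u k) s - expw (2 * u k) s))%:E)%E.
pose a1 : R := M * T `^ g * expR 1.
have a10 : 0 <= a1 by rewrite !mulr_ge0 ?powR_ge0 ?expR_ge0.
have mG k : measurable_fun Dpos (G k) by apply: measurable_funeM; exact: meta.
have G0 k s : Dpos s -> (0 <= G k s)%E.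
  move=> Ds; rewrite mule_ge0 ?lee_fin ?a0// mulr_ge0 ?eta0// exp_diff_ge0//.
  exact: Dp.
have pw s : Dpos s -> ((eta t s)%:E * f s <=
    a1%:E * (eta t s * expw T^-1 s)%:E + \sum_(0 <= k <oo) G k s)%E.
  move=> Ds; have s0 := Dp _ Ds; have e0 := eta0 t0 Ds.
  apply: (le_trans (lee_wpmul2l _ (fM s Ds))); first by rewrite lee_fin.
  have sT : 0 <= s / T by rewrite divr_ge0 ?ltW.
  have sg : s `^ g = T `^ g * (s / T) `^ g.
    by rewrite -powRM ?(ltW T0)// mulrCA mulfV ?mulr1// gt_eqF.
  have [k [xk [k00|k2]]] := dyadic_scale sT.
    rewrite -[leLHS]adde0; apply: leeD; last by apply: nneseries_ge0 => k' _ _; exact: G0.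
    rewrite -!EFinM lee_fin sg /a1 /expw.
    have h1 : (s / T) `^ g <= 1.
      rewrite -[leRHS](_ : 1 `^ g = 1); last by rewrite powR1.
      apply: le_powR => //; move: xk; rewrite k00 expr0; exact: ltW.
    have h2 : 1 <= expR 1 * expR (- (s * T^-1)).
      rewrite -expRD -[leLHS]expR0 ler_expR subr_ge0; move: xk; rewrite k00 expr0; exact: ltW.
    have w0 : 0 <= eta t s * (M * T `^ g) by rewrite !mulr_ge0 ?powR_ge0.
    rewrite [leRHS](_ : _ = eta t s * (M * T `^ g) * (expR 1 * expR (- (s * T^-1)))); last by ring.
    rewrite [leLHS](_ : _ = eta t s * (M * T `^ g) * (s / T) `^ g); last by ring.
    by rewrite ler_wpM2l// (le_trans h1).
  apply: (@le_trans _ _ (G k s)); last first.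
    rewrite -[leLHS]add0e; apply: leeD.
      by rewrite mule_ge0 ?lee_fin// mulr_ge0// expR_ge0.
    by apply: nneseries_ge_term => n; exact: G0.
  rewrite -!EFinM lee_fin sg /a /expw.
  have h1 : (s / T) `^ g <= (2 ^+ k) `^ g by apply: le_powR => //; exact: ltW.
  pose y := s * u k.
  have yE : y = s / T / 2 ^+ k by rewrite /y /u; field; rewrite !gt_eqF.
  have y1 : y <= 1 by rewrite yE ler_pdivrMr// mul1r ltW.
  have y2 : 1/2 <= y by rewrite yE ler_pdivlMr//; lra.
  have h2 : c <= expR (- (s * u k)) - expR (- (s * (2 * u k))).
    rewrite -/y (_ : s * (2 * u k) = y + y); last by rewrite /y; ring.
    rewrite opprD expRD -[X in X - _]mulr1 -mulrBr /c.
    apply: ler_pM.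
    - exact: expR_ge0.
    - by rewrite subr_ge0 -[leRHS]expR0 ler_expR; lra.
    - by rewrite ler_expR lerN2.
    - by rewrite lerB// ler_expR lerN2.
  have w0 : 0 <= eta t s * (M * T `^ g) by rewrite !mulr_ge0 ?powR_ge0.
  rewrite [leRHS](_ : _ = eta t s * (M * T `^ g) * ((2 ^+ k) `^ g *
     ((expR (- (s * u k)) - expR (- (s * (2 * u k)))) / c))); last first.
    by field; rewrite gt_eqF.
  rewrite [leLHS](_ : _ = eta t s * (M * T `^ g) * (s / T) `^ g); last by ring.
  rewrite ler_wpM2l// (le_trans h1)// ler_peMr ?powR_ge0//.
  by rewrite ler_pdivlMr// mul1r.
have msum : measurable_fun Dpos (fun s => \sum_(0 <= k <oo) G k s)%E.
  by apply: ge0_emeasurable_sum => // k s Ds _; exact: G0.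
have me1 : measurable_fun Dpos (fun s => a1%:E * (eta t s * expw T^-1 s)%:E)%E.
  by apply: measurable_funeM; exact: meta.
have sum0 s : Dpos s -> (0 <= \sum_(0 <= k <oo) G k s)%E.
  by move=> Ds; apply: nneseries_ge0 => k _ _; exact: G0.
have e10 s : Dpos s -> (0 <= a1%:E * (eta t s * expw T^-1 s)%:E)%E.
  by move=> Ds; rewrite mule_ge0 ?lee_fin// mulr_ge0 ?eta0 ?expR_ge0.
apply: (@le_trans _ _ (\int[leb]_(s in Dpos) (a1%:E * (eta t s * expw T^-1 s)%:E
    + \sum_(0 <= k <oo) G k s))%E).
  apply: ge0_le_integral => //.
  - by move=> s Ds; rewrite mule_ge0 ?f0// lee_fin eta0.
  - apply: emeasurable_funM => //; apply/measurable_EFinP.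
    exact: measurable_subordinator.
  - exact: emeasurable_funD.
rewrite ge0_integralD//.
have i1 : (\int[leb]_(s in Dpos) (a1%:E * (eta t s * expw T^-1 s)%:E) = (M * T `^ g)%:E)%E.
  rewrite ge0_integralZl//; last 2 first.
  - exact: meta.
  - by move=> s Ds; rewrite lee_fin mulr_ge0 ?eta0 ?expR_ge0.
  rewrite laplace ?invr_gt0// -[T^-1]mul1r scaled// powR1 -EFinM /a1.
  have e11 : expR 1 * expR (- 1) = 1 :> R by rewrite -expRD subrr expR0.
  by congr EFin; rewrite -[LHS]mulrA e11 mulr1.
have i2 : (\int[leb]_(s in Dpos) \sum_(0 <= k <oo) G k s <=
    (M * T `^ g * (2 / c) / (1 - z))%:E)%E.
  rewrite integral_nneseries//.
  rewrite -nneseries_geometric//; last 2 first.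
  - by rewrite !mulr_ge0 ?powR_ge0// ?invr_ge0 ltW.
  - exact: ltW.
  apply: lee_nneseries => [k _ _|k _].
    by apply: integral_ge0 => s Ds; exact: (G0 k s Ds).
  have ak0 : (0 <= (a k)%:E)%E by rewrite lee_fin.
  rewrite ge0_integralZl//; last first.
    move=> s Ds; rewrite lee_fin mulr_ge0 ?eta0// exp_diff_ge0//; exact: Dp.
    exact: (meta t0 (mexp_diff _)).
  apply: (@le_trans _ _ ((a k)%:E * (t * (2 * u k) `^ delta)%:E)%E).
    by apply: lee_wpmul2l => //; exact: laplace_diff.
  have k20 : 0 <= 2 * (2 ^+ k)^-1 :> R by rewrite mulr_ge0// invr_ge0 ltW.
  have -> : t * (2 * u k) `^ delta = (2 * (2 ^+ k)^-1) `^ delta.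
    by rewrite -(scaled t0 k20) /u mulrA.
  rewrite -EFinM lee_fin.
  rewrite powRM ?invr_ge0 ?(ltW (twok k))//.
  have -> : z ^+ k = (2 ^+ k) `^ g * ((2 ^+ k)^-1) `^ delta.
    have -> : z ^+ k = (2 ^+ k) `^ (g - delta).
      by rewrite /z -!powR_mulrn ?powR_ge0// -!powRrM mulrC.
    rewrite gt0_powRB//; congr (_ * _).
    by rewrite -[(2 ^+ k)^-1]powR_inv1 ?ltW// -powRrM mulN1r powRN.
  rewrite /a [leRHS](_ : _ = 2 * (M * T `^ g / c * (2 ^+ k) `^ g * (2 ^+ k)^-1 `^ delta)); last first.
    by field; rewrite gt_eqF.
  rewrite [leLHS](_ : _ = 2 `^ delta * (M * T `^ g / c * (2 ^+ k) `^ g * (2 ^+ k)^-1 `^ delta)); last first.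
    by field; rewrite gt_eqF.
  apply: ler_wpM2r.
    by rewrite !mulr_ge0 ?powR_ge0// invr_ge0 ltW.
  by apply: ler1_powR; [lra|exact: ltW].
rewrite i1; apply: (le_trans (leeD (lexx _) i2)).
rewrite -EFinD lee_fin -Tg le_eqVlt; apply/orP; left; apply/eqP; field.
by rewrite !gt_eqF// subr_gt0.
Qed.

(** The stable law at time t charges a window around T = t^(1/delta) with a mass
bounded below.  Indeed exp (- s / T) has mean exp (- 1), of which at most
e * exp (- M^delta) comes from s < T / M, because there exp (- s / T) is at most
e * exp (- M s / T), and at most exp (- 3) comes from s > 6 T, because there it is
at most exp (- 3) * exp (- s / (2 T)). *)
Lemma subordinator_window : exists a b c : R, [/\ 0 < a, a <= b, 0 < c &
  forall (t m : R) (f : R -> \bar R), 0 < t -> 0 <= m ->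
    measurable_fun Dpos f -> (forall s, Dpos s -> 0 <= f s)%E ->
    (forall s, a * t `^ delta^-1 <= s -> s <= b * t `^ delta^-1 -> (m%:E <= f s)%E) ->
    ((c * m)%:E <= \int[leb]_(s in Dpos) ((eta t s)%:E * f s))%E].
Proof.
(* chosen so that e * exp (- M^delta) = exp (- 3) *)
pose M : R := 4 `^ delta^-1.
have M1 : 1 <= M.
  rewrite -[leLHS](_ : 1 `^ delta^-1 = 1); last by rewrite powR1.
  by apply: le_powR => //; [rewrite invr_ge0 ltW|lra].
have M0 : 0 < M by lra.
have Md : M `^ delta = 4 by rewrite /M -powRrM mulVf ?gt_eqF// powRr1.
exists M^-1, 6, (expR (- 1) - 2 * expR (- 3)); split.
- by rewrite invr_gt0.
- by rewrite (@le_trans _ _ 1)// ?invf_le1//; lra.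
- have -> : - 1 = - 3 + 2 :> R by ring.
  have := expR_gt0 (- 3 : R); have := expR_ge1Dx (2 : R).
  rewrite (expRD (- 3) 2) => e2 e3; have : expR (- 3) * (1 + 2) <= expR (- 3) * expR 2 :> R.
    by rewrite ler_wpM2l ?expR_ge0.
  lra.
move=> t m f t0 m0 mf f0 fm.
set I := (\int[leb]_(s in Dpos) _)%E.
pose T := t `^ delta^-1; have T0 : 0 < T by exact: powR_gt0.
have Dp s : Dpos s -> 0 < s by rewrite /Dpos/= in_itv/= andbT.
pose w (a u s : R) : \bar R := (a%:E * (eta t s * expw (u / T) s)%:E)%E.
have mw a u : measurable_fun Dpos (w a u).
  by apply: measurable_funeM; exact: (meta t0 (mexpw _)).
have w0 a u s : 0 <= a -> Dpos s -> (0 <= w a u s)%E.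
  by move=> a0 Ds; rewrite mule_ge0 ?lee_fin// mulr_ge0 ?eta0 ?expR_ge0.
have iw a u : 0 <= a -> 0 < u ->
    (\int[leb]_(s in Dpos) w a u s = (a * expR (- (u `^ delta)))%:E)%E.
  move=> a0 u0.
  have mE : measurable_fun Dpos (fun s => (eta t s * expw (u / T) s)%:E).
    exact: (meta t0 (mexpw _)).
  have E0 s : Dpos s -> (0 <= (eta t s * expw (u / T) s)%:E)%E.
    by move=> Ds; rewrite lee_fin mulr_ge0 ?eta0 ?expR_ge0.
  rewrite ge0_integralZl ?lee_fin//.
  by rewrite laplace ?divr_gt0// scaled ?ltW.
have me0 : 0 <= m * expR (- 3) by rewrite mulr_ge0 ?expR_ge0.
have me1 : 0 <= m * expR 1 by rewrite mulr_ge0 ?expR_ge0.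
have mef : measurable_fun Dpos (fun s => (eta t s)%:E * f s)%E.
  apply: emeasurable_funM => //; apply/measurable_EFinP.
  exact: measurable_subordinator.
have ef0 s : Dpos s -> (0 <= (eta t s)%:E * f s)%E.
  by move=> Ds; rewrite mule_ge0 ?f0// lee_fin eta0.
have key : (\int[leb]_(s in Dpos) w m 1%R s <=
    I + (\int[leb]_(s in Dpos) w (m * expR 1)%R M s +
         \int[leb]_(s in Dpos) w (m * expR (- 3))%R (1/2)%R s))%E.
  have ww0 s : Dpos s -> (0 <= w (m * expR 1)%R M s + w (m * expR (- 3))%R (1/2)%R s)%E.
    by move=> Ds; rewrite adde_ge0// w0.
  have mww : measurable_fun Dpos
      (fun s => w (m * expR 1)%R M s + w (m * expR (- 3))%R (1/2)%R s)%E.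
    exact: emeasurable_funD.
  have wa s : Dpos s -> (0 <= w (m * expR 1)%R M s)%E by exact: w0.
  have wb s : Dpos s -> (0 <= w (m * expR (- 3))%R (1/2)%R s)%E by exact: w0.
  have mwa := mw (m * expR 1) M; have mwb := mw (m * expR (- 3)) (1/2).
  rewrite -ge0_integralD// -ge0_integralD//.
  apply: ge0_le_integral => //.
  - by move=> s Ds; exact: w0.
  - exact: mw.
  - exact: emeasurable_funD.
  move=> s Ds; have s0 := Dp _ Ds; have e0 := eta0 t0 Ds.
  have [sa|sa] := ltP s (M^-1 * T).
    rewrite -[leLHS]add0e; apply: leeD; first exact: ef0.
    rewrite -[leLHS]adde0; apply: leeD; last exact: w0.
    rewrite /w -!EFinM lee_fin /expw.
    rewrite [leRHS](_ : _ = m * (eta t s * (expR 1 * expR (- (s * (M / T)))))); last by ring.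
    rewrite ler_wpM2l// ler_wpM2l// -expRD ler_expR.
    have x1 : s * (M / T) <= 1.
      by rewrite mulrA ler_pdivrMr// mul1r -ler_pdivlMr// mulrC ltW.
    have : 0 <= s * (1 / T) by rewrite mulr_ge0 ?divr_ge0 ?ltW.
    lra.
  have [sb|sb] := leP s (6 * T).
    rewrite -[leLHS]adde0; apply: leeD; last exact: ww0.
    apply: (@le_trans _ _ ((eta t s)%:E * m%:E)%E); last first.
      by apply: lee_wpmul2l; [rewrite lee_fin|exact: fm].
    rewrite /w -!EFinM lee_fin mulrCA ler_wpM2l// ler_piMr//.
    by rewrite /expw -[leRHS]expR0 ler_expR oppr_le0 mulr_ge0 ?divr_ge0 ?ltW.
  rewrite -[leLHS]add0e; apply: leeD; first exact: ef0.
  rewrite -[leLHS]add0e; apply: leeD; first exact: w0.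
  rewrite /w -!EFinM lee_fin /expw.
  rewrite [leRHS](_ : _ = m * (eta t s * (expR (- 3) * expR (- (s * (1 / 2 / T)))))); last by ring.
  rewrite ler_wpM2l// ler_wpM2l// -expRD ler_expR.
  have x6 : 6 < s / T by rewrite ltr_pdivlMr.
  have -> : s * (1 / T) = s / T by rewrite mul1r.
  have -> : s * (1 / 2 / T) = s / T / 2 by field; rewrite gt_eqF.
  lra.
move: key; rewrite !iw// => key.
have key2 : ((m * expR (- 1))%:E <= I + (2 * (m * expR (- 3)))%:E)%E.
  move: key; rewrite powR1 => /le_trans; apply; rewrite leeD2l// -EFinD lee_fin.
  rewrite Md -mulrA -expRD (_ : 1 + - 4 = - 3 :> R); last by ring.
  by rewrite mulr_natl mulr2n lerD2l ler_piMr//.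
rewrite [leLHS](_ : _ = (m * expR (- 1))%:E - (2 * (m * expR (- 3)))%:E)%E.
  by rewrite leeBlDr.
by rewrite -EFinB; congr EFin; ring.
Qed.

End stable_subordinator.

(** * Heat energies and the Besov norm *)

Section monotone_integral.
Local Open Scope ereal_scope.
Context d (T : measurableType d) (R : realType).
Variable mu : {measure set T -> \bar R}.

(** The integral of a nonnegative function is a supremum over the simple functions
below it, so it is monotone without measurability.  This matters for the Besov
norm of the superlevel sets, as a function of the level an uncountable
supremum. *)
Lemma ge0_le_integral_any (D : set T) (f g : T -> \bar R) :
  (forall x, D x -> 0 <= f x) -> (forall x, D x -> f x <= g x) ->
  \int[mu]_(x in D) f x <= \int[mu]_(x in D) g x.
Proof.
move=> f0 fg; have g0 x : D x -> 0 <= g x by move=> Dx; exact: le_trans (f0 x Dx) (fg x Dx).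
rewrite !ge0_integralE//; apply: ereal_sup_le => _ [h /= hf <-].
exists h => //= x; apply: (le_trans (hf x)).
by rewrite !patchE; case: ifPn => // /set_mem /fg.
Qed.

End monotone_integral.

Section product_sigma_finite.
Context (R : realType) d1 d2 (T1 : measurableType d1) (T2 : measurableType d2).
Variable m1 : {sigma_finite_measure set T1 -> \bar R}.
Variable m2 : {sigma_finite_measure set T2 -> \bar R}.

(** An alias that carries sigma-finiteness, so that the Tonelli theorem applies
to time and pairs of points. *)
Definition prod_measure : set (T1 * T2)%type -> \bar R := (m1 \x m2)%E.

HB.instance Definition _ := Measure.on prod_measure.

Let prod_measure_sigma_finite : sigma_finite setT prod_measure.
Proof.
have /sigma_finiteP[A [AT ndA Afin]] := sigma_finiteT m1.
have /sigma_finiteP[B [BT ndB Bfin]] := sigma_finiteT m2.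
exists (fun n => A n `*` B n) => [|n].
  apply/esym/seteqP; split => // -[x y] _.
  have [i _ Aix] : (\bigcup_n A n) x by rewrite -AT.
  have [j _ Bjy] : (\bigcup_n B n) y by rewrite -BT.
  exists (i + j)%N => //; split => /=.
    by have /subsetPset := ndA _ _ (leq_addr j i); exact.
  by have /subsetPset := ndB _ _ (leq_addl i j); exact.
have [mA Aoo] := Afin n; have [mB Boo] := Bfin n.
split; first exact: measurableX.
by rewrite /prod_measure product_measure1E// lte_mul_pinfty// ge0_fin_numE.
Qed.

HB.instance Definition _ := Measure_isSigmaFinite.Build _ _ _ prod_measure
  prod_measure_sigma_finite.

End product_sigma_finite.

Section energies.
Context (R : realType) (d : measure_display) (X : borelMetricType d R).
Variable mu : {sigma_finite_measure set X -> \bar R}.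
Variables (delta : R) (eta : R -> R -> R) (p : R -> X -> X -> R).
Hypothesis eta_density : subordinator_density delta eta.
Hypothesis mp : measurable_fun [set z : R * (X * X) | 0 < z.1]
    (fun z => p z.1 z.2.1 z.2.2).
Hypothesis p0 : forall t x y, 0 < t -> 0 <= p t x y.
Hypothesis mp2 : forall t, 0 < t ->
  measurable_fun [set: X * X] (fun z => p t z.1 z.2).

Implicit Types (f g : X -> R) (s t : R).

Let leb := @lebesgue_measure R.
Let Dpos : set R := `]0, +oo[.
Let mD : measurable Dpos. Proof. exact: measurable_itv. Qed.
Let Dp s : Dpos s -> 0 < s. Proof. by rewrite /Dpos/= in_itv/= andbT. Qed.
Let eta0 t s : 0 < t -> Dpos s -> 0 <= eta t s.
Proof. by move=> t0 /Dp s0; have [_ + _] := eta_density t0; apply. Qed.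

Let nu : {sigma_finite_measure set (X * X)%type -> \bar R} := prod_measure mu mu.
Notation q := (subordinated_kernel eta p).

Definition gap f (z : X * X) : R := `|f z.1 - f z.2|.

Lemma gap_ge0 f z : 0 <= gap f z. Proof. exact: normr_ge0. Qed.

Lemma measurable_gap f : measurable_fun setT f -> measurable_fun setT (gap f).
Proof.
move=> mf; apply: measurableT_comp => //; apply: measurable_funB.
  exact: (measurableT_comp mf).
exact: (measurableT_comp mf).
Qed.

Definition heat_energy f s : \bar R :=
  (\int[prod_measure mu mu]_z ((p s z.1 z.2)%:E * (gap f z)%:E))%E.
Definition sub_energy f t : \bar R :=
  (\int[mu]_y \int[mu]_x ((gap f (x, y))%:E * q t x y))%E.

Lemma heat_energy_ge0 f s : 0 < s -> (0 <= heat_energy f s)%E.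
Proof.
by move=> s0; apply: integral_ge0 => z _; rewrite mule_ge0// lee_fin ?p0 ?gap_ge0.
Qed.

Let Dset : Dpos `*` [set: X * X] = [set z : R * (X * X) | 0 < z.1].
Proof.
apply/seteqP; split => [[s z] [/Dp]//|[s z] /= s0]; split => //=.
by rewrite /Dpos/= in_itv/= andbT.
Qed.

Let mpD : measurable_fun (Dpos `*` [set: X * X]) (fun z => (p z.1 z.2.1 z.2.2)%:E).
Proof. by rewrite Dset; apply/measurable_EFinP; exact: mp. Qed.

Let mDX : measurable (Dpos `*` [set: X * X]).
Proof. exact: measurableX. Qed.

Let metaD t : 0 < t -> measurable_fun (Dpos `*` [set: X * X])
  (fun z : R * (X * X) => (eta t z.1)%:E).
Proof.
move=> t0; apply/measurable_EFinP.
apply: (@measurable_comp _ _ _ _ _ _ Dpos (eta t) _ fst) => //.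
- by move=> _ [[s z] [Ds _] <-].
- exact: (measurable_subordinator eta_density t0).
exact: measurable_funTS.
Qed.

Let mgapD f : measurable_fun setT f -> measurable_fun (Dpos `*` [set: X * X])
  (fun z : R * (X * X) => (gap f z.2)%:E).
Proof.
move=> mf; apply: measurable_funTS; apply/measurable_EFinP.
by apply: (measurableT_comp (measurable_gap mf)).
Qed.

Let qE t z : q t z.1 z.2 = (\int[leb]_(s in Dpos) ((eta t s)%:E * (p s z.1 z.2)%:E))%E.
Proof. by rewrite /subordinated_kernel; apply: eq_integral => s _; rewrite EFinM. Qed.

Let epD t : 0 < t -> measurable_fun (Dpos `*` [set: X * X])
  (fun z : R * (X * X) => (eta t z.1)%:E * (p z.1 z.2.1 z.2.2)%:E)%E.
Proof. by move=> t0; apply: emeasurable_funM => //; exact: metaD. Qed.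

Let ep0 t (z : R * (X * X)) : 0 < t -> (Dpos `*` [set: X * X]) z ->
  (0 <= (eta t z.1)%:E * (p z.1 z.2.1 z.2.2)%:E)%E.
Proof. by move=> t0 [Ds _]; rewrite mule_ge0// lee_fin ?eta0 ?p0//; exact: Dp. Qed.

Lemma sub_kernel_ge0 t (x y : X) : 0 < t -> (0 <= q t x y)%E.
Proof.
move=> t0; apply: integral_ge0 => s Ds.
by rewrite lee_fin mulr_ge0 ?eta0 ?p0//; exact: Dp.
Qed.

Let swapD : measurable_fun ([set: X * X] `*` Dpos)
  (fun z : (X * X) * R => (z.2, z.1)).
Proof. by apply: measurable_funTS; apply: measurable_fun_pair. Qed.

Lemma measurable_sub_kernel t : 0 < t ->
  measurable_fun [set: X * X] (fun z => q t z.1 z.2).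
Proof.
move=> t0.
rewrite (_ : (fun z => _) = fun z => (\int[leb]_(s in Dpos)
   ((eta t s)%:E * (p s z.1 z.2)%:E))%E); last by apply/funext => z; exact: qE.
apply: (@measurable_tonelli_inner _ _ _ _ _ leb setT Dpos
  (fun w : (X * X) * R => (eta t w.2)%:E * (p w.2 w.1.1 w.1.2)%:E)%E) => //.
- apply: (@measurable_comp _ _ _ _ _ _ (Dpos `*` [set: X * X])
     (fun z : R * (X * X) => (eta t z.1)%:E * (p z.1 z.2.1 z.2.2)%:E)%E _
     (fun w : (X * X) * R => (w.2, w.1))) => //.
    by move=> _ [[z s] [_ Ds] <-].
  exact: epD.
- by move=> [z s] [_ Ds]; exact: (ep0 t0 (z := (s, z))).
Qed.

Lemma sub_energy_prod f t : 0 < t -> measurable_fun setT f ->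
  sub_energy f t = (\int[nu]_z ((gap f z)%:E * q t z.1 z.2))%E.
Proof.
move=> t0 mf; apply: esym.
apply: (@fubini_tonelli2 _ _ _ _ _ mu mu (fun z => (gap f z)%:E * q t z.1 z.2)%E).
  apply: emeasurable_funM; last exact: measurable_sub_kernel.
  by apply/measurable_EFinP; exact: measurable_gap.
by move=> z; rewrite mule_ge0 ?sub_kernel_ge0// lee_fin gap_ge0.
Qed.

Lemma measurable_heat_energy f : measurable_fun setT f ->
  measurable_fun Dpos (heat_energy f).
Proof.
move=> mf; rewrite /heat_energy.
apply: (@measurable_tonelli_inner _ _ _ _ _ nu Dpos setT
  (fun w : R * (X * X) => (p w.1 w.2.1 w.2.2)%:E * (gap f w.2)%:E)%E) => //.
- by apply: emeasurable_funM => //; exact: mgapD.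
- by move=> [s z] [/Dp s0 _]; rewrite mule_ge0// lee_fin ?p0 ?gap_ge0.
Qed.

Lemma sub_energyE f t : 0 < t -> measurable_fun setT f ->
  sub_energy f t = (\int[leb]_(s in Dpos) ((eta t s)%:E * heat_energy f s))%E.
Proof.
move=> t0 mf; rewrite sub_energy_prod//.
pose h (w : R * (X * X)) : \bar R :=
  ((eta t w.1)%:E * ((p w.1 w.2.1 w.2.2)%:E * (gap f w.2)%:E))%E.
have mh : measurable_fun (Dpos `*` [set: X * X]) h.
  by apply: emeasurable_funM; [exact: metaD|apply: emeasurable_funM => //; exact: mgapD].
have h0 w : (Dpos `*` [set: X * X]) w -> (0 <= h w)%E.
  move=> [Ds _]; rewrite mule_ge0 ?lee_fin ?eta0// mulr_ge0 ?gap_ge0 ?p0//.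
  exact: Dp.
transitivity (\int[nu]_z \int[leb]_(s in Dpos) h (s, z))%E.
  apply: eq_integral => z _; rewrite qE -ge0_integralZl ?lee_fin ?gap_ge0//.
  - by apply: eq_integral => s _; rewrite /h /= muleCA; congr (_ * _)%E; exact: muleC.
  - apply: emeasurable_funM; apply/measurable_EFinP.
      exact: (measurable_subordinator eta_density t0).
    apply: (@measurable_comp _ _ _ _ _ _ [set z : R * (X * X) | 0 < z.1]
      (fun w => p w.1 w.2.1 w.2.2) Dpos (fun s => (s, z))) => //.
    + by rewrite -Dset.
    + by move=> _ [s /Dp s0 <-].
    + by apply: measurable_funTS; exact: pair2_measurable.
  - by move=> s Ds; rewrite mule_ge0 ?lee_fin ?eta0 ?p0//; exact: Dp.
rewrite -(@tonelli_sets _ _ _ _ _ leb nu Dpos setT h)//.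
apply: eq_integral => s /set_mem Ds; rewrite /heat_energy -ge0_integralZl//.
- apply: emeasurable_funM; apply/measurable_EFinP; first by apply: mp2; exact: Dp.
  exact: measurable_gap.
- by move=> z _; rewrite mule_ge0 ?lee_fin ?gap_ge0 ?p0//; exact: Dp.
- by rewrite lee_fin eta0.
Qed.

Lemma besov_normE alpha f :
  besov_norm mu q 1 alpha f =
  ereal_sup [set ((t `^ (- alpha))%:E * sub_energy f t)%E | t in [set t : R | 0 < t]].
Proof.
rewrite /besov_norm; congr ereal_sup; apply: eq_imagel => t /= t0.
rewrite invr1; congr (_ * _)%E; rewrite poweRe1.
  apply: eq_integral => y _; apply: eq_integral => x _.
  by rewrite powRr1.
apply: integral_ge0 => y _; apply: integral_ge0 => x _.
by rewrite mule_ge0 ?sub_kernel_ge0// lee_fin powR_ge0.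
Qed.

Lemma sub_energy_ge0 f t : 0 < t -> (0 <= sub_energy f t)%E.
Proof.
move=> t0; apply: integral_ge0 => y _; apply: integral_ge0 => x _.
by rewrite mule_ge0 ?sub_kernel_ge0// lee_fin gap_ge0.
Qed.

Lemma besov_norm_ge0 alpha f : (0 <= besov_norm mu q 1 alpha f)%E.
Proof.
rewrite besov_normE; apply: le_ereal_sup_tmp.
exists ((1 `^ (- alpha))%:E * sub_energy f 1)%E; first by exists 1 => //=; exact: ltr01.
by rewrite mule_ge0 ?sub_energy_ge0// lee_fin powR_ge0.
Qed.

End energies.

(** * Energies at small distances *)

Section energy_estimates.
Context (R : realType) (d : measure_display) (X : borelMetricType d R).
Variable mu : {sigma_finite_measure set X -> \bar R}.
Variables (p : R -> X -> X -> R).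
Variables (dH dW c1 c2 c3 c4 c5 c6 : R).
Hypothesis A1 : forall (x : X) (r : R), compact (closure (ball x r)).
Hypotheses (dW2 : 2 <= dW).
Hypotheses (c10 : 0 < c1) (c20 : 0 < c2).
Hypotheses (c30 : 0 < c3) (c40 : 0 < c4) (c50 : 0 < c5) (c60 : 0 < c6).
Hypothesis ahl : forall (x : X) r, 0 <= r ->
  ((c1 * r `^ dH)%:E <= mu (ball x r) <= (c2 * r `^ dH)%:E)%E.
Hypothesis HB : forall t x y, 0 < t ->
  c5 * t `^ (- (dH / dW)) * expR (- (c6 * stretch dW t (mdist x y))) <=
  p t x y <=
  c3 * t `^ (- (dH / dW)) * expR (- (c4 * stretch dW t (mdist x y))).
Hypothesis psym : forall t x y, 0 < t -> p t x y = p t y x.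
Hypothesis mp2 : forall t, 0 < t ->
  measurable_fun [set: X * X] (fun z => p t z.1 z.2).

Implicit Types (f g : X -> R) (s t r : R).

Let nu : {sigma_finite_measure set (X * X)%type -> \bar R} := prod_measure mu mu.
Let p0 t x y : 0 < t -> 0 <= p t x y. Proof. exact: (heat_kernel_ge0 c50 HB). Qed.
Let dW0 : 0 < dW. Proof. by move: dW2; lra. Qed.
Let dWn : dW != 0. Proof. by rewrite gt_eqF. Qed.

Let mpE t : 0 < t -> measurable_fun [set: X * X] (fun z => (p t z.1 z.2)%:E).
Proof. by move=> t0; apply/measurable_EFinP; exact: mp2. Qed.

(** The pairs separated by A form A x A^c and A^c x A, which exchange the same
amount of heat. *)
Lemma heat_energy_indic (A : set X) s : measurable A -> 0 < s ->
  heat_energy mu p \1_A s = (2%:E * heat_loss mu p A s)%E.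
Proof.
move=> mA s0; have mAc : measurable (~` A) by exact: measurableC.
pose pE (z : X * X) := (p s z.1 z.2)%:E.
have mpE' D : measurable_fun D pE by apply: measurable_funTS; exact: mpE.
have pE0 z : (0 <= pE z)%E by rewrite lee_fin p0.
have m1 : measurable (A `*` ~` A) by exact: measurableX.
have m2 : measurable (~` A `*` A) by exact: measurableX.
rewrite /heat_energy.
rewrite (eq_integral (fun z => (pE \_ (A `*` ~` A)) z + (pE \_ (~` A `*` A)) z)%E);
  last first.
  move=> [x y] _; rewrite !patchE !in_setX/= !in_setC /gap/= !indicE.
  case: (x \in A); case: (y \in A) => //=.
  - by rewrite subrr normr0 mule0 adde0.
  - by rewrite subr0 normr1 mule1 adde0.
  - by rewrite sub0r normrN normr1 mule1 add0e.
  - by rewrite subrr normr0 mule0 adde0.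
have r0 D z : (0 <= (pE \_ D) z)%E by rewrite patchE; case: ifP.
rewrite ge0_integralD//; last 2 first.
- by apply/(measurable_restrictT _ m1).
- by apply/(measurable_restrictT _ m2).
rewrite -!integral_mkcond.
have e1 : (\int[prod_measure mu mu]_(z in A `*` ~` A) pE z = heat_loss mu p A s)%E.
  by rewrite -[LHS](@tonelli_prod _ _ _ _ _ mu mu A (~` A) pE).
have e2 : (\int[prod_measure mu mu]_(z in ~` A `*` A) pE z = heat_loss mu p A s)%E.
  rewrite -[LHS](@tonelli_prod _ _ _ _ _ mu mu (~` A) A pE)//.
  rewrite (@tonelli_sets _ _ _ _ _ mu mu (~` A) A pE)//.
  apply: eq_integral => y _; apply: eq_integral => x _.
  by rewrite /pE/= psym.
by rewrite e1 e2 -mule2n -mule_natl.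
Qed.

(** Up to the normalization r^(-lambda-dH) this is the Korevaar-Schoen energy in a
regular space.  It mediates between that energy and the heat energy. *)
Definition near_energy f r : \bar R :=
  (\int[prod_measure mu mu]_(z in [set z | (mdist z.1 z.2 < r)%R]) (gap f z)%:E)%E.

Let near r := [set z : X * X | (mdist z.1 z.2 < r)%R].

Let mnear r : measurable (near r).
Proof. by apply: (open_measurable_prod A1); exact: open_mdist_lt. Qed.

Let nearE r x y : ((x, y) \in near r) = (y \in (ball x r : set X)).
Proof.
by apply/idP/idP => /set_mem h; apply/mem_set; move: h; rewrite ballEmdist.
Qed.

Let nearEr r x y : ((x, y) \in near r) = (x \in (ball y r : set X)).
Proof.
by apply/idP/idP => /set_mem h; apply/mem_set; move: h;
  rewrite ballEmdist/= metric_sym.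
Qed.

Lemma near_energy_ge0 f r : (0 <= near_energy f r)%E.
Proof. by apply: integral_ge0 => z _; rewrite lee_fin gap_ge0. Qed.

Lemma heat_energy_le_near a : 0 <= a -> exists2 K : R, 0 < K &
  forall f (M s : R), measurable_fun setT f -> 0 < s -> 0 <= M ->
    (forall r : R, 0 < r -> (near_energy f r <= (M * r `^ a)%:E)%E) ->
    (heat_energy mu p f s <= (K * M * s `^ ((a - dH) / dW))%:E)%E.
Proof.
move=> a0; have [K K0 KP] := sub_gaussian_integral_le dH dW2 c30 c40 a0.
exists K => // f M s mf s0 M0 Mf.
apply: (KP _ _ nu (fun z => mdist z.1 z.2) (fun z => (gap f z)%:E)
  (fun z => p s z.1 z.2)) => //.
- exact: measurable_mdist.
- by move=> z; exact: mdist_ge0.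
- by apply/measurable_EFinP; exact: measurable_gap.
- by move=> z; rewrite lee_fin gap_ge0.
- exact: mp2.
- by move=> z; exact: p0.
- by move=> z; have /andP[] := HB z.1 z.2 s0.
Qed.

Lemma near_le_heat_energy f s r : measurable_fun setT f -> 0 < s ->
  r <= s `^ dW^-1 ->
  ((c5 * expR (- c6) * s `^ (- (dH / dW)))%:E * near_energy f r <=
   heat_energy mu p f s)%E.
Proof.
move=> mf s0 rs; set k := c5 * _ * _.
have k0 : 0 <= k by rewrite !mulr_ge0 ?expR_ge0 ?powR_ge0// ltW.
have mnr := mnear r.
have mg : measurable_fun (near r) (fun z => (gap f z)%:E).
  by apply/measurable_EFinP; apply: measurable_funTS; exact: measurable_gap.
have mh : measurable_fun setT (fun z : X * X => (p s z.1 z.2)%:E * (gap f z)%:E)%E.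
  apply: emeasurable_funM; first exact: mpE.
  by apply/measurable_EFinP; exact: measurable_gap.
have h0 (z : X * X) : (0 <= (p s z.1 z.2)%:E * (gap f z)%:E)%E.
  by rewrite mule_ge0 ?lee_fin ?p0 ?gap_ge0.
rewrite /near_energy -ge0_integralZl//; last by move=> z _; rewrite lee_fin gap_ge0.
apply: (@le_trans _ _ (\int[prod_measure mu mu]_(z in near r)
    ((p s z.1 z.2)%:E * (gap f z)%:E))%E); last first.
  by apply: ge0_subset_integral => //; exact: mnear.
apply: ge0_le_integral_any => [z _|z zr].
  by rewrite mule_ge0// lee_fin gap_ge0.
rewrite lee_wpmul2r ?lee_fin ?gap_ge0//.
apply: (heat_kernel_lower dW2 c50 c60 HB) => //.
by rewrite ltW// (lt_le_trans zr).
Qed.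

(** |f x - f y| <= |f x| + |f y|, and balls have measure at most c2 r^dH.  It
serves at large distances, where the Korevaar-Schoen condition says nothing. *)
Lemma near_energy_le_L1 f (N r : R) : measurable_fun setT f -> 0 <= r ->
  (\int[mu]_x `|f x|%:E <= N%:E)%E ->
  (near_energy f r <= (2 * c2 * N * r `^ dH)%:E)%E.
Proof.
move=> mf r0 fN.
have mabs : measurable_fun setT (fun x => `|f x|%:E).
  by apply/measurable_EFinP; exact: measurableT_comp.
have mB x : measurable (ball x r : set X) by exact: ball_measurable.
pose g1 (z : X * X) := ((fun z : X * X => `|f z.1|%:E) \_ (near r)) z.
pose g2 (z : X * X) := ((fun z : X * X => `|f z.2|%:E) \_ (near r)) z.
have mg1 : measurable_fun setT g1.
  apply/(measurable_restrictT _ (mnear r)); apply: measurable_funTS.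
  exact: (measurableT_comp mabs).
have mg2 : measurable_fun setT g2.
  apply/(measurable_restrictT _ (mnear r)); apply: measurable_funTS.
  exact: (measurableT_comp mabs).
have g10 z : (0 <= g1 z)%E by rewrite /g1 patchE; case: ifP => // _; rewrite lee_fin.
have g20 z : (0 <= g2 z)%E by rewrite /g2 patchE; case: ifP => // _; rewrite lee_fin.
have bound : (\int[mu]_x (`|f x|%:E * mu (ball x r)) <= (c2 * N * r `^ dH)%:E)%E.
  have k0 : (0 <= (c2 * r `^ dH)%:E)%E.
    by rewrite lee_fin mulr_ge0 ?powR_ge0 ?ltW.
  apply: (@le_trans _ _ (\int[mu]_x ((c2 * r `^ dH)%:E * `|f x|%:E))%E).
    apply: ge0_le_integral_any => x _; first by rewrite mule_ge0// lee_fin.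
    rewrite muleC; apply: lee_wpmul2r; first by rewrite lee_fin.
    by have /andP[] := ahl x r0.
  rewrite ge0_integralZl//.
  rewrite [leRHS](_ : _ = (c2 * r `^ dH)%:E * N%:E)%E.
    exact: lee_wpmul2l.
  by rewrite -EFinM mulrAC.
have e1 : (\int[prod_measure mu mu]_z g1 z = \int[mu]_x (`|f x|%:E * mu (ball x r)))%E.
  rewrite (@fubini_tonelli1 _ _ _ _ _ mu mu g1)//; apply: eq_integral => x _.
  rewrite /fubini_F; transitivity (\int[mu]_(y in ball x r) (cst `|f x|%:E y))%E.
    rewrite [RHS]integral_mkcond; apply: eq_integral => y _.
    by rewrite /g1 !patchE nearE.
  by rewrite integral_cst.
have e2 : (\int[prod_measure mu mu]_z g2 z = \int[mu]_x (`|f x|%:E * mu (ball x r)))%E.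
  rewrite (@fubini_tonelli2 _ _ _ _ _ mu mu g2)//; apply: eq_integral => x _.
  rewrite /fubini_G; transitivity (\int[mu]_(y in ball x r) (cst `|f x|%:E y))%E.
    rewrite [RHS]integral_mkcond; apply: eq_integral => y _.
    by rewrite /g2 !patchE nearEr.
  by rewrite integral_cst.
apply: (@le_trans _ _ (\int[prod_measure mu mu]_z (g1 z + g2 z))%E).
  rewrite /near_energy [leLHS]integral_mkcond; apply: ge0_le_integral_any => z _.
    by rewrite patchE; case: ifP => // _; rewrite lee_fin gap_ge0.
  rewrite /g1 /g2 !patchE; case: ifP => _; last by rewrite adde0.
  by rewrite -EFinD lee_fin /gap ler_normB.
rewrite ge0_integralD// e1 e2; apply: (le_trans (leeD bound bound)).
by rewrite -EFinD lee_fin; lra.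
Qed.

Lemma KS_energyE lambda f r : 0 < r ->
  KS_energy mu lambda 1 f r = (\int[mu]_x \int[mu]_(y in ball x r)
     ((r `^ lambda * fine (mu (ball x r)))^-1%:E * (gap f (x, y))%:E))%E.
Proof.
move=> r0; apply: eq_integral => x _; apply: eq_integral => y _.
by rewrite powRr1 ?normr_ge0// mulr1 -EFinM mulrC.
Qed.

Let near_iter f r : measurable_fun setT f ->
  near_energy f r = (\int[mu]_x \int[mu]_(y in ball x r) (gap f (x, y))%:E)%E.
Proof.
move=> mf; pose g := (fun z : X * X => (gap f z)%:E) \_ (near r).
have mg : measurable_fun setT g.
  apply/(measurable_restrictT _ (mnear r)); apply: measurable_funTS.
  by apply/measurable_EFinP; exact: measurable_gap.
have g0 z : (0 <= g z)%E by rewrite /g patchE; case: ifP => // _; rewrite lee_fin gap_ge0.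
rewrite /near_energy integral_mkcond (@fubini_tonelli1 _ _ _ _ _ mu mu g)//.
apply: eq_integral => x _; rewrite [RHS]integral_mkcond; apply: eq_integral => y _.
by rewrite /g !patchE nearE.
Qed.

Let mgap1 f x r : measurable_fun setT f ->
  measurable_fun (ball x r) (fun y => (gap f (x, y))%:E).
Proof.
move=> mf; apply: measurable_funTS; apply/measurable_EFinP.
apply: (@measurableT_comp _ _ _ _ _ _ (gap f) _ (pair x)); first exact: measurable_gap.
exact: pair1_measurable.
Qed.

Let fine_ball x r : 0 < r ->
  c1 * r `^ dH <= fine (mu (ball x r)) <= c2 * r `^ dH.
Proof.
move=> r0; have := ahl x (ltW r0).
by rewrite -[mu _]fineK ?lee_fin// ge0_fin_numE// (ball_lty ahl).
Qed.

Let miter f r : measurable_fun setT f ->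
  measurable_fun setT (fun x => \int[mu]_(y in ball x r) (gap f (x, y))%:E)%E.
Proof.
move=> mf; pose g := (fun z : X * X => (gap f z)%:E) \_ (near r).
have mg : measurable_fun setT g.
  apply/(measurable_restrictT _ (mnear r)); apply: measurable_funTS.
  by apply/measurable_EFinP; exact: measurable_gap.
have g0 z : (0 <= g z)%E by rewrite /g patchE; case: ifP => // _; rewrite lee_fin gap_ge0.
rewrite (_ : (fun x => _) = fubini_F mu g); first exact: measurable_fun_fubini_tonelli_F.
apply/funext => x; rewrite integral_mkcond; apply: eq_integral => y _.
by rewrite /g !patchE nearE.
Qed.

Lemma near_le_KS_energy lambda f r : measurable_fun setT f -> 0 < r ->
  (near_energy f r <= (c2 * r `^ (dH + lambda))%:E * KS_energy mu lambda 1 f r)%E.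
Proof.
move=> mf r0; rewrite near_iter// KS_energyE//.
have rl : 0 < r `^ lambda by exact: powR_gt0.
have rH : 0 < r `^ dH by exact: powR_gt0.
set k := c2 * _; have k0 : 0 < k by rewrite mulr_gt0// powR_gt0.
have kE : k = c2 * (r `^ dH * r `^ lambda) by rewrite /k gt0_powRD.
rewrite -lee_pdivrMl// -ge0_integralZl//; last 3 first.
- exact: miter.
- by move=> x _; apply: integral_ge0 => y _; rewrite lee_fin gap_ge0.
- by rewrite lee_fin invr_ge0 ltW.
apply: ge0_le_integral_any => x _.
  rewrite mule_ge0//; first by rewrite lee_fin invr_ge0 ltW.
  by apply: integral_ge0 => y _; rewrite lee_fin gap_ge0.
rewrite -ge0_integralZl//; last 4 first.
- exact: ball_measurable.
- exact: mgap1.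
- by move=> y _; rewrite lee_fin gap_ge0.
- by rewrite lee_fin invr_ge0 ltW.
apply: ge0_le_integral_any => y _.
  by rewrite mule_ge0 ?lee_fin ?gap_ge0// invr_ge0 ltW.
rewrite lee_wpmul2r ?lee_fin ?gap_ge0//.
have /andP[b1 b2] := fine_ball x r0.
have f0 : 0 < fine (mu (ball x r)) by apply: lt_le_trans b1; exact: mulr_gt0.
rewrite lef_pV2 ?posrE//; last exact: mulr_gt0.
by rewrite kE mulrA [leRHS]mulrC ler_wpM2l// ltW.
Qed.

Lemma KS_energy_le_near lambda f r : measurable_fun setT f -> 0 < r ->
  (KS_energy mu lambda 1 f r <= (c1 * r `^ (dH + lambda))^-1%:E * near_energy f r)%E.
Proof.
move=> mf r0; rewrite near_iter// KS_energyE//.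
have rl : 0 < r `^ lambda by exact: powR_gt0.
have rH : 0 < r `^ dH by exact: powR_gt0.
set k := c1 * _; have k0 : 0 < k by rewrite mulr_gt0// powR_gt0.
have kE : k = c1 * (r `^ dH * r `^ lambda) by rewrite /k gt0_powRD.
have fb x : 0 < fine (mu (ball x r)).
  have /andP[b1 _] := fine_ball x r0.
  by apply: lt_le_trans b1; exact: mulr_gt0.
rewrite -ge0_integralZl//; last 3 first.
- exact: miter.
- by move=> x _; apply: integral_ge0 => y _; rewrite lee_fin gap_ge0.
- by rewrite lee_fin invr_ge0 ltW.
have i0 x : 0 <= (r `^ lambda * fine (mu (ball x r)))^-1.
  by rewrite invr_ge0 mulr_ge0 ?powR_ge0// ltW.
apply: ge0_le_integral_any => x _.
  by apply: integral_ge0 => y _; rewrite mule_ge0 ?lee_fin ?gap_ge0.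
rewrite -ge0_integralZl//; last 4 first.
- exact: ball_measurable.
- exact: mgap1.
- by move=> y _; rewrite lee_fin gap_ge0.
- by rewrite lee_fin invr_ge0 ltW.
apply: ge0_le_integral_any => y _.
  by rewrite mule_ge0 ?lee_fin ?gap_ge0.
rewrite lee_wpmul2r ?lee_fin ?gap_ge0//.
have /andP[b1 b2] := fine_ball x r0.
rewrite lef_pV2 ?posrE//; last exact: mulr_gt0.
by rewrite kE mulrA [leLHS]mulrC ler_wpM2l// ltW.
Qed.

End energy_estimates.

(** * The critical exponent *)

Section critical_exponent.
Context (R : realType) (d : measure_display) (X : borelMetricType d R).
Variable mu : {sigma_finite_measure set X -> \bar R}.
Variables (delta : R) (eta : R -> R -> R) (p : R -> X -> X -> R).
Variables (dH dW c1 c2 c3 c4 c5 c6 : R).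
Hypothesis A1 : forall (x : X) (r : R), compact (closure (ball x r)).
Hypotheses (dH0 : 0 < dH) (dW2 : 2 <= dW).
Hypotheses (c10 : 0 < c1) (c20 : 0 < c2).
Hypotheses (c30 : 0 < c3) (c40 : 0 < c4) (c50 : 0 < c5) (c60 : 0 < c6).
Hypothesis ahl : forall (x : X) r, 0 <= r ->
  ((c1 * r `^ dH)%:E <= mu (ball x r) <= (c2 * r `^ dH)%:E)%E.
Hypothesis HB : forall t x y, 0 < t ->
  c5 * t `^ (- (dH / dW)) * expR (- (c6 * stretch dW t (mdist x y))) <=
  p t x y <=
  c3 * t `^ (- (dH / dW)) * expR (- (c4 * stretch dW t (mdist x y))).
Hypothesis mp : measurable_fun [set z : R * (X * X) | 0 < z.1]
    (fun z => p z.1 z.2.1 z.2.2).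
Hypothesis mp2 : forall t, 0 < t ->
  measurable_fun [set: X * X] (fun z => p t z.1 z.2).
Hypothesis delta_range : 0 < delta < 1.
Hypothesis eta_density : subordinator_density delta eta.

Implicit Types (f : X -> R) (g s t r l lambda alpha : R).
Notation q := (subordinated_kernel eta p).

Let p0 t x y : 0 < t -> 0 <= p t x y. Proof. exact: (heat_kernel_ge0 c50 HB). Qed.
Let dW0 : 0 < dW. Proof. by move: dW2; lra. Qed.
Let dWn : dW != 0. Proof. by rewrite gt_eqF. Qed.
Let delta0 : 0 < delta. Proof. by have /andP[] := delta_range. Qed.
Let deltan : delta != 0. Proof. by rewrite gt_eqF. Qed.

Let sub_energyE' f t : 0 < t -> measurable_fun setT f ->
  sub_energy mu eta p f t =
  (\int[@lebesgue_measure R]_(s in `]0%R, +oo[) ((eta t s)%:E * heat_energy mu p f s))%E.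
Proof. exact: (sub_energyE mu eta_density mp p0 mp2). Qed.

Lemma Lfun1_facts f : f \in Lfun mu 1%:E -> measurable_fun setT f /\
  exists2 N : R, 0 <= N & (\int[mu]_x `|f x|%:E <= N%:E)%E.
Proof.
move=> fL; split; first by have /sub_Lfun_mfun := fL; rewrite inE.
have /Lfun1_integrable/integrableP[_ fi] := fL.
exists (fine (\int[mu]_x `|f x|%:E)%E).
  by apply/fine_ge0/integral_ge0 => x _; rewrite lee_fin.
by rewrite fineK// ge0_fin_numE//; apply: integral_ge0 => x _; rewrite lee_fin.
Qed.

(** The condition g < delta is that of the existence of moments. *)
Lemma besov_norm_le_heat_energy g : 0 <= g -> g < delta ->
  exists2 K : R, 0 < K & forall f (M : R), measurable_fun setT f -> 0 <= M ->
    (forall s : R, 0 < s -> (heat_energy mu p f s <= (M * s `^ g)%:E)%E) ->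
    (besov_norm mu q 1 (g / delta) f <= (K * M)%:E)%E.
Proof.
move=> g0 gd; have [K K0 KP] := subordinator_moment delta_range eta_density g0 gd.
exists K => // f M mf M0 hf.
rewrite (besov_normE mu eta_density p0); apply: ge_ereal_sup => _ [t /= t0 <-].
rewrite sub_energyE'//.
have tp : 0 < t `^ (g / delta) by exact: powR_gt0.
apply: (@le_trans _ _ ((t `^ (- (g / delta)))%:E * (K * M * t `^ (g / delta))%:E)%E).
  apply: lee_wpmul2l; first by rewrite lee_fin powR_ge0.
  apply: KP => //.
  - exact: (measurable_heat_energy mu mp p0).
  - move=> s; rewrite /= in_itv/= andbT => s0; exact: (heat_energy_ge0 mu p0).
  - by move=> s; rewrite /= in_itv/= andbT => s0; exact: hf.
by rewrite -EFinM lee_fin powRN mulrCA mulVf ?mulr1// gt_eqF.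
Qed.

Lemma sub_energy_window : exists a b c : R, [/\ 0 < a, a <= b, 0 < c &
  forall f t m, measurable_fun setT f -> 0 < t -> 0 <= m ->
    (forall s, a * t `^ delta^-1 <= s -> s <= b * t `^ delta^-1 ->
      (m%:E <= heat_energy mu p f s)%E) ->
    ((c * m)%:E <= sub_energy mu eta p f t)%E].
Proof.
have [a [b [c [a0 ab c0 H]]]] := subordinator_window delta_range eta_density.
exists a, b, c; split => // f t m mf t0 m0 hm.
rewrite sub_energyE'//; apply: H => //.
  exact: (measurable_heat_energy mu mp p0).
by move=> s; rewrite /= in_itv/= andbT => s0; exact: (heat_energy_ge0 mu p0).
Qed.

(** The Korevaar-Schoen condition bounds the energy at small distances, up to some
r0, with the best exponent; the L^1 bound covers r >= r0.  A lower exponent l is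
then available at all distances. *)
Lemma KS_near_energy lambda f : KS mu lambda 1 f -> 0 < lambda ->
  forall l, 0 <= l -> l <= lambda -> exists2 M : R, 0 <= M &
    forall r, 0 < r -> (near_energy mu f r <= (M * r `^ (dH + l))%:E)%E.
Proof.
move=> [fL]; have [mf [N N0 fN]] := Lfun1_facts fL.
rewrite limf_esupE => /ereal_inf_lt[_ [V V0 <-] supV] l0 l le0 ll.
have [r0 r00 Vr] : exists2 r0 : R, 0 < r0 & forall r, 0 < r -> r < r0 -> V r.
  have [e e0 eV] := iffLR (nbhs_ballP _ _) V0.
  exists e => // r rp re; apply: eV => //=.
  by rewrite -ball_normE/= sub0r normrN gtr0_norm.
have [M M0 KSM] : exists2 M : R, 0 <= M & forall r, 0 < r -> r < r0 ->
    (KS_energy mu lambda 1 f r <= M%:E)%E.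
  have KS0 r : (0 <= KS_energy mu lambda 1 f r)%E.
    apply: integral_ge0 => x _; apply: integral_ge0 => y _.
    by rewrite lee_fin divr_ge0 ?powR_ge0// mulr_ge0 ?powR_ge0// fine_ge0.
  have sup_le r : 0 < r -> r < r0 -> (KS_energy mu lambda 1 f r <=
      ereal_sup (KS_energy mu lambda 1 f @` V))%E.
    by move=> rp rr; apply: ereal_sup_ubound; exists r => //; exact: Vr.
  have r2 : 0 < r0 / 2 by rewrite divr_gt0.
  have sup0 : (0 <= ereal_sup (KS_energy mu lambda 1 f @` V))%E.
    by apply: (le_trans (KS0 (r0 / 2))); apply: sup_le => //; lra.
  exists (fine (ereal_sup (KS_energy mu lambda 1 f @` V))); first exact: fine_ge0.
  by move=> r rp rr; rewrite fineK ?ge0_fin_numE//; exact: sup_le.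
exists (c2 * M * r0 `^ (lambda - l) + 2 * c2 * N * r0 `^ (- l)).
  by rewrite addr_ge0// !mulr_ge0 ?powR_ge0// ltW.
move=> r rp; have rH : 0 <= r `^ (dH + l) by exact: powR_ge0.
rewrite mulrDl EFinD; have [rr|rr] := ltP r r0.
- apply: (@le_trans _ _ (c2 * M * r0 `^ (lambda - l) * r `^ (dH + l))%:E); last first.
    by rewrite leeDl// lee_fin !mulr_ge0 ?powR_ge0// ltW.
  apply: (le_trans (near_le_KS_energy A1 c10 c20 ahl lambda mf rp)).
  apply: (@le_trans _ _ ((c2 * r `^ (dH + lambda))%:E * M%:E)%E).
    apply: lee_wpmul2l; first by rewrite lee_fin mulr_ge0 ?powR_ge0// ltW.
    exact: KSM.
  rewrite -EFinM lee_fin [dH + lambda](_ : _ = (lambda - l) + (dH + l)); last by ring.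
  rewrite gt0_powRD//.
  have : r `^ (lambda - l) <= r0 `^ (lambda - l).
    by apply: le_powR; rewrite ?subr_ge0// ltW.
  move=> h; rewrite [leLHS](_ : _ = c2 * M * r `^ (dH + l) * r `^ (lambda - l)); last by ring.
  rewrite [leRHS](_ : _ = c2 * M * r `^ (dH + l) * r0 `^ (lambda - l)); last by ring.
  by rewrite ler_wpM2l// !mulr_ge0// ltW.
- apply: (@le_trans _ _ (2 * c2 * N * r0 `^ (- l) * r `^ (dH + l))%:E); last first.
    by rewrite leeDr// lee_fin !mulr_ge0 ?powR_ge0// ltW.
  apply: (le_trans (near_energy_le_L1 A1 c20 ahl mf (ltW rp) fN)).
  rewrite lee_fin gt0_powRD// powRN.
  have h : r0 `^ l <= r `^ l by apply: le_powR => //; exact: ltW.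
  have rl : 0 < r0 `^ l by exact: powR_gt0.
  rewrite [leRHS](_ : _ = 2 * c2 * N * r `^ dH * (r `^ l / r0 `^ l)); last by ring.
  rewrite ler_peMr ?ler_pdivlMr ?mul1r//.
  by rewrite !mulr_ge0 ?powR_ge0// ltW.
Qed.

(** Energies at distances r = s^(1/dW) of order r^(g dW) give heat energies of order
s^g, whose averages have order t^(g/delta). *)
Lemma besov_of_KS lambda f g : KS mu lambda 1 f -> 0 < lambda ->
  0 <= g -> g * dW <= lambda -> g < delta -> besov mu q 1 (g / delta) f.
Proof.
move=> fKS l0 g0 gl gd; have [fL _] := fKS; split => //.
have [mf _] := Lfun1_facts fL.
have gW : 0 <= g * dW by rewrite mulr_ge0// ltW.
have [M M0 HM] := KS_near_energy fKS l0 gW gl.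
have dHg : 0 <= dH + g * dW by rewrite addr_ge0// ltW.
have [K K0 KP] := heat_energy_le_near mu A1 dW2 c30 c40 c50 HB mp2 dHg.
have [K' K'0 K'P] := besov_norm_le_heat_energy g0 gd.
have KM : 0 <= K * M by rewrite mulr_ge0// ltW.
apply: (le_lt_trans (K'P f (K * M) mf KM _)); last exact: ltry.
move=> s s0; apply: (le_trans (KP f M s mf s0 M0 HM)).
by rewrite lee_fin le_eqVlt; apply/orP; left; rewrite addrC addKr mulfK.
Qed.

(** For t = T^delta with a T = r^dW, the energy at distance r is dominated by every
heat energy in the window [a T, b T], hence by the subordinated energy at t. *)
Lemma KS_of_besov alpha f : 0 < alpha -> besov mu q 1 alpha f ->
  KS mu (alpha * delta * dW) 1 f.
Proof.
move=> al0 [fL fB]; split => //; have [mf [N N0 fN]] := Lfun1_facts fL.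
have [a [b [c [a0 ab c0 H]]]] := sub_energy_window.
have b0 : 0 < b by apply: lt_le_trans ab.
pose B := fine (besov_norm mu q 1 alpha f).
have B0 : 0 <= B by apply: fine_ge0; exact: (besov_norm_ge0 mu eta_density p0).
have BE : besov_norm mu q 1 alpha f = B%:E.
  by rewrite fineK// ge0_fin_numE//; exact: (besov_norm_ge0 mu eta_density p0).
have subB t : 0 < t -> (sub_energy mu eta p f t <= (B * t `^ alpha)%:E)%E.
  move=> t0; have tp : 0 < t `^ alpha by exact: powR_gt0.
  rewrite mulrC EFinM -lee_pdivrMl// -BE (besov_normE mu eta_density p0).
  by apply: ereal_sup_ubound; exists t => //; rewrite powRN.
pose k := c5 * expR (- c6); have k0 : 0 < k by rewrite mulr_gt0// expR_gt0.
pose lam := alpha * delta * dW.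
pose D := B * (b / a) `^ (dH / dW) * a `^ (- (alpha * delta)) / (c * k).
have D0 : 0 <= D.
  by rewrite divr_ge0 ?mulr_ge0 ?powR_ge0// ltW.
have nearD r : 0 < r -> (near_energy mu f r <= (D * r `^ (dH + lam))%:E)%E.
  move=> r0; pose T := r `^ dW / a.
  have T0 : 0 < T by rewrite divr_gt0// powR_gt0.
  pose t := T `^ delta; have t0 : 0 < t by exact: powR_gt0.
  have tT : t `^ delta^-1 = T by rewrite /t -powRrM mulfV// powRr1// ltW.
  have Wfin : near_energy mu f r \is a fin_num.
    rewrite ge0_fin_numE ?near_energy_ge0//.
    apply: (le_lt_trans (near_energy_le_L1 A1 c20 ahl mf (ltW r0) fN)).
    exact: ltry.
  pose W := fine (near_energy mu f r).
  have W0 : 0 <= W by apply/fine_ge0/near_energy_ge0.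
  have WE : near_energy mu f r = W%:E by rewrite fineK.
  have bT0 : 0 < b * T by exact: mulr_gt0.
  have := H f t (k * (b * T) `^ (- (dH / dW)) * W) mf t0.
  have m0 : 0 <= k * (b * T) `^ (- (dH / dW)) * W.
    by rewrite !mulr_ge0 ?powR_ge0// ltW.
  rewrite tT => /(_ m0) HW.
  have {}HW : (c * (k * (b * T) `^ (- (dH / dW)) * W) <= B * t `^ alpha).
    rewrite -lee_fin; apply: (le_trans _ (subB t t0)); apply: HW => s sa sb.
    have s0 : 0 < s by apply: lt_le_trans sa; exact: mulr_gt0.
    have aT : a * T = r `^ dW by rewrite /T mulrCA mulfV ?mulr1// gt_eqF.
    have rs : r <= s `^ dW^-1.
      have -> : r = (r `^ dW) `^ dW^-1 by rewrite -powRrM mulfV// powRr1// ltW.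
      apply: le_powR; rewrite ?powR_ge0// ?invr_ge0 ?(ltW dW0)//.
      by rewrite -aT.
    apply: (le_trans _ (near_le_heat_energy mu A1 dW2 c50 c60 HB mp2 mf s0 rs)).
    rewrite WE -EFinM lee_fin ler_wpM2r// ler_wpM2l ?(ltW k0)//.
    rewrite !powRN lef_pV2 ?posrE ?powR_gt0//.
    by apply: le_powR; rewrite ?divr_ge0// ltW.
  rewrite WE lee_fin.
  have bTp : 0 < (b * T) `^ (dH / dW) by exact: powR_gt0.
  have W_le : W <= B * t `^ alpha * (b * T) `^ (dH / dW) / (c * k).
    have ck : 0 < c * k by exact: mulr_gt0.
    rewrite (ler_pdivlMr _ _ ck) -(ler_pdivrMr _ _ bTp).
    move: HW; rewrite powRN; apply: le_trans.
    by rewrite le_eqVlt; apply/orP; left; apply/eqP; ring.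
  apply: (le_trans W_le).
  have e1 : t `^ alpha = a `^ (- (alpha * delta)) * r `^ lam.
    have ai : 0 <= a^-1 by rewrite invr_ge0 ltW.
    rewrite /t /T -powRrM (powRM _ (powR_ge0 _ _) ai) [LHS]mulrC.
    congr (_ * _).
      by rewrite -[a^-1]powR_inv1 ?(ltW a0)// -powRrM mulN1r mulrC.
    by rewrite -powRrM /lam; congr (_ `^ _); ring.
  have e2 : (b * T) `^ (dH / dW) = (b / a) `^ (dH / dW) * r `^ dH.
    have ba : 0 <= b / a by rewrite divr_ge0// ltW.
    have -> : b * T = b / a * r `^ dW by rewrite /T; ring.
    rewrite (powRM _ ba (powR_ge0 _ _)).
    by rewrite -powRrM; congr (_ * r `^ _); field.
  rewrite e1 e2 /D gt0_powRD// le_eqVlt; apply/orP; left; apply/eqP.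
  by ring.
rewrite limf_esupE; apply: (@le_lt_trans _ _ (c1^-1 * D)%:E); last exact: ltry.
apply: ge_ereal_inf; exists (ereal_sup (KS_energy mu lam 1 f @` [set r | 0 < r])).
  by exists [set r | 0 < r] => //; exact: nbhs_right_gt.
apply: ge_ereal_sup => _ [r /= r0 <-].
apply: (le_trans (KS_energy_le_near A1 c10 ahl lam mf r0)).
have rp : 0 < r `^ (dH + lam) by exact: powR_gt0.
have i0 : (0 <= (c1 * r `^ (dH + lam))^-1%:E)%E.
  by rewrite lee_fin invr_ge0 mulr_ge0// ltW.
apply: (le_trans (lee_wpmul2l i0 (nearD r r0))).
rewrite -EFinM lee_fin le_eqVlt; apply/orP; left; apply/eqP; field.
by rewrite !gt_eqF.
Qed.

(** Besov and Korevaar-Schoen classes correspond through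
lambda = alpha * delta * dW, except that the passage to Besov classes needs
alpha < 1.  If b >= delta, this passage would give classes of all orders
below 1, and the critical exponent would be at least 1. *)
Lemma besov_critical_exponentE kappa : 0 < kappa < dW ->
  (dW - kappa)%:E = KS_critical_exponent mu 1 ->
  (besov_critical_exponent mu q 1 < 1)%E ->
  1 - kappa / dW < delta /\
  besov_critical_exponent mu q 1 = ((1 - kappa / dW) / delta)%:E.
Proof.
move=> /andP[k0 kW] kdef; set A := besov_critical_exponent mu q 1 => A1'.
pose b := 1 - kappa / dW.
have b0 : 0 < b by rewrite subr_gt0 ltr_pdivrMr// mul1r.
have bW : b * dW = dW - kappa by rewrite /b mulrBl mul1r mulfVK.
have low g : 0 < g -> g < b -> g < delta -> ((g / delta)%:E <= A)%E.
  move=> g0 gb gd.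
  have : ((g * dW)%:E < KS_critical_exponent mu 1)%E.
    by rewrite -kdef lte_fin -bW ltr_pM2r.
  move=> /ereal_sup_gt[_ [l [l0 [f fKS fnc]] <-]]; rewrite lte_fin => gl.
  apply: ereal_sup_ubound; exists (g / delta) => //; split; first exact: divr_gt0.
  exists f => //; apply: (besov_of_KS fKS l0 (ltW g0) (ltW gl) gd).
have [r Ar] : exists r, A = r%:E.
  pose g := Num.min b delta / 2.
  have m0 : 0 < Num.min b delta by rewrite lt_min b0 delta0.
  have mb : Num.min b delta <= b by rewrite ge_min lexx.
  have md : Num.min b delta <= delta by rewrite ge_min lexx orbT.
  have g0 : 0 < g by rewrite divr_gt0.
  have gb : g < b by rewrite /g; lra.
  have gd : g < delta by rewrite /g; lra.
  have := low g g0 gb gd.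
  by case: A A1' {low} => // r; exists r.
have r1 : r < 1 by move: A1'; rewrite Ar lte_fin.
have low' g : 0 < g -> g < b -> g < delta -> g <= r * delta.
  by move=> g0 gb gd; have := low g g0 gb gd; rewrite Ar lee_fin ler_pdivrMr.
have rd : r * delta < delta by rewrite -[ltRHS]mul1r ltr_pM2r.
have bd : b < delta.
  rewrite ltNge; apply/negP => db.
  (* a number in (0, delta) above r * delta *)
  pose g := Num.max (delta / 2) ((r * delta + delta) / 2).
  have gd : g < delta by rewrite gt_max; apply/andP; split; move: delta0 rd; lra.
  have g0 : 0 < g by rewrite lt_max; apply/orP; left; rewrite divr_gt0.
  have := low' g g0 (lt_le_trans gd db) gd.
  by rewrite ge_max => /andP[_]; lra.
split=> //; rewrite Ar; congr EFin; apply/eqP; rewrite eq_le; apply/andP; split.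
- rewrite -lee_fin -Ar; apply: ge_ereal_sup => _ [al [al0 [f fB fnc]] <-].
  have fKS := KS_of_besov al0 fB.
  rewrite lee_fin ler_pdivlMr// -(ler_pM2r dW0) -/b bW -lee_fin kdef.
  apply: ereal_sup_ubound; exists (al * delta * dW) => //.
  by split; [rewrite !mulr_gt0|exists f].
- rewrite ler_pdivrMr// -/b leNgt; apply/negP => rb.
  (* a number in (0, b) above r * delta *)
  pose g := Num.max (b / 2) ((r * delta + b) / 2).
  have gb : g < b by rewrite gt_max; apply/andP; split; move: b0 rb; lra.
  have g0 : 0 < g by rewrite lt_max; apply/orP; left; rewrite divr_gt0.
  have := low' g g0 gb (lt_trans gb bd).
  by rewrite ge_max => /andP[_]; lra.
Qed.

End critical_exponent.

(** * The coarea formula *)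

Section layer_cake.
Context (R : realType).

Lemma integral_level_gap (a b : R) : 0 <= a -> 0 <= b ->
  (\int[@lebesgue_measure R]_(s in `]0%R, +oo[)
     (`|(s < a)%R%:R - (s < b)%R%:R|)%:E = `|a - b|%:E)%E.
Proof.
wlog ab : a b / a <= b => [H a0 b0|a0 b0].
  have [ab|/ltW ba] := leP a b; first exact: H.
  by rewrite distrC -H//; apply: eq_integral => s _; rewrite distrC.
transitivity (\int[@lebesgue_measure R]_(s in `]0%R, +oo[)
    (\1_(`[a, b[%classic : set R) s)%:E)%E.
  apply: eq_integral => s _; rewrite indicE mem_setE in_itv/= leNgt.
  case: (ltP s a) => sa /=; last by rewrite sub0r normrN normr_nat.
  by rewrite (lt_le_trans sa ab) subrr normr0.
rewrite integral_indic//.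
have -> : `[a, b[%classic `&` `]0%R, +oo[%classic =
    (if 0 < a then `[a, b[%classic else `]0, b[%classic) :> set R.
  apply/seteqP; split => s /=; rewrite !in_itv/= ?andbT.
    by case: ifP => _ [/andP[sa sb] s0]; rewrite /= in_itv/= ?sa ?sb ?s0.
  case: ifPn => a1 /=; rewrite in_itv/= => /andP[sa sb].
    by rewrite sa sb (lt_le_trans a1 sa).
  by rewrite sa sb andbT; split => //; apply: (le_trans _ (ltW sa)); rewrite leNgt.
rewrite distrC ger0_norm ?subr_ge0//.
case: ifPn => a1; apply: (etrans (lebesgue_measure_itv _)); rewrite /= lte_fin.
  case: ltP => // ba; congr EFin; apply/eqP; rewrite eq_sym subr_eq0.
  by rewrite eq_le ab ba.
have a_eq0 : a = 0 by apply/eqP; rewrite eq_le a0 andbT leNgt.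
rewrite a_eq0 subr0; case: ltP => [_|ba]; congr EFin; first by rewrite subr0.
by apply/eqP; rewrite eq_le ba b0.
Qed.

End layer_cake.

Section coarea.
Context (R : realType) (d : measure_display) (X : borelMetricType d R).
Variable mu : {sigma_finite_measure set X -> \bar R}.
Variables (delta : R) (eta : R -> R -> R) (p : R -> X -> X -> R).
Hypothesis eta_density : subordinator_density delta eta.
Hypothesis mp : measurable_fun [set z : R * (X * X) | 0 < z.1]
    (fun z => p z.1 z.2.1 z.2.2).
Hypothesis p0 : forall t x y, 0 < t -> 0 <= p t x y.
Implicit Types (f : X -> R) (s t : R).

Let nu : {sigma_finite_measure set (X * X)%type -> \bar R} := prod_measure mu mu.
Let leb := @lebesgue_measure R.
Let Dpos : set R := `]0, +oo[.
Let mD : measurable Dpos. Proof. exact: measurable_itv. Qed.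

Notation q := (subordinated_kernel eta p).

Lemma measurable_superlevel f s : measurable_fun setT f ->
  measurable (superlevel f s).
Proof.
move=> mf; rewrite (_ : superlevel f s = f @^-1` `]s, +oo[).
  by rewrite -[X in measurable X]setTI; exact: mf.
by apply/seteqP; split => x /=; rewrite in_itv/= andbT.
Qed.

Let level_gap f (w : R * (X * X)) : \bar R :=
  (gap \1_(superlevel f w.1) w.2)%:E.

Let level_gapE f s z :
  level_gap f (s, z) = `|(s < f z.1)%R%:R - (s < f z.2)%R%:R|%:E.
Proof. by rewrite /level_gap /gap /= !indicE !mem_setE. Qed.

Let measurable_level_gap f : measurable_fun setT f ->
  measurable_fun setT (level_gap f).
Proof.
move=> mf; pose S := [set u : R * X | u.1 < f u.2].
have mS : measurable S.
  rewrite (_ : S = (fun u : R * X => f u.2 - u.1) @^-1` `]0, +oo[).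
    rewrite -[X in measurable X]setTI.
    have mfu : measurable_fun setT (fun u : R * X => f u.2 - u.1).
      by apply: measurable_funB => //; exact: (measurableT_comp mf).
    exact: mfu.
  by apply/seteqP; split => u /=; rewrite in_itv/= andbT subr_gt0.
rewrite (_ : level_gap f = fun w =>
   `|\1_S (w.1, w.2.1) - \1_S (w.1, w.2.2)|%:E); last first.
  by apply/funext => -[s z]; rewrite level_gapE !indicE !mem_setE.
apply/measurable_EFinP; apply: measurableT_comp => //; apply: measurable_funB.
  apply: (measurableT_comp (measurable_indic mS)).
  apply: measurable_fun_pair => //; exact: measurableT_comp.
apply: (measurableT_comp (measurable_indic mS)).
apply: measurable_fun_pair => //; exact: measurableT_comp.
Qed.

Lemma ae_prod_both (Q : X -> Prop) : {ae mu, forall x, Q x} ->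
  {ae prod_measure mu mu, forall z : X * X, Q z.1 /\ Q z.2}.
Proof.
move=> [N [mN N0 QN]]; exists (N `*` setT `|` setT `*` N).
have m1 : measurable (N `*` [set: X]) by exact: measurableX.
have m2 : measurable ([set: X] `*` N) by exact: measurableX.
split; first exact: measurableU.
- have z1 : prod_measure mu mu (N `*` [set: X]) = 0%E.
    rewrite /prod_measure product_measure1E//.
    by rewrite [X in (X * _)%E](_ : _ = 0%E) ?mul0e.
  have z2 : prod_measure mu mu ([set: X] `*` N) = 0%E.
    rewrite /prod_measure product_measure1E//.
    by rewrite [X in (_ * X)%E](_ : _ = 0%E) ?mule0.
  apply/eqP; rewrite eq_le measure_ge0 andbT.
  apply: (le_trans (measureU2 _ m1 m2)).
  by rewrite [X in (X + _)%E](_ : _ = 0%E)// [X in (_ + X)%E](_ : _ = 0%E)// adde0.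
- move=> [x y] /= nQ; have [Qx|Qx] := pselect (Q x); last by left; split => //; exact: QN.
  by right; split => //; apply: QN => /= Qy; exact: nQ.
Qed.

Let int0 f t : 0 < t -> measurable_fun setT f ->
  measurable_fun (Dpos `*` [set: X * X])
    (fun w : R * (X * X) => level_gap f w * q t w.2.1 w.2.2)%E.
Proof.
move=> t0 mf; apply: emeasurable_funM; apply: measurable_funTS.
  exact: measurable_level_gap.
apply: (@measurableT_comp _ _ _ _ _ _ (fun z : X * X => q t z.1 z.2) _ snd) => //.
exact: (measurable_sub_kernel eta_density mp p0).
Qed.

Let int_ge0 f t w : 0 < t -> (0 <= level_gap f w * q t w.2.1 w.2.2)%E.
Proof.
move=> t0; rewrite mule_ge0//; first by rewrite lee_fin gap_ge0.
exact: (sub_kernel_ge0 eta_density p0).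
Qed.

Let sub_energy_level f t s : 0 < t -> measurable_fun setT f ->
  sub_energy mu eta p \1_(superlevel f s) t =
  (\int[nu]_z (level_gap f (s, z) * q t z.1 z.2))%E.
Proof.
move=> t0 mf; rewrite (sub_energy_prod mu eta_density mp p0)//.
exact/measurable_indic/measurable_superlevel.
Qed.

Lemma measurable_sub_energy_level f t : 0 < t -> measurable_fun setT f ->
  measurable_fun Dpos (fun s => sub_energy mu eta p \1_(superlevel f s) t).
Proof.
move=> t0 mf.
rewrite (_ : (fun s => _) =
   (fun s => \int[nu]_z (level_gap f (s, z) * q t z.1 z.2))%E); last first.
  by apply/funext => s; exact: sub_energy_level.
apply: (@measurable_tonelli_inner _ _ _ _ _ nu Dpos setT
   (fun w : R * (X * X) => level_gap f w * q t w.2.1 w.2.2)%E) => //.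
- exact: int0.
- by move=> w _; exact: int_ge0.
Qed.

(** The layer-cake identity for |f x - f y| holds where f x and f y are
nonnegative, that is, for almost every pair; the rest is the Tonelli theorem. *)
Lemma sub_energy_coarea f t : 0 < t -> measurable_fun setT f ->
  {ae mu, forall x, 0 <= f x} ->
  sub_energy mu eta p f t =
  (\int[leb]_(s in Dpos) sub_energy mu eta p \1_(superlevel f s) t)%E.
Proof.
move=> t0 mf f0.
under [RHS]eq_integral => s _ do rewrite sub_energy_level//.
rewrite (@tonelli_sets _ _ _ _ _ leb nu Dpos setT
   (fun w : R * (X * X) => level_gap f w * q t w.2.1 w.2.2)%E)//; last 2 first.
- exact: int0.
- by move=> w _; exact: int_ge0.
rewrite (sub_energy_prod mu eta_density mp p0)//.
have mq := measurable_sub_kernel eta_density mp p0 t0.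
have q0 (z : X * X) : (0 <= q t z.1 z.2)%E by exact: (sub_kernel_ge0 eta_density p0).
have mlevel z : measurable_fun Dpos (fun s => level_gap f (s, z)).
  apply: measurable_funTS.
  apply: (@measurableT_comp _ _ _ _ _ _ (level_gap f) _ (fun s => (s, z))).
    exact: measurable_level_gap.
  exact: pair2_measurable.
have level0 s z : (0 <= level_gap f (s, z))%E by rewrite lee_fin gap_ge0.
apply: ge0_ae_eq_integral => //.
- apply: emeasurable_funM => //; apply/measurable_EFinP; exact: measurable_gap.
- have mswap : measurable_fun ([set: X * X] `*` Dpos)
      (fun w : (X * X) * R => level_gap f (w.2, w.1) * q t w.1.1 w.1.2)%E.
    apply: measurable_funTS; apply: emeasurable_funM.
      apply: (measurableT_comp (measurable_level_gap mf)).
      exact: measurable_fun_pair.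
    exact: (measurableT_comp mq).
  apply: (@measurable_tonelli_inner _ _ _ _ _ leb setT Dpos
    (fun w : (X * X) * R => level_gap f (w.2, w.1) * q t w.1.1 w.1.2)%E) => //.
  by move=> w _; exact: (int_ge0 f (w.2, w.1) t0).
- by move=> z _; rewrite mule_ge0// lee_fin gap_ge0.
- by move=> z _; apply: integral_ge0 => s _; rewrite mule_ge0.
apply: filterS (ae_prod_both f0) => z [fz1 fz2] _ /=.
rewrite ge0_integralZr//; last exact: mlevel.
congr (_ * _)%E; rewrite /gap -integral_level_gap//; apply: eq_integral => s _.
by rewrite level_gapE.
Qed.

End coarea.

(** * Weak monotonicity for indicators *)

Section liminf_tools.
Local Open Scope ereal_scope.
Context (R : realType).
Implicit Types (u : nat -> \bar R).

Lemma limn_einf_supE u : limn_einf u = ereal_sup (range (einfs u)).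
Proof. by rewrite limn_einf_lim; apply/cvg_lim => //; exact: cvg_einfs_sup. Qed.

Lemma limn_einf_le_ub u (B : \bar R) : (forall n, u n <= B) -> limn_einf u <= B.
Proof.
move=> uB; rewrite limn_einf_supE; apply: ge_ereal_sup => _ [n _ <-].
by apply: (le_trans _ (uB n)); apply: ereal_inf_lbound; exists n => /=.
Qed.

Lemma limn_einf_ge0 u : (forall n, 0 <= u n) -> 0 <= limn_einf u.
Proof.
move=> u0; rewrite limn_einf_supE; apply: le_ereal_sup_tmp.
by exists (einfs u 0%N); [exists 0%N|apply: le_ereal_inf_tmp => _ [n _ <-]].
Qed.

Lemma limn_einf_lt_often u (M : \bar R) (n : nat) : limn_einf u < M ->
  exists2 k, (n <= k)%N & u k < M.
Proof.
rewrite limn_einf_supE => uM.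
have : einfs u n < M by apply: le_lt_trans uM; apply: ereal_sup_ubound; exists n.
by move=> /ereal_inf_lt[_ [k /= nk <-]] ukM; exists k.
Qed.

End liminf_tools.

Section rescaled_energy.
Context (R : realType) (d : measure_display) (X : borelMetricType d R).
Variable mu : {sigma_finite_measure set X -> \bar R}.
Variables (delta : R) (eta : R -> R -> R) (p : R -> X -> X -> R) (alpha : R).
Hypothesis eta_density : subordinator_density delta eta.
Hypothesis p0 : forall t x y, 0 < t -> 0 <= p t x y.
Implicit Types (f : X -> R).
Notation q := (subordinated_kernel eta p).

Let tau (n : nat) : R := n.+1%:R^-1.
Let tau0 n : 0 < tau n. Proof. by rewrite invr_gt0. Qed.

(** Sampling at the times 1 / (n + 1) makes the lower limit measurable in the level
and the Fatou lemma applicable. *)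
Definition rescaled_energy f (n : nat) : \bar R :=
  ((tau n `^ (- alpha))%:E * sub_energy mu eta p f (tau n))%E.

Lemma rescaled_energy_ge0 f n : (0 <= rescaled_energy f n)%E.
Proof.
rewrite mule_ge0 ?lee_fin ?powR_ge0//.
exact: (sub_energy_ge0 mu eta_density p0).
Qed.

Lemma rescaled_energy_le_besov_norm f n :
  (rescaled_energy f n <= besov_norm mu q 1 alpha f)%E.
Proof.
rewrite (besov_normE mu eta_density p0); apply: ereal_sup_ubound.
by exists (tau n) => //=; exact: tau0.
Qed.

End rescaled_energy.

Section weak_monotonicity.
Context (R : realType) (d : measure_display) (X : borelMetricType d R).
Variable mu : {sigma_finite_measure set X -> \bar R}.
Variables (delta b e L : R) (eta : R -> R -> R) (p : R -> X -> X -> R).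
Variables (dH dW c3 c4 c5 c6 : R).
Hypothesis c50 : 0 < c5.
Hypothesis HB : forall t x y, 0 < t ->
  c5 * t `^ (- (dH / dW)) * expR (- (c6 * stretch dW t (mdist x y))) <=
  p t x y <=
  c3 * t `^ (- (dH / dW)) * expR (- (c4 * stretch dW t (mdist x y))).
Hypothesis mp : measurable_fun [set z : R * (X * X) | 0 < z.1]
    (fun z => p z.1 z.2.1 z.2.2).
Hypothesis mp2 : forall t, 0 < t ->
  measurable_fun [set: X * X] (fun z => p t z.1 z.2).
Hypothesis psym : forall t x y, 0 < t -> p t x y = p t y x.
Hypothesis delta_range : 0 < delta < 1.
Hypothesis eta_density : subordinator_density delta eta.
Hypotheses (b0 : 0 < b) (bd : b < delta) (e0 : 0 < e) (L0 : 0 < L).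
Hypothesis loss_le : forall (A : set X) t, measurable A -> 0 < t ->
  (heat_loss mu p A t <= mu A)%E.
Hypothesis near_monotone : forall (A : set X) t h, measurable A ->
  (mu A < +oo)%E -> 0 < t -> 0 < h -> h <= e * t ->
  (heat_loss mu p A t <= (L * (t / h) `^ b)%:E * heat_loss mu p A h)%E.

Implicit Types (f : X -> R) (s t r : R).
Notation q := (subordinated_kernel eta p).
Notation alpha := (b / delta).
Notation energies := (rescaled_energy mu eta p alpha).

Let p0 t x y : 0 < t -> 0 <= p t x y. Proof. exact: (heat_kernel_ge0 c50 HB). Qed.
Let delta0 : 0 < delta. Proof. by have /andP[] := delta_range. Qed.

(** Fix s.  If t is so small that the window around t^(1/delta) lies below e * s,
the loss at s is dominated, through near-monotonicity, by the loss at every time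
of the window, hence by the subordinated energy at t.  This gives a heat energy
of order s^b for all s, and the moment of order b < delta concludes. *)
Lemma indicator_besov_norm_le : exists2 C : R, 0 < C &
  forall (A : set X) (M : R), measurable A -> (mu A < +oo)%E -> 0 <= M ->
  (forall r : R, 0 < r -> exists t, [/\ 0 < t, t < r &
     (sub_energy mu eta p \1_A t <= (M * t `^ alpha)%:E)%E]) ->
  (besov_norm mu q 1 alpha \1_A <= (C * M)%:E)%E.
Proof.
have [K K0 KP] := besov_norm_le_heat_energy mu c50 HB mp mp2 delta_range eta_density
  (ltW b0) bd.
have [a [B [c [a0 aB c0 win]]]] := sub_energy_window mu c50 HB mp mp2 delta_range eta_density.
have B0 : 0 < B by apply: lt_le_trans aB.
have cab : 0 < c * a `^ b by rewrite mulr_gt0// powR_gt0.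
exists (K * (L / (c * a `^ b))); first by rewrite mulr_gt0// divr_gt0.
move=> A M mA fA M0 often.
have m1A : measurable_fun setT (\1_A : X -> R) by exact: measurable_indic.
rewrite -mulrA; apply: KP => // [|s s0].
  by rewrite mulr_ge0// divr_ge0// ltW.
have hE t : 0 < t -> heat_energy mu p \1_A t = (2%:E * heat_loss mu p A t)%E.
  by move=> t0; exact: (heat_energy_indic mu c50 HB psym mp2 mA t0).
have loss0 t : 0 < t -> (0 <= heat_loss mu p A t)%E.
  by move=> t0; exact: (heat_loss_ge0 mu p0).
have fs : heat_energy mu p \1_A s \is a fin_num.
  rewrite hE// fin_numM// ge0_fin_numE ?loss0//.
  exact: le_lt_trans (loss_le mA s0) fA.
pose v := fine (heat_energy mu p \1_A s).
have v0 : 0 <= v by apply/fine_ge0/(heat_energy_ge0 mu p0).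
have vE : heat_energy mu p \1_A s = v%:E by rewrite fineK.
(* t < r means that the window [a T, B T] with T = t^(1/delta) lies below e * s *)
pose r := (e * s / B) `^ delta.
have r0 : 0 < r by rewrite powR_gt0// divr_gt0// mulr_gt0.
have [t [t0 tr subM]] := often r r0.
pose T := t `^ delta^-1; have T0 : 0 < T by exact: powR_gt0.
have BT : B * T <= e * s.
  rewrite mulrC -ler_pdivlMr// /T.
  have -> : e * s / B = r `^ delta^-1.
    by rewrite /r -powRrM mulfV ?gt_eqF// powRr1// divr_ge0 ?mulr_ge0 ?ltW.
  by apply: le_powR; rewrite ?invr_ge0 ltW.
have aT0 : 0 < a * T by exact: mulr_gt0.
(* the lower bound on the heat energy in the window, given its value v at s *)
pose m := v / (L * (s / (a * T)) `^ b).
have ps : 0 < (s / (a * T)) `^ b by rewrite powR_gt0// divr_gt0.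
have m0 : 0 <= m by rewrite divr_ge0// mulr_ge0// ltW.
have window h : a * T <= h -> h <= B * T -> (m%:E <= heat_energy mu p \1_A h)%E.
  move=> ah hB; have h0 : 0 < h by exact: lt_le_trans ah.
  have nm := near_monotone mA fA s0 h0 (le_trans hB BT).
  have nm2 : (heat_energy mu p \1_A s <=
      (L * (s / (a * T)) `^ b)%:E * heat_energy mu p \1_A h)%E.
    rewrite !hE// muleCA; apply: lee_wpmul2l => //; apply: (le_trans nm).
    apply: lee_wpmul2r; first exact: loss0.
    rewrite lee_fin ler_wpM2l ?(ltW L0)//; apply: le_powR; rewrite ?(ltW b0)//.
      by rewrite divr_ge0 ?ltW.
    by rewrite ler_wpM2l ?(ltW s0)// lef_pV2.
  have Lp : 0 < L * (s / (a * T)) `^ b by exact: mulr_gt0.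
  by move: nm2; rewrite vE -lee_pdivrMl// -EFinM mulrC.
have low := win \1_A t m m1A t0 m0 window.
move: (le_trans low subM); rewrite vE !lee_fin => cm.
have Ta : t `^ alpha = T `^ b by rewrite /T -powRrM mulrC.
have Tb : 0 < T `^ b by exact: powR_gt0.
have sb : 0 < s `^ b by exact: powR_gt0.
have ab : 0 < a `^ b by exact: powR_gt0.
have psE : (s / (a * T)) `^ b = s `^ b / (a `^ b * T `^ b).
  rewrite powRM ?invr_ge0 ?(ltW s0) ?(ltW aT0)//; congr (_ * _).
  rewrite -[(a * T)^-1]powR_inv1 ?(ltW aT0)// -powRrM mulN1r powRN.
  by rewrite powRM ?(ltW a0) ?(ltW T0).
move: cm; rewrite Ta /m psE => cm.
have : c * (v / (L * (s `^ b / (a `^ b * T `^ b)))) = (v * (c * a `^ b) / (L * s `^ b)) * T `^ b.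
  by field; rewrite !gt_eqF.
move=> cE; move: cm; rewrite cE ler_pM2r// ler_pdivrMr ?mulr_gt0// -ler_pdivlMr// => h.
apply: (le_trans h); rewrite le_eqVlt; apply/orP; left; apply/eqP; field.
by rewrite !gt_eqF.
Qed.

(** Below any bound larger than the lower limit there are energies at arbitrarily
small times of the sequence, which is all that the previous lemma asks for. *)
Lemma indicator_besov_norm_le_liminf : exists2 C : R, 0 < C &
  forall A : set X, measurable A -> (mu A < +oo)%E ->
  (besov_norm mu q 1 alpha \1_A <= C%:E * limn_einf (energies \1_A))%E.
Proof.
have [C C0 CP] := indicator_besov_norm_le; exists C => // A mA fA.
have l0 : (0 <= limn_einf (energies \1_A))%E.
  by apply: limn_einf_ge0 => n; exact: (rescaled_energy_ge0 mu _ eta_density p0).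
move lE : (limn_einf (energies \1_A)) => l; rewrite lE in l0.
case: l lE l0 => [l| |]// lE l0; last by rewrite gt0_muley ?lte_fin// leey.
rewrite -EFinM; apply/lee_addgt0Pr => eps eps0.
have l0' : 0 <= l by rewrite -lee_fin.
pose M := l + eps / C.
have M0 : 0 <= M by rewrite addr_ge0// divr_ge0 ?ltW.
have -> : ((C * l)%:E + eps%:E = (C * M)%:E)%E.
  by rewrite -EFinD; congr EFin; rewrite /M; field; rewrite gt_eqF.
apply: CP => // r r0.
have lM : (limn_einf (energies \1_A) < M%:E)%E.
  by rewrite lE lte_fin /M ltrDl divr_gt0.
have [k nk ukM] := limn_einf_lt_often (Num.bound r^-1) lM.
exists k.+1%:R^-1; split => //.
  rewrite -[ltRHS]invrK ltf_pV2 ?posrE ?invr_gt0//.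
  rewrite (le_lt_trans (ler_norm _))// (lt_le_trans (unstable.ltr_norm_bound _))//.
  by rewrite ler_nat leqW.
have tp : 0 < k.+1%:R^-1 `^ alpha by rewrite powR_gt0// invr_gt0.
move: (ltW ukM); rewrite /rescaled_energy powRN lee_pdivrMl//.
by rewrite -EFinM mulrC.
Qed.

End weak_monotonicity.

(** * Besov norms through superlevel sets *)

Section superlevel_tools.
Context (R : realType) (d : measure_display) (X : borelMetricType d R).
Variable mu : {sigma_finite_measure set X -> \bar R}.
Implicit Types (f : X -> R) (s : R).

Lemma superlevel_finite f s : f \in Lfun mu 1%:E -> 0 < s ->
  (mu (superlevel f s) < +oo)%E.
Proof.
move=> fL s0; have [mf [N N0 fN]] := Lfun1_facts fL.
have mS := measurable_superlevel s mf.
have mabs : measurable_fun setT (fun x => `|f x|%:E).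
  by apply/measurable_EFinP; exact: measurableT_comp.
have h : (s%:E * mu (superlevel f s) <= N%:E)%E.
  apply: le_trans fN.
  apply: (@le_trans _ _ (\int[mu]_(x in superlevel f s) `|f x|%:E)%E).
    apply: ge0_le_cst_integral => //; first exact: measurable_funTS.
      exact: ltW.
    by move=> x /= sx; rewrite lee_fin (le_trans (ltW sx))// ler_norm.
  by apply: ge0_subset_integral.
apply: (@le_lt_trans _ _ (s^-1 * N)%:E); last exact: ltry.
by rewrite EFinM lee_pdivlMl.
Qed.

Lemma indic_Lfun1 (A : set X) : measurable A -> (mu A < +oo)%E ->
  (\1_A : X -> R) \in Lfun mu 1%:E.
Proof.
move=> mA fA; apply/Lfun1_integrable/integrableP; split.
  by apply/measurable_EFinP; exact: measurable_indic.
rewrite (eq_integral (fun x => (\1_A x)%:E)) ?integral_indic ?setIT// => x _.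
by rewrite /= ger0_norm// indicE ler0n.
Qed.

End superlevel_tools.

Section besov_coarea.
Context (R : realType) (d : measure_display) (X : borelMetricType d R).
Variable mu : {sigma_finite_measure set X -> \bar R}.
Variables (delta alpha C : R) (eta : R -> R -> R) (p : R -> X -> X -> R).
Hypothesis eta_density : subordinator_density delta eta.
Hypothesis mp : measurable_fun [set z : R * (X * X) | 0 < z.1]
    (fun z => p z.1 z.2.1 z.2.2).
Hypothesis p0 : forall t x y, 0 < t -> 0 <= p t x y.
Notation q := (subordinated_kernel eta p).
Notation Dpos := (`]0, +oo[%classic : set R).
Notation leb := (@lebesgue_measure R).
Notation energies := (rescaled_energy mu eta p alpha).
Hypothesis C0 : 0 < C.
Hypothesis weak_monotone : forall A : set X, measurable A -> (mu A < +oo)%E ->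
  (besov_norm mu q 1 alpha \1_A <= C%:E * limn_einf (energies \1_A))%E.
Variable f : X -> R.
Hypothesis fL : f \in Lfun mu 1%:E.
Hypothesis f0 : {ae mu, forall x, 0 <= f x}.

Let mf : measurable_fun setT f. Proof. by have [] := Lfun1_facts fL. Qed.
Let mD : measurable Dpos. Proof. exact: measurable_itv. Qed.
Let D0 s : Dpos s -> 0 < s. Proof. by rewrite /= in_itv/= andbT. Qed.
Let perimeter s := besov_norm mu q 1 alpha \1_(superlevel f s).
Let lower_limit s := limn_einf (energies \1_(superlevel f s)).

Let scaled_coarea (a t : R) : 0 <= a -> 0 < t ->
  (a%:E * sub_energy mu eta p f t =
   \int[leb]_(s in Dpos) (a%:E * sub_energy mu eta p \1_(superlevel f s) t))%E.
Proof.
move=> a0 t0; rewrite (sub_energy_coarea eta_density mp p0 t0 mf f0).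
rewrite ge0_integralZl//.
- exact: (measurable_sub_energy_level mu eta_density mp p0 t0 mf).
- by move=> s _; exact: (sub_energy_ge0 mu eta_density p0).
Qed.

Lemma besov_norm_le_perimeter_integral :
  (besov_norm mu q 1 alpha f <= \int[leb]_(s in Dpos) perimeter s)%E.
Proof.
rewrite {1}(besov_normE mu eta_density p0); apply: ge_ereal_sup => _ [t /= t0 <-].
rewrite scaled_coarea ?powR_ge0//; apply: ge0_le_integral_any => s _.
  by rewrite mule_ge0 ?lee_fin ?powR_ge0//; exact: (sub_energy_ge0 mu eta_density p0).
rewrite /perimeter (besov_normE mu eta_density p0); apply: ereal_sup_ubound.
by exists t.
Qed.

Let perimeter_le s : Dpos s -> (perimeter s <= C%:E * lower_limit s)%E.
Proof.
move=> /D0 s0; apply: weak_monotone; first exact: measurable_superlevel.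
exact: superlevel_finite.
Qed.

Let energies_ge0 s n : (0 <= energies \1_(superlevel f s) n)%E.
Proof. exact: (rescaled_energy_ge0 mu alpha eta_density p0). Qed.

Let lower_limit_ge0 s : (0 <= lower_limit s)%E.
Proof. exact/limn_einf_ge0/energies_ge0. Qed.

Let measurable_energies n :
  measurable_fun Dpos (fun s => energies \1_(superlevel f s) n).
Proof.
apply: measurable_funeM.
by apply: (measurable_sub_energy_level mu eta_density mp p0 _ mf); rewrite invr_gt0.
Qed.

Let measurable_lower_limit : measurable_fun Dpos lower_limit.
Proof.
apply: (measurableT_comp (f := -%E)) => //.
apply: measurable_fun_limn_esup => n; exact: measurableT_comp.
Qed.

Lemma lower_limit_integral_le :
  (\int[leb]_(s in Dpos) lower_limit s <= besov_norm mu q 1 alpha f)%E.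
Proof.
apply: (le_trans (fatou leb mD measurable_energies (fun n s _ => energies_ge0 s n))).
apply: limn_einf_le_ub => n.
rewrite -scaled_coarea ?powR_ge0 ?invr_gt0//.
exact: (rescaled_energy_le_besov_norm mu alpha eta_density p0).
Qed.

Lemma perimeter_integral_le_besov_norm :
  (C^-1%:E * \int[leb]_(s in Dpos) perimeter s <= besov_norm mu q 1 alpha f)%E.
Proof.
rewrite lee_pdivrMl//.
apply: (@le_trans _ _ (\int[leb]_(s in Dpos) (C%:E * lower_limit s))%E).
  apply: ge0_le_integral_any => s sD; last exact: perimeter_le.
  exact: (besov_norm_ge0 mu eta_density p0).
rewrite ge0_integralZl ?lee_fin ?(ltW C0)//.
by rewrite lee_wpmul2l ?lee_fin ?(ltW C0)//; exact: lower_limit_integral_le.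
Qed.

(** The dominating lower limit is measurable, so the finiteness of its integral
makes it finite almost everywhere. *)
Lemma superlevel_besov : (besov_norm mu q 1 alpha f < +oo)%E ->
  {ae leb, forall s, 0 < s -> besov mu q 1 alpha \1_(superlevel f s)}.
Proof.
move=> fB.
have /integrable_ae : leb.-integrable Dpos lower_limit.
  apply/integrableP; split => //.
  under eq_integral do rewrite gee0_abs//.
  exact: le_lt_trans lower_limit_integral_le fB.
move=> /(_ mD); apply: filterS => s fin s0.
have sD : Dpos s by rewrite /= in_itv/= s0.
have mS := measurable_superlevel s mf.
split; first exact: (indic_Lfun1 mS (superlevel_finite fL s0)).
apply: (le_lt_trans (perimeter_le sD)).
by rewrite -ge0_fin_numE ?mule_ge0 ?lee_fin ?(ltW C0)// fin_numM// fin.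
Qed.

End besov_coarea.

(** * The coarea theorem *)

Theorem theorem4p6 (R : realType) (d : measure_display)
  (X : borelMetricType d R) (mu : {sigma_finite_measure set X -> \bar R})
  (E : (X -> R) -> (X -> R) -> R) (F : set (X -> R))
  (P : R -> (X -> R) -> X -> R) (p : R -> X -> X -> R)
  (dH dW kappa delta : R) (eta : R -> R -> R)
  (X_lc : locally_compact [set: X])
  (mu_radon : radon_measure mu)
  (mu_support : full_support mu)
  (E_dirichlet : dirichlet_form mu E F)
  (P_heat : heat_semigroup mu E F P)
  (A1 : forall (x : X) (r : R), compact (closure (ball x r)))
  (A2 : ahlfors_regular mu dH)
  (A3_regular : regular_form mu E F)
  (A3_local : strongly_local mu E F)
  (HK_kernel : continuous_heat_kernel mu P p)
  (HK_bounds : heat_kernel_bounds mu p dH dW)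
  (kappa_range : 0 < kappa < dW)
  (kappa_def : (dW - kappa)%:E = KS_critical_exponent mu 1)
  (BE : weak_bakry_emery mu p dW kappa)
  (delta_range : 0 < delta < 1)
  (eta_density : subordinator_density delta eta) :
  let q := subordinated_kernel eta p in
  let alpha1 := fine (besov_critical_exponent mu q 1) in
  let perimeter_integral (f : X -> R) :=
    (\int[lebesgue_measure]_(t in `]0%R, +oo[)
       besov_norm mu q 1 alpha1 \1_(superlevel f t))%E in
  (besov_critical_exponent mu q 1 < 1)%E ->
  [/\ exists C1 C2 : R, [/\ 0 < C1, 0 < C2
        & forall f : X -> R, f \in Lfun mu 1%:E ->
            {ae mu, forall x, 0 <= f x} ->
            (C1%:E * perimeter_integral f <= besov_norm mu q 1 alpha1 f
               <= C2%:E * perimeter_integral f)%E],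
      forall f : X -> R, besov mu q 1 alpha1 f ->
        {ae mu, forall x, 0 <= f x} ->
        {ae (@lebesgue_measure R), forall t, 0 < t ->
           besov mu q 1 alpha1 \1_(superlevel f t)}
    & forall f : X -> R, f \in Lfun mu 1%:E ->
        {ae mu, forall x, 0 <= f x} ->
        {ae (@lebesgue_measure R), forall t, 0 < t ->
           besov mu q 1 alpha1 \1_(superlevel f t)} ->
        (perimeter_integral f < +oo)%E ->
        besov mu q 1 alpha1 f].
Proof.
move=> q alpha1 perimeter_integral crit1.
have [dH0 [c1 [c2 [c10 c20 ahl]]]] := A2.
have [dW2 [c3 [c4 [c5 [c6 [c30 c40 c50 c60 HB]]]]]] :=
  heat_kernel_bounds_everywhere HK_kernel.1 mu_support HK_bounds.
have dW0 : 0 < dW by lra.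
have /andP[kappa0 kappaW] := kappa_range.
have [C C0 BEC] := BE.
have p0 := heat_kernel_ge0 c50 HB.
have ball_fin := ball_lty ahl.
have mp := measurable_continuous_kernel A1 HK_kernel.1.
have mp2 t (t0 : 0 < t) := measurable_heat2 A1 HK_kernel t0.
have psym t x y (t0 : 0 < t) :=
  heat_kernel_sym A1 mu_support P_heat HK_kernel p0 ball_fin x y t0.
have mass1 s (s0 : 0 < s) := heat_mass_eq1 A1 P_heat HK_kernel dH0 dW2 kappa0
  c10 c20 c30 c40 c50 c60 ahl HB C0 BEC s0.
have holder := heat_mass_holder A1 HK_kernel dH0 dW2 c10 c20 c30 c40 c50 c60
  ahl HB C0 BEC.
have CK := heat_mass_semigroup A1 P_heat HK_kernel p0.
(* used without weight and with the weight d^kappa, at the same dilation *)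
have [c c0 dil] := heat_kernel_dilation dH0 dW2 c30 c40 c50 c60 HB.
have [K0 K00 dil0'] := dil 0 (lexx 0).
have [K1 K10 dil1] := dil kappa (ltW kappa0).
have dil0 t u x y : 0 < t -> c * t <= u -> u <= 2 * c * t ->
    p t x y <= K0 * p u x y.
  move=> t0 ct cu; have := dil0' t u x y t0 ct cu.
  by rewrite mul0r !powRr0 mul1r mulr1.
have [e [L [e0 L0 near_monotone]]] := heat_loss_near_monotone dW0 kappa_range mp2
  (measurable_mdist A1) p0 psym mass1 CK C0 holder c0 K00 K10 dil0 dil1.
have loss_le (A : set X) t : measurable A -> 0 < t -> (heat_loss mu p A t <= mu A)%E.
  move=> mA t0; rewrite (heat_content_loss mp2 p0 mass1 mA t0) leeDr//.
  exact: heat_content_ge0.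
pose b := 1 - kappa / dW.
have b0 : 0 < b by rewrite subr_gt0 ltr_pdivrMr// mul1r.
have [bd critE] := besov_critical_exponentE A1 dH0 dW2 c10 c20 c30 c40 c50 c60
  ahl HB mp mp2 delta_range eta_density kappa_range kappa_def crit1.
have alpha1E : alpha1 = b / delta by rewrite /alpha1 /q critE.
have [C' C'0 weak_monotone] := indicator_besov_norm_le_liminf c50 HB mp mp2 psym
  delta_range eta_density b0 bd e0 L0 loss_le near_monotone.
rewrite -alpha1E in weak_monotone.
have upper f : f \in Lfun mu 1%:E -> {ae mu, forall x, 0 <= f x} ->
    (besov_norm mu q 1 alpha1 f <= perimeter_integral f)%E.
  exact: (besov_norm_le_perimeter_integral alpha1 eta_density mp p0).
split.
- exists C'^-1, 1; split; rewrite ?invr_gt0// => f fL f0; rewrite mul1e.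
  rewrite upper// andbT.
  exact: (perimeter_integral_le_besov_norm eta_density mp p0 C'0 weak_monotone).
- move=> f [fL fB] f0.
  exact: (superlevel_besov eta_density mp p0 C'0 weak_monotone).
- move=> f fL f0 _ fin; split => //.
  exact: le_lt_trans (upper f fL f0) fin.
Qed.
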